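(* Let $\Phi:\{2,3,4,\dots\}\to(0,\infty)$ be an increasing positive function and let $H>0$. Then $$\lim_{N\to\infty}\ \min_{|a_n|\le\Phi(n)}\ \int_0^H\left|1+\sum_{n=2}^N a_n n^{it-1}\right|^2dt>0$$ if and only if $$\sum_{n=2}^\infty\frac{\log\Phi(n)}{n\log^2 n}<\infty .$$
   Context: For each $N\ge 2$ the minimum is taken over all complex numbers $a_2,\dots,a_N$ with $|a_n|\le\Phi(n)$ for $2\le n\le N$. *)

(* Defs.v *)
From mathcomp Require Import all_boot all_order all_algebra.
From mathcomp Require Export complex.
From mathcomp Require Export all_classical all_reals all_analysis.

Set Implicit Arguments.
Unset Strict Implicit.
Unset Printing Implicit Defensive.

Import Order.TTheory GRing.Theory Num.Theory.
Import numFieldNormedType.Exports.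

Local Open Scope classical_set_scope.
Local Open Scope ring_scope.
Local Open Scope complex_scope.

Definition cexp (R : realType) (z : R[i]) : R[i] :=
  (expR (complex.Re z))%:C * (cos (complex.Im z) +i* sin (complex.Im z)).

(* The power n^s with the real logarithm; only used for n >= 2, whereas ln 0 is
   a junk value. *)
Definition natpowC (R : realType) (n : nat) (s : R[i]) : R[i] :=
  cexp (s * (ln (n%:R : R))%:C).

(* Only the values of a on 2 <= n <= N matter. *)
Definition dirichlet_poly (R : realType) (a : nat -> R[i]) (N : nat) (t : R) :
    R[i] :=
  1 + \sum_(2 <= n < N.+1) a n * natpowC n ('i%C * t%:C - 1).

(* normc is the R-valued modulus; the norm `| _ | of R[i] takes values in
   R[i]. *)
Definition mean_square (R : realType) (H : R) (N : nat) (a : nat -> R[i]) : R :=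
  \int[lebesgue_measure]_(t in `[0, H]) (Normc.normc (dirichlet_poly a N t) ^+ 2).

Definition admissible (R : realType) (Phi : nat -> R) (N : nat) :
    set (nat -> R[i]) :=
  [set a | forall n, (2 <= n <= N)%N -> Normc.normc (a n) <= Phi n].

Definition is_minimum (R : realType) (S : set R) (x : R) : Prop :=
  S x /\ lbound S x.

(* Main.v *)
(* Convergence gives a lower bound. Suitable averages over short real shifts
   turn 1 + sum a_n n^(it-1) into a Dirichlet polynomial G with constant term 1
   and with a uniformly bounded sum of coefficients (Ingham's compactly
   supported functions with Fourier transform decaying like 1 / Phi), without
   increasing the mean square on a shorter interval. Since the frequencies
   log n are nonnegative, G is bounded in the upper half-plane and tends to 1
   high up, so by a two-constants argument it cannot be small on an interval.

   Divergence forces the limit to be 0. The first order condition at a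
   minimiser F says that f(x) = int conj(F(t)) e^(itx) dt satisfies
   mu + sum_n Phi(n) / n |f(log n)| <= Re f(0). Hence |f| is, on average, at
   most about 1 / Phi(e^x) for large x > 0, while f is bounded in the upper
   half-plane and not small near 0. Comparing log |f| with a sum of explicit
   harmonic functions, one at each scale log 2^j, bounds the sum of
   log Phi(2^j) / j^2.

   Both arguments only need the maximum principle for finite sums of moduli of
   functions with a second order complex Taylor expansion. Integrals over t are
   replaced by Riemann sums. *)
Require Import Defs.
From mathcomp Require Import all_boot all_order all_algebra.
From mathcomp Require Import all_classical all_reals all_analysis.
From mathcomp Require Import ring lra.
Import Order.TTheory GRing.Theory Num.Theory.
Import numFieldNormedType.Exports.
Local Open Scope classical_set_scope.
Local Open Scope ring_scope.
Set Implicit Arguments.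
Unset Strict Implicit.
Unset Printing Implicit Defensive.
Import Normc.

(** * Complex numbers and elementary Taylor bounds *)

(** No logarithm of a modulus is taken: comparing log |f| with a harmonic function Re W is done as a
    maximum principle for |f exp W|. Neither direction controls one function pointwise, only an
    average of |f| over shifts or a mean square of G, which is why sums of moduli occur.
    Discretising before minimising makes f a finite exponential sum; the price is half of mu. On the
    real axis f is controlled only at the points log n and between them by its Lipschitz constant,
    so averages near x carry an error of order exp(-x) and no faster decay is visible. Hence log
    Phi(2^j) is capped at j log 2; monotonicity shows afterwards that bounded capped sums reach the
    cap only finitely often. In the converse the averaging lengths must add up to a fraction of H,
    while a gain 1 / Phi(n) is wanted at every large n. In a double dyadic range log n is comparable
    to 2^k, so one length 32 / 2^k serves the whole range; the cost is about log Phi(2^(2^(k+1))) /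
    2^k, the general term of the series condensed twice. *)

Lemma normc_ge0 (R : rcfType) (z : R[i]) : 0 <= normc z.
Proof. by case: z => x y /=; rewrite sqrtr_ge0. Qed.

Lemma sqr_normcE (R : rcfType) (z : R[i]) :
  normc z ^+ 2 = complex.Re z ^+ 2 + complex.Im z ^+ 2.
Proof. by case: z => x y /=; rewrite sqr_sqrtr // addr_ge0 ?sqr_ge0. Qed.

Lemma normcB (R : rcfType) (x y : R[i]) : normc (x - y) <= normc x + normc y.
Proof. by rewrite -[normc y]normcN; exact: le_normcD. Qed.

Lemma normcX (R : rcfType) (x : R[i]) n : normc (x ^+ n) = normc x ^+ n.
Proof.
elim: n => [|n IH]; first by rewrite !expr0 normc1.
by rewrite !exprS normcM IH.
Qed.

Lemma normc_real (R : rcfType) (x : R) : normc (real_complex R x) = `|x|.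
Proof. by rewrite /= expr0n /= addr0 sqrtr_sqr. Qed.

Lemma normc_sum (R : rcfType) (I : Type) (r : seq I) (P : pred I) (F : I -> R[i]) :
  normc (\sum_(i <- r | P i) F i) <= \sum_(i <- r | P i) normc (F i).
Proof.
elim/big_rec2: _ => [|i y z _ H]; first by rewrite normc0.
by apply: le_trans (le_normcD _ _) _; rewrite lerD2l.
Qed.

Lemma ge_normc_Re (R : rcfType) (z : R[i]) : `|complex.Re z| <= normc z.
Proof.
rewrite -(@ler_pXn2r _ 2) ?nnegrE ?normc_ge0 //.
by rewrite sqr_normcE real_normK ?num_real // lerDl sqr_ge0.
Qed.

Lemma ge_normc_Im (R : rcfType) (z : R[i]) : `|complex.Im z| <= normc z.
Proof.
rewrite -(@ler_pXn2r _ 2) ?nnegrE ?normc_ge0 //.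
by rewrite sqr_normcE real_normK ?num_real // lerDr sqr_ge0.
Qed.

Lemma normc_le_ReIm (R : rcfType) (z : R[i]) :
  normc z <= `|complex.Re z| + `|complex.Im z|.
Proof.
rewrite -(@ler_pXn2r _ 2) ?nnegrE ?normc_ge0 ?addr_ge0 //.
rewrite sqr_normcE sqrrD !real_normK ?num_real //.
rewrite [leRHS]addrAC lerDl mulrn_wge0 // mulr_ge0 //.
Qed.

Lemma ler_dist_normc (R : rcfType) (x y : R[i]) :
  `|normc x - normc y| <= normc (x - y).
Proof.
rewrite ler_norml; apply/andP; split.
  rewrite lerBrDr addrC lerBlDr; have := le_normcD (y - x) x.
  by rewrite subrK -[normc (y - x)]normcN opprB addrC.
by rewrite lerBlDr; have := le_normcD (x - y) y; rewrite subrK.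
Qed.

Lemma complex_eqP (R : rcfType) (x y : R[i]) :
  complex.Re x = complex.Re y -> complex.Im x = complex.Im y -> x = y.
Proof. by case: x y => [a b] [c d] /= -> ->. Qed.

Lemma Re_sum (R : rcfType) (I : Type) (r : seq I) (P : pred I) (F : I -> R[i]) :
  complex.Re (\sum_(i <- r | P i) F i) = \sum_(i <- r | P i) complex.Re (F i).
Proof.
elim/big_rec2: _ => // i y z _ <-; by case: (F i) z => [? ?] [? ?].
Qed.

Lemma ReD (R : rcfType) (x y : R[i]) :
  complex.Re (x + y) = complex.Re x + complex.Re y.
Proof. by case: x y => [a b] [c d]. Qed.

(** The mean value theorem between 0 and [x], used to climb from one Taylor remainder to the next.
    The factor 1 / (n + 1) of integration is given up, so the constants below are not sharp. *)
Lemma taylor_step (R : realType) (f df : R -> R) (C : R) (n : nat) (x : R) :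
  (forall y : R, is_derive y 1 f (df y)) -> f 0 = 0 -> 0 <= C ->
  (forall y, `|y| <= `|x| -> `|df y| <= C * `|y| ^+ n) ->
  `|f x| <= C * `|x| ^+ n.+1.
Proof.
move=> fd f0 C0 Hdf.
have cf : continuous f.
  by move=> y; apply: differentiable_continuous; apply/derivable1_diffP; case: (fd y).
have key (c : R) : `|c| <= `|x| -> `|df c| <= C * `|x| ^+ n.
  move=> cx; apply: (le_trans (Hdf _ cx)); rewrite ler_wpM2l //.
  by rewrite lerXn2r ?nnegrE.
have cW (a b : R) : {within `[a, b], continuous f}.
  exact: continuous_subspaceT.
have [x0|x0] := leP 0 x.
  have [c cx] := @MVT_segment R f df 0 x x0 (fun y _ => fd y) (cW _ _).
  rewrite f0 !subr0 => ->; rewrite normrM exprSr mulrA ler_wpM2r //.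
  apply: key; move: cx; rewrite in_itv /= => /andP[c0 cx].
  by rewrite !ger0_norm.
have [c cx] := @MVT_segment R f df x 0 (ltW x0) (fun y _ => fd y) (cW _ _).
rewrite f0 !sub0r => /(congr1 (fun u : R => `|u|)).
rewrite normrN => ->; rewrite normrM normrN exprSr mulrA ler_wpM2r //.
apply: key; move: cx; rewrite in_itv /= => /andP[c0 cx].
by rewrite !ler0_norm // ?lerN2 // ltW.
Qed.

Lemma norm_sin_le (R : realType) (x : R) : `|sin x| <= `|x|.
Proof.
have := @taylor_step R sin cos 1 0 x (fun y => is_derive_sin y) (sin0 R).
by rewrite expr1 mul1r; apply => // y _; rewrite expr0 mul1r cos_max.
Qed.

Lemma cosB1_le (R : realType) (x : R) : `|cos x - 1| <= `|x| ^+ 2.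
Proof.
rewrite -[leRHS]mul1r.
apply: (@taylor_step R (fun y => cos y - 1) (fun y => - sin y)) => //.
- by move=> y; apply: is_derive_eq; rewrite subr0.
- by rewrite cos0 subrr.
- by move=> y _; rewrite mul1r expr1 normrN norm_sin_le.
Qed.

Lemma sinB_le (R : realType) (x : R) : `|sin x - x| <= `|x| ^+ 3.
Proof.
rewrite -[leRHS]mul1r.
apply: (@taylor_step R (fun y => sin y - y) (fun y => cos y - 1)) => //.
- by rewrite sin0 subrr.
- by move=> y _; rewrite mul1r cosB1_le.
Qed.

Lemma cosB2_le (R : realType) (x : R) : `|cos x - 1 + x ^+ 2 / 2| <= `|x| ^+ 4.
Proof.
rewrite -[leRHS]mul1r.
apply: (@taylor_step R (fun y => cos y - 1 + y ^+ 2 / 2) (fun y => y - sin y)) => //.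
- move=> y; apply: is_derive_eq; rewrite /GRing.scale /=.
  by field.
- by rewrite cos0 subrr expr0n /= mul0r addr0.
- by move=> y _; rewrite mul1r distrC sinB_le.
Qed.

Lemma expR_le4 (R : realType) (x : R) : `|x| <= 1 -> expR x <= 4.
Proof.
move=> x1.
have x2 : `|x / 2| <= 1/2 by rewrite normrM [`|2^-1|]ger0_norm ?invr_ge0 // ler_pM2r.
have := expR_ge1Dx (- (x / 2)); rewrite expRN => h.
have h0 : 0 < expR (x/2) by exact: expR_gt0.
have h2 : expR (x / 2) <= 2.
  have /ler_normlP[h1 h2] := x2.
  rewrite -[expR _]invrK -[leRHS]invrK lef_pV2 ?posrE ?invr_gt0 //.
  by apply: le_trans h; lra.
have -> : expR x = expR (x / 2) * expR (x / 2) by rewrite -expRD; congr expR; field.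
have -> : (4 : R) = 2 * 2 by ring.
by apply: ler_pM; rewrite ?expR_ge0.
Qed.

Lemma expRB_le (R : realType) (x : R) : `|x| <= 1 ->
  [/\ `|expR x - 1| <= 4 * `|x|, `|expR x - 1 - x| <= 4 * `|x| ^+ 2
    & `|expR x - 1 - x - x ^+ 2 / 2| <= 4 * `|x| ^+ 3].
Proof.
move=> x1.
have h1 (y : R) : `|y| <= 1 -> `|expR y - 1| <= 4 * `|y| ^+ 1.
  move=> y1; apply: (@taylor_step R (fun y => expR y - 1) expR 4 0%N) => //.
  - by move=> z; apply: is_derive_eq; rewrite subr0.
  - by rewrite expR0 subrr.
  - by move=> z zy; rewrite expr0 mulr1 ger0_norm ?expR_ge0 // expR_le4 // (le_trans zy).
have h2 (y : R) : `|y| <= 1 -> `|expR y - 1 - y| <= 4 * `|y| ^+ 2.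
  move=> y1; apply: (@taylor_step R (fun y => expR y - 1 - y) (fun y => expR y - 1) 4 1%N) => //.
  - by move=> z; apply: is_derive_eq; rewrite subr0.
  - by rewrite expR0 !subrr.
  - by move=> z zy; apply: h1; rewrite (le_trans zy).
split; [exact: h1|exact: h2|].
apply: (@taylor_step R (fun y => expR y - 1 - y - y ^+ 2 / 2) (fun y => expR y - 1 - y) 4 2%N) => //.
- by move=> z; apply: is_derive_eq; rewrite /GRing.scale /=; field.
- by rewrite expR0 !subrr expr0n /= mul0r subr0.
- by move=> z zy; apply: h2; rewrite (le_trans zy).
Qed.

Lemma cexpD (R : realType) (x y : R[i]) : cexp (x + y) = cexp x * cexp y.
Proof.
case: x y => [a b] [c d]; apply: complex_eqP;
  rewrite /cexp /= expRD sinD cosD; ring.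
Qed.

Lemma cexp0 (R : realType) : cexp (0 : R[i]) = 1.
Proof. by apply: complex_eqP; rewrite /cexp /= expR0 sin0 cos0; ring. Qed.

Lemma normc_cexp (R : realType) (z : R[i]) : normc (cexp z) = expR (complex.Re z).
Proof.
rewrite /cexp normcM normc_real ger0_norm ?expR_ge0 //.
by rewrite [normc (_ +i* _)%C]/= cos2Dsin2 sqrtr1 mulr1.
Qed.

Lemma cexp_taylor_le (R : realType) (w : R[i]) : normc w <= 1 ->
  normc (cexp w - 1 - w - w ^+ 2 / 2%:R) <= 16 * normc w ^+ 3.
Proof.
move=> w1; set m := normc w.
rewrite -/m in w1; have m0 : 0 <= m by exact: normc_ge0.
pose x := complex.Re w; pose y := complex.Im w.
have xm : `|x| <= m by exact: ge_normc_Re.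
have ym : `|y| <= m by exact: ge_normc_Im.
have x1 : `|x| <= 1 by exact: le_trans xm _.
have [_ _ hE] := expRB_le x1.
pose E := expR x - 1 - x - x ^+ 2 / 2; rewrite -/E in hE.
pose c := cos y - 1 + y ^+ 2 / 2; pose s := sin y - y.
have m32 : m ^+ 3 <= m ^+ 2 by rewrite exprS ler_piMl // exprn_ge0.
have m30 : 0 <= m ^+ 3 by rewrite exprn_ge0.
have hE' : `|E| <= 4 * m ^+ 3.
  by apply: (le_trans hE); rewrite ler_pM2l // lerXn2r ?nnegrE.
have hc : `|c| <= m ^+ 3.
  apply: (le_trans (cosB2_le y)); apply: (@le_trans _ _ (m ^+ 4)).
    by rewrite lerXn2r ?nnegrE.
  by rewrite [m ^+ 4]exprS ler_piMl.
have hs : `|s| <= m ^+ 3.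
  by apply: (le_trans (sinB_le y)); rewrite lerXn2r ?nnegrE.
have x2 : `|x ^+ 2| <= m ^+ 2 by rewrite normrX lerXn2r ?nnegrE.
have y2 : `|y ^+ 2| <= m ^+ 2 by rewrite normrX lerXn2r ?nnegrE.
have m21 : m ^+ 2 <= m by rewrite expr2 ler_piMl.
have hh : `|1 + x + x ^+ 2 / 2| <= 3.
  have /ler_normlP[? ?] := x1; have /ler_normlP[? ?] := x2.
  by apply/ler_normlP; split; lra.
have hg : `|x + x ^+ 2 / 2| <= 2 * m.
  have /ler_normlP[? ?] := xm; have /ler_normlP[? ?] := x2.
  by apply/ler_normlP; split; lra.
have B (a b A B : R) : `|a| <= A -> `|b| <= B -> `|a * b| <= A * B.
  by move=> ? ?; rewrite normrM ler_pM.
have b1 := B _ _ _ _ hE' (cos_max y).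
have b2 := B _ _ _ _ hg y2.
have b3 := B _ _ _ _ hh hc.
have b4 := B _ _ _ _ hE' (sin_max y).
have b5 := B _ _ _ _ x2 ym.
have b6 := B _ _ _ _ hh hs.
have mm2 : m * m ^+ 2 = m ^+ 3 by ring.
apply: (le_trans (normc_le_ReIm _)).
(* With P = 1 + x + x^2/2, exp x cos y = E cos y + P (1 - y^2/2 + c). The part of P y^2/2 that w^2/2
   does not cancel is of third order. *)
have -> : complex.Re (cexp w - 1 - w - w ^+ 2 / 2%:R) =
    E * cos y - ((x + x ^+ 2 / 2) * y ^+ 2) / 2 + (1 + x + x ^+ 2 / 2) * c.
  rewrite /E /c /x /y; case: (w) => a b; rewrite /cexp /= !(expr2,expr0n) /=.
  by field.
have -> : complex.Im (cexp w - 1 - w - w ^+ 2 / 2%:R) =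
    E * sin y + (x ^+ 2 * y) / 2 + (1 + x + x ^+ 2 / 2) * s.
  rewrite /E /s /x /y; case: (w) => a b; rewrite /cexp /= !(expr2,expr0n) /=.
  by field.
have -> : 16 * m ^+ 3 = 8 * m ^+ 3 + 8 * m ^+ 3 by ring.
apply: lerD.
  have /ler_normlP[p1 p2] := b1; have /ler_normlP[p3 p4] := b2.
  have /ler_normlP[p5 p6] := b3.
  by clear - m30 mm2 p1 p2 p3 p4 p5 p6; apply/ler_normlP; split; lra.
have /ler_normlP[p1 p2] := b4; have /ler_normlP[p3 p4] := b5.
have /ler_normlP[p5 p6] := b6.
by clear - m30 mm2 p1 p2 p3 p4 p5 p6; apply/ler_normlP; split; lra.
Qed.

Lemma cexp_imagB (R : realType) (s t : R) :
  normc (cexp (0 +i* s)%C - cexp (0 +i* t)%C) <= `|s - t|.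
Proof.
rewrite -(@ler_pXn2r _ 2) ?nnegrE ?normc_ge0 ?normr_ge0 //.
rewrite sqr_normcE /cexp /= expR0 real_normK ?num_real //.
have -> : (1 * cos s - 0 * sin s - (1 * cos t - 0 * sin t)) ^+ 2 +
  (1 * sin s + 0 * cos s - (1 * sin t + 0 * cos t)) ^+ 2 =
  (cos s ^+ 2 + sin s ^+ 2) + (cos t ^+ 2 + sin t ^+ 2) -
  2 * (cos s * cos t + sin s * sin t) by ring.
rewrite !cos2Dsin2 -cosB.
have -> : s - t = ((s - t) / 2) *+ 2 by rewrite -mulr_natr divfK.
set u := (s - t) / 2.
rewrite cos_mulr2n cos2sin2 -[u *+ 2]mulr_natr exprMn.
have : sin u ^+ 2 <= u ^+ 2.
  by rewrite -[leLHS]real_normK ?num_real // -[leRHS]real_normK ?num_real //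
    lerXn2r ?nnegrE // norm_sin_le.
move: (sin u ^+ 2) (u ^+ 2) => a b ab.
by rewrite expr2; lra.
Qed.

(** The linear term dominates for small [w]; this bounds the denominator of the geometric sum in
    [avg_mult_le] from below. *)
Lemma cexp_B1_ge (R : realType) (w : R[i]) : normc w <= 1 / 8 ->
  normc w / 2 <= normc (cexp w - 1).
Proof.
move=> w8; have w1 : normc w <= 1 by apply: le_trans w8 _; lra.
have := cexp_taylor_le w1.
set e := (X in normc X) => he.
have m0 := normc_ge0 w.
have -> : cexp w - 1 = w - (- w ^+ 2 / 2%:R - e) by rewrite /e; ring.
have := ler_dist_normc w (- w ^+ 2 / 2%:R - e).
move=> /ler_normlP[_ h2].
have h3 : normc (- w ^+ 2 / 2%:R - e) <= normc w ^+ 2 / 2 + normc e.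
  apply: (le_trans (normcB _ _)); rewrite lerD2r normcM normcN normcX.
  by rewrite normcV -(rmorph_nat (real_complex R)) normc_real ger0_norm.
have : normc w ^+ 2 <= normc w / 8 by rewrite expr2; nra.
have : normc w ^+ 3 <= normc w / 64.
  rewrite 2!exprS expr1; have : normc w * normc w <= 1 / 64 by nra.
  by nra.
by move: h2 h3 he; lra.
Qed.

(** * A maximum principle without derivatives *)

Lemma normc_nat (R : rcfType) n : normc (n%:R : R[i]) = n%:R.
Proof. by rewrite -(rmorph_nat (real_complex R)) normc_real ger0_norm. Qed.

Lemma normc_eq0 (R : rcfType) (z : R[i]) : (normc z == 0) = (z == 0).
Proof. by apply/eqP/eqP => [/eq0_normc //|->]; rewrite normc0. Qed.

Lemma normcD_le (R : rcfType) (x y : R[i]) a b :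
  normc x <= a -> normc y <= b -> normc (x + y) <= a + b.
Proof. by move=> ? ?; apply: le_trans (le_normcD _ _) _; exact: lerD. Qed.

Lemma normcM_le (R : rcfType) (x y : R[i]) a b :
  normc x <= a -> normc y <= b -> normc (x * y) <= a * b.
Proof. by move=> ? ?; rewrite normcM ler_pM ?normc_ge0. Qed.

(** Stands in for holomorphy near [z]. With the remainder written as [w ^+ 3 * r], closure under
    products, [cexp] and inverses becomes an algebraic identity plus a bound on the new [r]. *)
Definition taylor2 (R : realType) (g : R[i] -> R[i]) (z : R[i]) :=
  exists g1 g2 : R[i], exists C d : R, 0 < d /\
    forall w, normc w <= d -> exists2 r, normc r <= C &
      g (z + w) = g z + g1 * w + g2 * w ^+ 2 + w ^+ 3 * r.

Lemma taylor2_cst (R : realType) (c z : R[i]) : taylor2 (fun=> c) z.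
Proof.
exists 0, 0, 0, 1; split => // w _; exists 0; first by rewrite normc0.
by ring.
Qed.

Lemma taylor2_id (R : realType) (z : R[i]) : taylor2 id z.
Proof.
exists 1, 0, 0, 1; split => // w _; exists 0; first by rewrite normc0.
by ring.
Qed.

Lemma taylor2D (R : realType) (g k : R[i] -> R[i]) z :
  taylor2 g z -> taylor2 k z -> taylor2 (fun z => g z + k z) z.
Proof.
move=> [g1 [g2 [C [d [d0 hg]]]]] [k1 [k2 [C' [d' [d'0 hk]]]]].
exists (g1 + k1), (g2 + k2), (C + C'), (Num.min d d').
split; first by rewrite lt_min d0.
move=> w; rewrite le_min => /andP[/hg[r rC ->] /hk[s sC ->]].
exists (r + s); last by ring.
exact: normcD_le.
Qed.

Lemma taylor2N (R : realType) (g : R[i] -> R[i]) z :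
  taylor2 g z -> taylor2 (fun z => - g z) z.
Proof.
move=> [g1 [g2 [C [d [d0 hg]]]]]; exists (- g1), (- g2), C, d; split => // w /hg[r rC ->].
by exists (- r); [rewrite normcN|ring].
Qed.

Lemma taylor2M (R : realType) (g k : R[i] -> R[i]) z :
  taylor2 g z -> taylor2 k z -> taylor2 (fun z => g z * k z) z.
Proof.
move=> [g1 [g2 [C [d [d0 hg]]]]] [k1 [k2 [C' [d' [d'0 hk]]]]].
pose N (x : R[i]) := normc x.
exists (g z * k1 + g1 * k z), (g z * k2 + g1 * k1 + g2 * k z).
(* This constant copies the witness below factor by factor, with 1 for the modulus of [w], so that
   the triangle inequality applies term by term. *)
exists ((N (g z) + N g1 * 1 + N g2 * 1 ^+ 2) * C' +
  C * (N (k z) + N k1 * 1 + N k2 * 1 ^+ 2 + 1 ^+ 3 * C') + (N (g1 * k2 + g2 * k1)) + N (g2 * k2) * 1).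
exists (Num.min (Num.min d d') 1).
split; first by rewrite !lt_min d0 d'0 ltr01.
move=> w; rewrite !le_min => /andP[/andP[/hg[r rC ->] /hk[s sC ->]] w1].
exists ((g z + g1 * w + g2 * w ^+ 2) * s +
  r * (k z + k1 * w + k2 * w ^+ 2 + w ^+ 3 * s) + (g1 * k2 + g2 * k1) + g2 * k2 * w); last by ring.
have wn n : normc (w ^+ n) <= 1 ^+ n by rewrite normcX lerXn2r ?nnegrE ?normc_ge0.
by do ?[apply: normcD_le | apply: normcM_le | exact: wn | exact: lexx].
Qed.

Lemma taylor2_sum (R : realType) (I : Type) (s : seq I) (P : pred I) (g : I -> R[i] -> R[i]) z :
  (forall i, taylor2 (g i) z) -> taylor2 (fun z => \sum_(i <- s | P i) g i z) z.
Proof.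
move=> hg; elim: s => [|i s IH].
  by under eq_fun do rewrite big_nil; exact: taylor2_cst.
under eq_fun do rewrite big_cons.
by case: (P i) => //; apply: taylor2D.
Qed.

Lemma taylor2_cexp (R : realType) (g : R[i] -> R[i]) z :
  taylor2 g z -> taylor2 (fun z => cexp (g z)) z.
Proof.
move=> [g1 [g2 [C [d [d0 hg]]]]].
pose N (x : R[i]) := normc x.
have N0 x : 0 <= N x by exact: normc_ge0.
pose C' := `|C|.
pose U := N g1 + 1 * (N g2 + 1 * C').
have C0 : 0 <= C' by exact: normr_ge0.
have U0 : 0 <= U by rewrite /U !mul1r !addr_ge0.
exists (cexp (g z) * g1), (cexp (g z) * (g2 + g1 ^+ 2 / 2%:R)).
exists (N (cexp (g z)) * (C' + N g1 * (N g2 + 1 * C') + 1 * (N g2 + 1 * C') ^+ 2 / 2 + U ^+ 3 * 16)).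
(* The increment of [g] is [w * u] with [u] of modulus at most [U]; the last radius keeps it in the
   unit disc, where [cexp_taylor_le] applies. *)
exists (Num.min (Num.min d 1) ((U + 1)^-1)).
split; first by rewrite !lt_min d0 ltr01 /= invr_gt0 ltr_wpDl.
move=> w; rewrite !le_min => /andP[/andP[/hg[r rC ->] w1] wU].
have rC' : normc r <= C' by apply: le_trans rC _; exact: ler_norm.
pose v := g2 + w * r.
pose u := g1 + w * v.
have vV : normc v <= N g2 + 1 * C'.
  by rewrite /v; apply: normcD_le => //; apply: normcM_le.
have uU : normc u <= U by rewrite /u /U; apply: normcD_le => //; apply: normcM_le.
have wu1 : normc (w * u) <= 1.
  apply: (@le_trans _ _ ((U + 1)^-1 * U)); first exact: normcM_le.
  by rewrite mulrC ler_pdivrMr ?mul1r ?lerDl ?ltr_wpDl.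
have [e he ->] : exists2 e, normc e <= 16 & cexp (g z + g1 * w + g2 * w ^+ 2 + w ^+ 3 * r)
   = cexp (g z) * (1 + w * u + (w * u) ^+ 2 / 2%:R + (w * u) ^+ 3 * e).
  have [wu0|wu0] := eqVneq (w * u) 0.
    exists 0; first by rewrite normc0.
    have -> : g z + g1 * w + g2 * w ^+ 2 + w ^+ 3 * r = g z + w * u by rewrite /u /v; ring.
    by rewrite wu0 addr0; ring.
  exists ((cexp (w * u) - 1 - w * u - (w * u) ^+ 2 / 2%:R) / (w * u) ^+ 3).
    rewrite normcM normcV normcX ler_pdivrMr ?cexp_taylor_le //.
    by rewrite exprn_gt0 // lt_neqAle normc_ge0 eq_sym normc_eq0 wu0.
  have -> : g z + g1 * w + g2 * w ^+ 2 + w ^+ 3 * r = g z + w * u by rewrite /u /v; ring.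
  rewrite cexpD; congr (_ * _); rewrite [(w * u) ^+ 3 * _]mulrC divfK ?expf_neq0 //; ring.
exists (cexp (g z) * (r + g1 * v + w * v ^+ 2 / 2%:R + u ^+ 3 * e)); last first.
  by rewrite /u /v; field.
have h2 : normc ((2%:R : R[i])^-1) <= 2^-1 by rewrite normcV normc_nat.
apply: normcM_le => //; apply: normcD_le; last first.
  by apply: normcM_le => //; rewrite normcX lerXn2r ?nnegrE ?normc_ge0.
apply: normcD_le; last first.
  apply: normcM_le => //; apply: normcM_le => //.
  by rewrite normcX lerXn2r ?nnegrE ?normc_ge0 // (le_trans _ vV) ?normc_ge0.
by apply: normcD_le => //; apply: normcM_le.
Qed.

Lemma taylor2_inv (R : realType) (c z : R[i]) :
  z + c != 0 -> taylor2 (fun z => (z + c)^-1) z.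
Proof.
move=> zc; set a := z + c.
have a0 : 0 < normc a by rewrite lt_neqAle normc_ge0 eq_sym normc_eq0 zc.
(* 1/(a + w) = 1/a - w/a^2 + w^2/a^3 - w^3/(a^3 (a + w)), and |a + w| >= |a|/2 on this disc. *)
exists (- a ^- 2), (a ^- 3), (normc (a ^- 3) * (normc a / 2)^-1), (normc a / 2).
split; first by rewrite divr_gt0.
move=> w wa.
have aw : normc a / 2 <= normc (a + w).
  have := ler_dist_normc a (- w); rewrite opprK normcN => /ler_normlP[_ h].
  have := le_normcD (a + w) (- w); rewrite addrK normcN; lra.
have aw0 : a + w != 0 by rewrite -normc_eq0 gt_eqF // (lt_le_trans _ aw) // divr_gt0.
exists (- (a ^- 3) * (a + w)^-1).
  apply: normcM_le; rewrite ?normcN // normcV lef_pV2 ?posrE ?divr_gt0 //.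
  by rewrite (lt_le_trans _ aw) // divr_gt0.
have -> : z + w + c = a + w by rewrite /a; ring.
rewrite -/a.
by field; rewrite aw0 /=.
Qed.

Lemma taylor2_continuous (R : realType) (g : R[i] -> R[i]) z : taylor2 g z ->
  exists L d : R, [/\ 0 <= L, 0 < d & forall w, normc w <= d ->
    normc (g (z + w) - g z) <= L * normc w].
Proof.
move=> [g1 [g2 [C [d [d0 hg]]]]].
exists (normc g1 + normc g2 * 1 + 1 ^+ 2 * `|C|), (Num.min d 1).
split; first by rewrite !(addr_ge0, mulr_ge0) ?normc_ge0 ?expr1n.
  by rewrite lt_min d0 ltr01.
move=> w; rewrite le_min => /andP[/hg[r rC ->] w1].
have -> : g z + g1 * w + g2 * w ^+ 2 + w ^+ 3 * r - g z = (g1 + g2 * w + w ^+ 2 * r) * w by ring.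
have rC' : normc r <= `|C| by apply: le_trans rC _; exact: ler_norm.
apply: normcM_le => //; apply: normcD_le.
  by apply: normcD_le => //; apply: normcM_le.
by apply: normcM_le => //; rewrite normcX lerXn2r ?nnegrE ?normc_ge0.
Qed.

(* Averaging over the directions 1, i, -1, -i kills the terms of order 1 and 2,
   which gives the sub-mean value property up to O(p^3). *)
Lemma taylor2_four_points (R : realType) (g : R[i] -> R[i]) z : taylor2 g z ->
  exists C d : R, [/\ 0 <= C, 0 < d & forall p : R, 0 < p <= d ->
    4 * normc (g z) <= normc (g (z + p%:C%C)) + normc (g (z - p%:C%C)) +
       normc (g (z + (0 +i* p)%C)) + normc (g (z - (0 +i* p)%C)) + C * p ^+ 3].
Proof.
move=> [g1 [g2 [C [d [d0 hg]]]]].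
exists (`|C| + `|C| + `|C| + `|C|), d; split => // p /andP[p0 pd].
have np : normc p%:C%C <= d by rewrite normc_real ger0_norm // ltW.
have -> : (0 +i* p)%C = 'i%C * p%:C%C by apply: complex_eqP => /=; ring.
set q := p%:C%C.
have i1 : normc 'i%C = 1 :> R by rewrite /= expr0n expr1n /= add0r sqrtr1.
have ni : normc ('i%C * q) <= d by rewrite normcM i1 mul1r.
have nN : normc (- q) <= d by rewrite normcN.
have niN : normc (- ('i%C * q)) <= d by rewrite normcN.
have [r1 hr1 e1] := hg _ np; have [r2 hr2 e2] := hg _ nN.
have [r3 hr3 e3] := hg _ ni; have [r4 hr4 e4] := hg _ niN.
have e : 4%:R * g z = g (z + q) + g (z - q) + g (z + ('i%C * q)) + g (z - ('i%C * q))
   + (- (q ^+ 3 * r1) + (q ^+ 3 * r2) - ('i%C ^+ 3 * q ^+ 3 * r3) + ('i%C ^+ 3 * q ^+ 3 * r4)).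
  (* The zero [1 + 'i%C ^+ 2] is inserted by hand because [ring] treats ['i%C] as a variable. *)
  have -> : 4%:R * g z = 4%:R * g z + 2%:R * g2 * q ^+ 2 * (1 + 'i%C ^+ 2).
    by rewrite sqr_i subrr mulr0 addr0.
  rewrite e1 e2 e3 e4 -/q; ring.
have := f_equal (@normc R) e; rewrite normcM normc_nat => ->.
have hC r : normc r <= C -> normc r <= `|C|.
  by move=> h; apply: le_trans h _; exact: ler_norm.
have q3 : normc (q ^+ 3) <= p ^+ 3 by rewrite normcX normc_real ger0_norm // ltW.
have iq3 : normc ('i%C ^+ 3 * q ^+ 3) <= p ^+ 3 by rewrite normcM [normc ('i%C ^+ 3)]normcX i1 expr1n mul1r.
apply: normcD_le; first by do !apply: normcD_le.
rewrite [leRHS]mulrC !mulrDr; do !apply: normcD_le; rewrite ?normcN.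
all: apply: normcM_le => //; exact: hC.
Qed.

(** The summands will be translates of one function, or squares of a Dirichlet polynomial at grid
    points, all multiplied by the same exponential. *)
Definition sum_norms (R : realType) (K : nat) (g : nat -> R[i] -> R[i]) z : R :=
  \sum_(k < K) normc (g k z).

Lemma sum_norms_four_points (R : realType) K (g : nat -> R[i] -> R[i]) z :
  (forall k, taylor2 (g k) z) ->
  exists C d : R, [/\ 0 <= C, 0 < d & forall p : R, 0 < p <= d ->
    4 * sum_norms K g z <= sum_norms K g (z + p%:C%C) + sum_norms K g (z - p%:C%C) +
       sum_norms K g (z + (0 +i* p)%C) + sum_norms K g (z - (0 +i* p)%C) + C * p ^+ 3].
Proof.
move=> hg; elim: K => [|K [C [d [C0 d0 IH]]]].
  exists 0, 1; split => // p _; rewrite /sum_norms !big_ord0; lra.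
have [C' [d' [C'0 d'0 h]]] := taylor2_four_points (hg K).
exists (C + C'), (Num.min d d'); split; [exact: addr_ge0|by rewrite lt_min d0|].
move=> p; rewrite le_min => /and3P[p0 pd pd'].
have := IH p; have := h p; rewrite p0 pd pd' => /(_ isT) h1 /(_ isT) h2.
rewrite /sum_norms !big_ord_recr /= mulrDr; move: h1 h2; rewrite /sum_norms.
lra.
Qed.

Lemma sum_norms_continuous (R : realType) K (g : nat -> R[i] -> R[i]) z :
  (forall k, taylor2 (g k) z) ->
  exists L d : R, [/\ 0 <= L, 0 < d & forall w, normc w <= d ->
    `|sum_norms K g (z + w) - sum_norms K g z| <= L * normc w].
Proof.
move=> hg; elim: K => [|K [L [d [L0 d0 IH]]]].
  by exists 0, 1; split => // w _; rewrite /sum_norms !big_ord0 subrr normr0 mul0r.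
have [L' [d' [L'0 d'0 h]]] := taylor2_continuous (hg K).
exists (L + L'), (Num.min d d'); split; [exact: addr_ge0|by rewrite lt_min d0|].
move=> w; rewrite le_min => /andP[/IH h1 /h h2].
rewrite /sum_norms !big_ord_recr /= opprD addrACA mulrDl.
apply: le_trans (ler_normD _ _) _; apply: lerD => //.
exact: le_trans (ler_dist_normc _ _) h2.
Qed.

(* Adding E |z|^2 makes the sub-mean value property strict: its average over
   the four points exceeds its value by E p^2, which beats the O(p^3) error. *)
Lemma max_principle_rect (R : realType) K (g : nat -> R[i] -> R[i]) (a b c d M : R) :
  a <= b -> c <= d ->
  (forall k x y, a <= x <= b -> c <= y <= d -> taylor2 (g k) (x +i* y)%C) ->
  (forall x y, a <= x <= b -> c <= y <= d -> [|| x == a, x == b, y == c | y == d] ->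
     sum_norms K g (x +i* y)%C <= M) ->
  forall x y, a <= x <= b -> c <= y <= d -> sum_norms K g (x +i* y)%C <= M.
Proof.
move=> ab cd hg hM x0 y0 x0ab y0cd.
pose B := a ^+ 2 + b ^+ 2 + (c ^+ 2 + d ^+ 2) + 1.
have B0 : 0 < B by rewrite ltr_wpDl // !addr_ge0 ?sqr_ge0.
have sqb (u v w : R) : u <= w <= v -> w ^+ 2 <= u ^+ 2 + v ^+ 2.
  move=> /andP[h1 h2]; rewrite !expr2; have [w0|w0] := leP 0 w.
    have : w * w <= v * v by apply: ler_pM.
    by have := sqr_ge0 u; rewrite expr2; lra.
  have : (- w) * (- w) <= (- u) * (- u) by apply: ler_pM; lra.
  by have := sqr_ge0 v; rewrite expr2; lra.
apply/ler_addgt0Pr => e e0.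
(* [B] exceeds |z|^2 on the rectangle, so the added term costs at most [e]. *)
pose E := e / B; have E0 : 0 < E by rewrite divr_gt0.
pose U (p : R * R) := sum_norms K g (p.1 +i* p.2)%C + E * (p.1 ^+ 2 + p.2 ^+ 2).
have EB : E * B = e by rewrite /E divfK // gt_eqF.
suff : exists p : R * R, [/\ a <= p.1 <= b, c <= p.2 <= d,
    [|| p.1 == a, p.1 == b, p.2 == c | p.2 == d] & U (x0, y0) <= U p].
  move=> [[x y] [/= hx hy hb hU]]; have h := hM _ _ hx hy hb.
  have h0 : 0 <= E * (x0 ^+ 2 + y0 ^+ 2) by rewrite mulr_ge0 ?addr_ge0 ?sqr_ge0 // ltW.
  have h1 : E * (x ^+ 2 + y ^+ 2) <= E * B.
    by rewrite ler_pM2l // /B; have := sqb _ _ _ hx; have := sqb _ _ _ hy; lra.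
  by move: hU h0 h1; rewrite /U /= EB; lra.
have cK : compact (`[a, b] `*` `[c, d] : set (R * R)).
  by apply: compact_setX; exact: segment_compact.
have K0 : (`[a, b] `*` `[c, d] : set (R * R)) !=set0.
  by exists (a, c); split => /=; rewrite in_itv /= lexx.
have cU : {within `[a, b] `*` `[c, d], continuous U}.
  apply: continuous_in_subspaceT => -[u v] /set_mem[/=]; rewrite !in_itv /= => hu hv.
  have c1 : fst q @[q --> (u, v)] --> u by exact: cvg_fst.
  have c2 : snd q @[q --> (u, v)] --> v by exact: cvg_snd.
  apply: cvgD; last by apply: cvgM; [exact: cvg_cst|apply: cvgD; [exact: (cvgM c1 c1)|exact: (cvgM c2 c2)]].
  have [L [r [L0 r0 h]]] := sum_norms_continuous K (fun k => hg k _ _ hu hv).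
  apply/cvgrPdist_le => /= eps eps0.
  pose r' := Num.min r (eps / (L + 1)).
  have r'0 : 0 < r' / 2 by rewrite divr_gt0 // lt_min r0 divr_gt0 // ltr_wpDl.
  near=> q.
  have q1 : `|u - q.1| <= r' / 2.
    by near: q; exact: (cvgr_dist_le _ _ c1 _ r'0).
  have q2 : `|v - q.2| <= r' / 2.
    by near: q; exact: (cvgr_dist_le _ _ c2 _ r'0).
  have -> : (q.1 +i* q.2 = u +i* v + (q.1 - u) +i* (q.2 - v))%C.
    by apply: complex_eqP => /=; ring.
  set w := ((q.1 - u) +i* (q.2 - v))%C.
  have wr : normc w <= r'.
    apply: (le_trans (normc_le_ReIm _)); rewrite /= distrC [X in _ + X]distrC.
    by rewrite [r']splitr lerD.
  have : normc w <= r by apply: (le_trans wr); rewrite ge_min lexx.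
  move=> /h; rewrite distrC => /le_trans; apply.
  apply: (@le_trans _ _ (L * (eps / (L + 1)))).
    by rewrite ler_wpM2l // (le_trans wr) // ge_min lexx orbT.
  rewrite mulrA ler_pdivrMr ?ltr_wpDl // mulrC ler_wpM2l ?ltW //.
  lra.
have [[x y] /set_mem[/=]] := compact_EVT_max K0 cK cU.
rewrite !in_itv /= => hx hy hmax.
have {}hmax u v : a <= u <= b -> c <= v <= d -> U (u, v) <= U (x, y).
  by move=> hu hv; apply: hmax; rewrite inE; split => /=; rewrite in_itv.
exists (x, y); split => //; last exact: hmax.
apply/negPn/negP; rewrite !negb_or => /and4P[xa xb yc yd] /=.
have {xa}xa : a < x by rewrite lt_neqAle eq_sym xa; case/andP: hx.
have {xb}xb : x < b by rewrite lt_neqAle xb; case/andP: hx.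
have {yc}yc : c < y by rewrite lt_neqAle eq_sym yc; case/andP: hy.
have {yd}yd : y < d by rewrite lt_neqAle yd; case/andP: hy.
have [C [d' [C0 d'0 h4]]] := sum_norms_four_points K (fun k => hg k _ _ hx hy).
(* [p] keeps the four points in the rectangle and within the radius of the expansion; its last bound
   gives C p^3 <= (E - p) p^2, which cannot reach the excess 4 E p^2. *)
pose p := Num.min (Num.min (Num.min (x - a) (b - x)) (Num.min (y - c) (d - y)))
  (Num.min d' (E / (C + 1))).
have p0 : 0 < p by rewrite !lt_min !subr_gt0 xa xb yc yd d'0 divr_gt0 // ltr_wpDl.
have : p <= p by []. 
rewrite {2}/p !le_min => /and3P[/andP[/andP[p1 p2] /andP[p3 p4]] p5 p6].
have {h4} := h4 p; rewrite p0 p5 => /(_ isT).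
have -> : (x +i* y + p%:C = (x + p) +i* y)%C by apply: complex_eqP => /=; ring.
have -> : (x +i* y - p%:C = (x - p) +i* y)%C by apply: complex_eqP => /=; ring.
have -> : (x +i* y + 0 +i* p = x +i* (y + p))%C by apply: complex_eqP => /=; ring.
have -> : (x +i* y - 0 +i* p = x +i* (y - p))%C by apply: complex_eqP => /=; ring.
have h1 : U (x + p, y) <= U (x, y) by apply: hmax => //; lra.
have h2 : U (x - p, y) <= U (x, y) by apply: hmax => //; lra.
have h3 : U (x, y + p) <= U (x, y) by apply: hmax => //; lra.
have h4 : U (x, y - p) <= U (x, y) by apply: hmax => //; lra.
move: h1 h2 h3 h4; rewrite /U /=.
have p6' : C * p ^+ 3 <= (E - p) * p ^+ 2.
  rewrite exprS mulrA ler_pM2r ?exprn_gt0 //.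
  by move: p6; rewrite ler_pdivlMr ?ltr_wpDl //; nra.
have p2E : 0 < E * p ^+ 2 by rewrite mulr_gt0 ?exprn_gt0.
have p3' : 0 < p * p ^+ 2 by rewrite mulr_gt0 ?exprn_gt0.
have -> : (x + p) ^+ 2 = x ^+ 2 + 2 * x * p + p ^+ 2 by ring.
have -> : (x - p) ^+ 2 = x ^+ 2 - 2 * x * p + p ^+ 2 by ring.
have -> : (y + p) ^+ 2 = y ^+ 2 + 2 * y * p + p ^+ 2 by ring.
have -> : (y - p) ^+ 2 = y ^+ 2 - 2 * y * p + p ^+ 2 by ring.
rewrite !mulrDr !mulrN.
move: p6'; rewrite mulrBl.
lra.
Unshelve. all: by end_near. Qed.

(** Exhaustion by rectangles standing on the real axis: on the three other sides |z| is large and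
    the hypothesis at infinity applies. *)
Lemma max_principle_halfplane (R : realType) K (g : nat -> R[i] -> R[i]) (M : R) :
  (forall k z, 0 <= complex.Im z -> taylor2 (g k) z) ->
  (forall x, sum_norms K g (x%:C)%C <= M) ->
  (forall e, 0 < e -> exists p, forall z, 0 <= complex.Im z -> p <= normc z ->
      sum_norms K g z <= M + e) ->
  forall z, 0 <= complex.Im z -> sum_norms K g z <= M.
Proof.
move=> hg hR hinf z z0; apply/ler_addgt0Pr => e e0.
have [p hp] := hinf e e0.
pose r := `|p| + normc z.
have r0 : 0 <= r by rewrite addr_ge0 // normc_ge0.
have zE : z = (complex.Re z +i* complex.Im z)%C by case: (z).
rewrite zE; apply: (@max_principle_rect R K g (- r) r 0 r) => //; try lra.
- by move=> k x y _ /andP[y0 _]; apply: hg.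
- move=> x y /andP[x1 x2] /andP[y1 y2] hb.
  have [y00|y0] := eqVneq y 0; first by rewrite y00 (le_trans (hR x)) // lerDl ltW.
  apply: hp => //; apply: (@le_trans _ _ r).
    by rewrite /r; have := ler_norm p; have := normc_ge0 z; lra.
  have {}hb : [|| x == - r, x == r | y == r] by move: hb; rewrite (negbTE y0).
  case/or3P: hb => /eqP hh.
  + apply: le_trans _ (ge_normc_Re _) => /=; rewrite hh normrN; exact: ler_norm.
  + apply: le_trans _ (ge_normc_Re _) => /=; rewrite hh; exact: ler_norm.
  + apply: le_trans _ (ge_normc_Im _) => /=; rewrite hh; exact: ler_norm.
- have := ge_normc_Re z; rewrite /r => /ler_normlP[? ?]; have := normr_ge0 p; lra.
- have := ge_normc_Im z; rewrite /r => /ler_normlP[? ?]; have := normr_ge0 p; lra.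
Qed.

(** * Riemann sums and Dirichlet polynomials *)

Definition lipschitz_on_line (R : realType) (g : R -> R) (L : R) :=
  forall s t, `|g s - g t| <= L * `|s - t|.

Lemma lipschitz_line_continuous (R : realType) (g : R -> R) L :
  lipschitz_on_line g L -> continuous g.
Proof.
move=> hg x; apply/cvgrPdist_le => /= e e0.
near=> t.
apply: (le_trans (hg _ _)).
apply: (@le_trans _ _ ((`|L| + 1) * `|x - t|)).
  by rewrite ler_wpM2r // (le_trans (ler_norm _)) // lerDl.
rewrite mulrC -ler_pdivlMr ?ltr_wpDl //.
near: t; apply: cvgr_dist_le; first exact: cvg_id.
by rewrite divr_gt0 // ltr_wpDl.
Unshelve. all: by end_near. Qed.

Local Notation Rint g a b := (\int[lebesgue_measure]_(t in `[a, b]) g t)%R.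

Lemma lipschitz_integrable (R : realType) (g : R -> R) L (a b : R) :
  lipschitz_on_line g L -> lebesgue_measure.-integrable `[a, b] (EFin \o g).
Proof.
move=> hg; apply: continuous_compact_integrable; first exact: segment_compact.
exact/continuous_subspaceT/(lipschitz_line_continuous hg).
Qed.

Lemma Rintegral_split (R : realType) (g : R -> R) L (a c b : R) :
  lipschitz_on_line g L -> a <= c -> c <= b ->
  Rint g a b = Rint g a c + Rint g c b.
Proof.
move=> hg ac cb.
have := @Rintegral_itvB R g (BLeft a) (BRight b) c (lipschitz_integrable a b hg).
rewrite !bnd_simp => /(_ ac cb) h.
rewrite -(@Rintegral_itv_obnd_cbnd R c (BRight b)); last first.
  apply: integrableS (lipschitz_integrable c b hg) => //.
  by apply: subset_itvr; rewrite bnd_simp.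
by rewrite -h; lra.
Qed.

Lemma Rintegral_cst_itv (R : realType) (a b r : R) : a <= b ->
  Rint (fun=> r) a b = r * (b - a).
Proof.
move=> ab; rewrite Rintegral_cst //; congr (_ * _).
rewrite -[fine _]/(fine (lebesgue_measure [set` `[a, b]])) lebesgue_measure_itv /= lte_fin.
by case: ltP => // ba; apply/eqP; rewrite /= eq_sym subr_eq0 eq_le ab ba.
Qed.

Lemma riemann_cell (R : realType) (g : R -> R) L (u h : R) :
  lipschitz_on_line g L -> 0 <= L -> 0 <= h ->
  `|Rint g u (u + h) - h * g u| <= L * h ^+ 2.
Proof.
move=> hg L0 h0.
have uh : u <= u + h by rewrite lerDl.
have hc (r : R) : lebesgue_measure.-integrable `[u, u + h] (EFin \o (fun=> r) : R -> \bar R).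
  apply: (@lipschitz_integrable _ _ 0) => s t; rewrite subrr normr0 mul0r //.
have hi := lipschitz_integrable u (u + h) hg.
have b t : u <= t <= u + h -> `|g t - g u| <= L * h.
  move=> /andP[ut th]; apply: (le_trans (hg _ _)).
  by rewrite ler_wpM2l // ger0_norm ?subr_ge0 // lerBlDl.
have h1 : Rint g u (u + h) <= Rint (fun=> g u + L * h) u (u + h).
  apply: le_Rintegral => // t /=; rewrite in_itv /= => /b /ler_normlP[_ ?]; lra.
have h2 : Rint (fun=> g u - L * h) u (u + h) <= Rint g u (u + h).
  apply: le_Rintegral => // t /=; rewrite in_itv /= => /b /ler_normlP[? ?]; lra.
move: h1 h2; rewrite !Rintegral_cst_itv // [u + h]addrC addrK expr2 => h1 h2.
by apply/ler_normlP; split; nra.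
Qed.

Lemma riemann_sum (R : realType) (g : R -> R) L (u h : R) K :
  lipschitz_on_line g L -> 0 <= L -> 0 <= h ->
  `|Rint g u (u + K%:R * h) - h * \sum_(k < K) g (u + k%:R * h)| <=
  K%:R * (L * h ^+ 2).
Proof.
move=> hg L0 h0; elim: K => [|K IH].
  rewrite !mul0r addr0 big_ord0 mulr0 subr0 set_itv1 Rintegral_set1 normr0 //.
have Kh : 0 <= K%:R * h by rewrite mulr_ge0.
rewrite (@Rintegral_split _ g L _ (u + K%:R * h)) //; first last.
- by rewrite -natr1 mulrDl mul1r; lra.
- by rewrite lerDl.
rewrite big_ord_recr /= mulrDr.
have -> : u + K.+1%:R * h = u + K%:R * h + h by rewrite -natr1; ring.
have := @riemann_cell _ g L (u + K%:R * h) h hg L0 h0 => h1.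
rewrite -[K.+1%:R in leRHS]natr1 [leRHS]mulrDl mul1r.
rewrite opprD addrACA; apply: le_trans (ler_normD _ _) _; exact: lerD.
Qed.

Lemma Rintegral_le_itv (R : realType) (g : R -> R) L (a b c d : R) :
  lipschitz_on_line g L -> (forall t, 0 <= g t) -> a <= c -> c <= d -> d <= b ->
  Rint g c d <= Rint g a b.
Proof.
move=> hg g0 ac cd db.
rewrite (Rintegral_split hg ac (le_trans cd db)) (Rintegral_split hg cd db).
have h1 : 0 <= Rint g a c by apply: Rintegral_ge0.
have h2 : 0 <= Rint g d b by apply: Rintegral_ge0.
rewrite -[leLHS]add0r lerD // lerDl //.
Qed.

(** * Exponentials of real frequency and Dirichlet polynomials in the upper half-plane *)

Definition expi (R : realType) (l : R) (z : R[i]) : R[i] := cexp ('i%C * (l%:C%C * z)).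

Lemma expiD (R : realType) (l : R) (z w : R[i]) :
  expi l (z + w) = expi l z * expi l w.
Proof. by rewrite /expi -cexpD !mulrDr. Qed.

Lemma normc_expi (R : realType) (l : R) (z : R[i]) :
  normc (expi l z) = expR (- (l * complex.Im z)).
Proof. by rewrite /expi normc_cexp; case: z => x y /=; congr expR; ring. Qed.

Lemma expi_real (R : realType) (l t : R) :
  expi l (t%:C)%C = cexp (0 +i* (l * t))%C.
Proof. by rewrite /expi; congr cexp; apply: complex_eqP => /=; ring. Qed.

Lemma normc_expi_real (R : realType) (l t : R) : normc (expi l (t%:C)%C) = 1.
Proof. by rewrite normc_expi /= mulr0 oppr0 expR0. Qed.

Lemma expi_lipschitz (R : realType) (l s t : R) :
  normc (expi l (s%:C)%C - expi l (t%:C)%C) <= `|l| * `|s - t|.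
Proof. by rewrite !expi_real -normrM mulrBr; exact: cexp_imagB. Qed.

Lemma taylor2_expi (R : realType) (l : R) (g : R[i] -> R[i]) z :
  taylor2 g z -> taylor2 (fun z => expi l (g z)) z.
Proof.
move=> hg; apply: taylor2_cexp; apply: taylor2M; first exact: taylor2_cst.
by apply: taylor2M => //; exact: taylor2_cst.
Qed.

(** [expi (ln n%:R) z] is n^(iz), of modulus n^(- Im z). Starting at n = 1, of frequency 0, makes
    the constant term the coefficient [c 1]. *)
Definition dpoly (R : realType) (c : nat -> R[i]) (N : nat) (z : R[i]) : R[i] :=
  \sum_(1 <= n < N.+1) c n * expi (ln n%:R) z.

Definition coefs (R : realType) (a : nat -> R[i]) (n : nat) : R[i] :=
  if n == 1%N then 1 else a n / n%:R.

Lemma dirichlet_polyE (R : realType) (a : nat -> R[i]) (N : nat) (t : R) :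
  (1 <= N)%N -> dirichlet_poly a N t = dpoly (coefs a) N (t%:C)%C.
Proof.
move=> N1; rewrite /dpoly big_nat_recl // /coefs /= ln1 /expi.
have -> : 'i%C * (0%:C%C * t%:C%C) = 0 :> R[i] by apply: complex_eqP => /=; ring.
rewrite cexp0 mulr1 /dirichlet_poly; congr (_ + _).
rewrite [LHS]big_add1 /=; apply: eq_big_nat => n /andP[n1 _].
have -> : (n.+1 == 1%N) = false by case: n n1.
have n0 : (0 < n.+1%:R :> R) by rewrite ltr0n.
rewrite /natpowC -mulrA; congr (_ * _).
have -> : ('i%C * t%:C%C - 1) * (ln n.+1%:R)%:C%C =
  (- ln n.+1%:R)%:C%C + 'i%C * ((ln n.+1%:R)%:C%C * t%:C%C) :> R[i].
  by apply: complex_eqP => /=; ring.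
rewrite cexpD; congr (_ * _).
rewrite /cexp /= expRN lnK ?posrE // sin0 cos0 -(rmorph_nat (real_complex R)) -fmorphV.
by apply: complex_eqP => /=; ring.
Qed.

Definition sum_coefs (R : realType) (c : nat -> R[i]) (N : nat) : R :=
  \sum_(1 <= n < N.+1) normc (c n).

Lemma dpoly_le (R : realType) (c : nat -> R[i]) (N : nat) (z : R[i]) :
  0 <= complex.Im z -> normc (dpoly c N z) <= sum_coefs c N.
Proof.
move=> z0; apply: (le_trans (normc_sum _ _ _)); rewrite /sum_coefs; apply: ler_sum_nat => n /andP[n1 _].
rewrite normcM normc_expi ler_piMr ?normc_ge0 //.
by rewrite -[leRHS]expR0 ler_expR oppr_le0; apply: mulr_ge0 => //; apply: ln_ge0; rewrite ler1n.
Qed.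

Definition lip_const (R : realType) (c : nat -> R[i]) (N : nat) : R :=
  \sum_(1 <= n < N.+1) normc (c n) * `|ln n%:R|.

Lemma dpoly_lipschitz (R : realType) (c : nat -> R[i]) (N : nat) (s t : R) :
  normc (dpoly c N (s%:C)%C - dpoly c N (t%:C)%C) <= lip_const c N * `|s - t|.
Proof.
rewrite /dpoly -sumrB; apply: (le_trans (normc_sum _ _ _)).
rewrite /lip_const mulr_suml; apply: ler_sum => n _.
by rewrite -mulrBr normcM -mulrA ler_wpM2l ?normc_ge0 // expi_lipschitz.
Qed.

Lemma lipschitz_sqr_dpoly (R : realType) (c : nat -> R[i]) (N : nat) (u : R) :
  lipschitz_on_line (fun t => normc (dpoly c N ((u + t)%:C)%C) ^+ 2)
    (2 * sum_coefs c N * lip_const c N).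
Proof.
move=> s t; rewrite subr_sqr normrM mulrC -mulrA.
set x := dpoly _ _ _; set y := dpoly _ _ _.
apply: ler_pM => //.
  rewrite ger0_norm ?addr_ge0 ?normc_ge0 // mulr_natl mulr2n.
  by apply: lerD; exact: dpoly_le.
apply: (le_trans (ler_dist_normc _ _)); apply: (le_trans (dpoly_lipschitz _ _ _ _)).
by rewrite opprD addrACA subrr add0r.
Qed.

Lemma sum_coefs_ge0 (R : realType) (c : nat -> R[i]) (N : nat) : 0 <= sum_coefs c N.
Proof. by apply: sumr_ge0 => n _; exact: normc_ge0. Qed.

Lemma lip_const_ge0 (R : realType) (c : nat -> R[i]) (N : nat) : 0 <= lip_const c N.
Proof. by apply: sumr_ge0 => n _; rewrite mulr_ge0 ?normc_ge0. Qed.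

Lemma mean_squareE (R : realType) (H : R) (N : nat) (a : nat -> R[i]) :
  (1 <= N)%N ->
  mean_square H N a = Rint (fun t => normc (dpoly (coefs a) N ((0 + t)%:C)%C) ^+ 2) 0 H.
Proof.
by move=> N1; apply: eq_Rintegral => t _; rewrite dirichlet_polyE // add0r.
Qed.

(** * Existence of minimisers *)

Lemma disc_compact (R : realType) (r : R) :
  compact [set p : R * R | p.1 ^+ 2 + p.2 ^+ 2 <= r ^+ 2].
Proof.
apply: (@subclosed_compact _ _ (`[- `|r|, `|r|] `*` `[- `|r|, `|r|])).
- have cf : continuous (fun p : R * R => p.1 ^+ 2 + p.2 ^+ 2).
    move=> -[u v].
    have c1 : fst q @[q --> (u, v)] --> u by exact: cvg_fst.
    have c2 : snd q @[q --> (u, v)] --> v by exact: cvg_snd.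
    by apply: cvgD; [exact: (cvgM c1 c1)|exact: (cvgM c2 c2)].
  by move/continuous_closedP : cf => /(_ _ (@closed_le R (r ^+ 2))).
- by apply: compact_setX; exact: segment_compact.
- move=> [x y] /= h; have k (u v : R) : u ^+ 2 + v ^+ 2 <= r ^+ 2 -> - `|r| <= u <= `|r|.
    move=> uv; rewrite -ler_norml -(@ler_pXn2r _ 2) ?nnegrE //.
    by rewrite !real_normK ?num_real // (le_trans _ uv) // lerDl sqr_ge0.
  by split; rewrite /= in_itv /=; [exact: k h|apply: (k _ x); rewrite addrC].
Qed.

Section CompactnessOfCoefficients.

Import ArrowAsProduct.

Lemma cvg_dist_coords (R : realType) (C : R) (N : nat) (f : nat -> (R * R)%type) :
  (C * \sum_(2 <= n < N.+1) (`|(g n).1 - (f n).1| + `|(g n).2 - (f n).2|))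
     @[g --> nbhs f] --> 0.
Proof.
have FF : Filter (nbhs f) by exact: nbhs_filter.
have hs : (fun g : nat -> (R * R)%type => \sum_(2 <= n < N.+1) (`|(g n).1 - (f n).1| + `|(g n).2 - (f n).2|)) g
     @[g --> nbhs f] --> \sum_(2 <= n < N.+1) (`|(f n).1 - (f n).1| + `|(f n).2 - (f n).2|).
  apply: (cvg_big (@add_continuous R) FF) => n _.
  have pc : (fun g : nat -> (R * R)%type => g n) g @[g --> nbhs f] --> f n by exact: (@proj_continuous _ _ n f).
  have p1 : (fun g : nat -> (R * R)%type => (g n).1 - (f n).1) g @[g --> nbhs f] --> (f n).1 - (f n).1.
    by apply: cvgB; [exact: (cvg_comp _ _ pc (@cvg_fst _ _ _ _ _))|exact: cvg_cst].
  have p2 : (fun g : nat -> (R * R)%type => (g n).2 - (f n).2) g @[g --> nbhs f] --> (f n).2 - (f n).2.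
    by apply: cvgB; [exact: (cvg_comp _ _ pc (@cvg_snd _ _ _ _ _))|exact: cvg_cst].
  exact: (cvgD (cvg_norm p1) (cvg_norm p2)).
rewrite [X in _ --> X]big1 in hs; last by move=> n _; rewrite !subrr normr0 addr0.
have h := cvgM (@cvg_cst _ C _ _ FF) hs; rewrite mulr0 in h; exact: h.
Qed.

(** Tychonoff on a product of discs. [J] is arbitrary because minimisers are needed both for the
    integral and for its Riemann sums. The Lipschitz bound gives continuity and shows that only the
    coordinates from 2 to [N] count. *)
Lemma admissible_minimizer (R : realType) (Phi : nat -> R) (N : nat)
    (J : (nat -> R[i]) -> R) (C : R) :
  (forall n, (2 <= n)%N -> 0 < Phi n) -> 0 <= C ->
  (forall a b, admissible Phi N a -> admissible Phi N b ->
     `|J a - J b| <= C * \sum_(2 <= n < N.+1) normc (a n - b n)) ->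
  exists2 a, admissible Phi N a & forall b, admissible Phi N b -> J a <= J b.
Proof.
move=> Phi0 C0 hJ.
pose T := forall i : nat, (R * R)%type.
pose r n := if (2 <= n)%N then Phi n else 0.
have r0 n : 0 <= r n by rewrite /r; case: ifP => // /Phi0 /ltW.
pose S := [set f : T | forall i, [set p : R * R | p.1 ^+ 2 + p.2 ^+ 2 <= r i ^+ 2] (f i)].
have cS : compact S := tychonoff (fun i => @disc_compact R (r i)).
pose A (f : T) (n : nat) : R[i] := ((f n).1 +i* (f n).2)%C.
have SA f : S f -> admissible Phi N (A f).
  move=> hf n /andP[n2 nN].
  have h : (f n).1 ^+ 2 + (f n).2 ^+ 2 <= Phi n ^+ 2 by have := hf n; rewrite /= /r n2.
  by rewrite -(@ler_pXn2r _ 2) ?nnegrE ?normc_ge0 ?(ltW (Phi0 _ n2)) // sqr_normcE.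
have S0 : S !=set0.
  by exists (fun=> (0, 0)) => i /=; rewrite expr0n addr0 sqr_ge0.
have cJ : {within S, continuous (J \o A)}.
  rewrite continuous_subspace_in => f0 /set_mem Sf; pose f : T := f0; rewrite -[f0]/f in Sf *.
  apply/cvgrPdist_le => /= e e0.
  have hc := cvg_dist_coords C N f.
  have FF : Filter (nbhs f) by exact: nbhs_filter.
  have hd := @cvgr_dist_le _ _ _ _ FF _ _ hc _ e0.
  rewrite -nbhs_subspace_in //; apply: (filterS _ hd) => g; rewrite sub0r normrN => hg Sg.
  apply: (le_trans (hJ _ _ (SA _ Sf) (SA _ Sg))); apply: le_trans hg.
  apply: le_trans (ler_norm _); rewrite ler_wpM2l //; apply: ler_sum => n _.
  apply: (le_trans (normc_le_ReIm _)); rewrite /A /=.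
  by rewrite distrC [X in _ + X <= _]distrC.
have [f /set_mem Sf hmin] := compact_EVT_min S0 cS cJ.
exists (A f); first exact: SA.
(* [b] is unconstrained outside 2 <= n <= N, so it is replaced by a point of the product with the
   same value of [J]. *)
move=> b hb; pose g : T := fun n => if (2 <= n <= N)%N then (complex.Re (b n), complex.Im (b n)) else (0, 0).
have Sg : S g.
  move=> n /=; rewrite /g; case: ifP => [h|_] /=; last by rewrite expr0n addr0 sqr_ge0.
  rewrite -sqr_normcE lerXn2r ?nnegrE ?normc_ge0 //.
  by case/andP: (h) => n2 nN; rewrite /r n2 hb.
apply: (le_trans (hmin g (mem_set Sg))); rewrite /=.
have := hJ (A g) b (SA _ Sg) hb; rewrite big_nat big1; last first.
  move=> n /andP[n2 nN]; rewrite /A /g n2 -ltnS nN /=.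
  have -> : (complex.Re (b n) +i* complex.Im (b n) = b n)%C by case: (b n).
  by rewrite subrr normc0.
by rewrite mulr0 normr_le0 subr_eq0 => /eqP ->.
Qed.

End CompactnessOfCoefficients.

Definition bound_coefs (R : realType) (Phi : nat -> R) (N : nat) : R :=
  1 + \sum_(2 <= n < N.+1) Phi n.

Lemma sum_coefsE (R : realType) (a : nat -> R[i]) (N : nat) : (1 <= N)%N ->
  sum_coefs (coefs a) N = 1 + \sum_(2 <= n < N.+1) normc (a n) / n%:R.
Proof.
move=> N1; rewrite /sum_coefs big_ltn // {1}/coefs eqxx normc1; congr (_ + _).
apply: eq_big_nat => n /andP[n2 _]; rewrite /coefs; have -> : (n == 1%N) = false by case: n n2 => [|[|]].
by rewrite normcM normcV normc_nat.
Qed.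

Lemma div_nat_le (R : realType) (x : R) n : 0 <= x -> (1 <= n)%N -> x / n%:R <= x.
Proof. by move=> x0 n1; rewrite ler_pdivrMr ?ltr0n // ler_peMr // ler1n. Qed.

Lemma sum_coefs_le (R : realType) (Phi : nat -> R) (a : nat -> R[i]) (N : nat) :
  (1 <= N)%N -> admissible Phi N a -> sum_coefs (coefs a) N <= bound_coefs Phi N.
Proof.
move=> N1 ha; rewrite sum_coefsE // lerD2l; apply: ler_sum_nat => n /andP[n2 nN].
apply: (@le_trans _ _ (normc (a n))); first by apply: div_nat_le; rewrite ?normc_ge0 // ltnW.
by apply: ha; rewrite n2.
Qed.

Lemma lip_const_le (R : realType) (Phi : nat -> R) (a : nat -> R[i]) (N : nat) :
  (1 <= N)%N -> admissible Phi N a -> lip_const (coefs a) N <= bound_coefs Phi N * ln N%:R.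
Proof.
move=> N1 ha; apply: (@le_trans _ _ (sum_coefs (coefs a) N * ln N%:R)); last first.
  by rewrite ler_wpM2r ?sum_coefs_le // ln_ge0 // ler1n.
rewrite /sum_coefs mulr_suml; apply: ler_sum_nat => n /andP[n1 nN].
rewrite ler_wpM2l ?normc_ge0 // ger0_norm ?ln_ge0 ?ler1n //.
by rewrite ler_ln ?posrE ?ltr0n // ler_nat.
Qed.

Lemma dpolyB_le (R : realType) (a b : nat -> R[i]) (N : nat) (z : R[i]) :
  (1 <= N)%N -> 0 <= complex.Im z ->
  normc (dpoly (coefs a) N z - dpoly (coefs b) N z) <= \sum_(2 <= n < N.+1) normc (a n - b n).
Proof.
move=> N1 z0; rewrite /dpoly -sumrB big_ltn // /coefs /= subrr add0r.
apply: (le_trans (normc_sum _ _ _)); apply: ler_sum_nat => n /andP[n2 nN].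
have -> : (n == 1%N) = false by case: n n2 {nN} => [|[|]].
have n1 : (1 <= n)%N by exact: ltnW.
rewrite -mulrBl -mulrBl normcM normcM normcV normc_nat normc_expi.
apply: (@le_trans _ _ (normc (a n - b n) / n%:R)); last by apply: div_nat_le; rewrite ?normc_ge0.
rewrite ler_piMr ?divr_ge0 ?normc_ge0 // -[leRHS]expR0 ler_expR oppr_le0.
by apply: mulr_ge0 => //; apply: ln_ge0; rewrite ler1n.
Qed.

Lemma sqr_dpolyB_le (R : realType) (Phi : nat -> R) (a b : nat -> R[i]) (N : nat) (z : R[i]) :
  (1 <= N)%N -> 0 <= complex.Im z -> admissible Phi N a -> admissible Phi N b ->
  `|normc (dpoly (coefs a) N z) ^+ 2 - normc (dpoly (coefs b) N z) ^+ 2| <=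
  2 * bound_coefs Phi N * \sum_(2 <= n < N.+1) normc (a n - b n).
Proof.
move=> N1 z0 ha hb; rewrite subr_sqr normrM mulrC; apply: ler_pM => //.
  rewrite ger0_norm ?addr_ge0 ?normc_ge0 // mulr_natl mulr2n.
  by apply: lerD; apply: (le_trans (dpoly_le _ _ z0)); exact: sum_coefs_le.
by apply: (le_trans (ler_dist_normc _ _)); exact: dpolyB_le.
Qed.

Lemma Rintegral_dist_le (R : realType) (g1 g2 : R -> R) L1 L2 (H c : R) :
  lipschitz_on_line g1 L1 -> lipschitz_on_line g2 L2 -> 0 <= H ->
  (forall t, `|g1 t - g2 t| <= c) -> `|Rint g1 0 H - Rint g2 0 H| <= c * H.
Proof.
move=> h1 h2 H0 hc.
have key (f1 f2 : R -> R) (K1 K2 : R) : lipschitz_on_line f1 K1 -> lipschitz_on_line f2 K2 ->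
    (forall t, f1 t <= f2 t + c) -> Rint f1 0 H <= Rint f2 0 H + c * H.
  move=> k1 k2 hf.
  have ic : lebesgue_measure.-integrable `[0, H] (EFin \o (fun=> c) : R -> \bar R).
    by apply: (@lipschitz_integrable _ _ 0) => s t; rewrite subrr normr0 mul0r.
  have <- : Rint (fun t => f2 t + c) 0 H = Rint f2 0 H + c * H.
    rewrite RintegralD //; last exact: lipschitz_integrable k2.
    by rewrite (Rintegral_cst_itv c H0) subr0.
  apply: le_Rintegral => //; first exact: lipschitz_integrable k1.
  apply: (@lipschitz_integrable _ _ K2) => s t; have := k2 s t.
  by rewrite (_ : f2 s + c - (f2 t + c) = f2 s - f2 t) //; ring.
rewrite ler_norml; apply/andP; split.
  rewrite lerNl opprB lerBlDl; apply: key h2 h1 _ => t; rewrite -lerBlDl.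
  by have := hc t; rewrite distrC => /ler_normlP[].
rewrite lerBlDl; apply: key h1 h2 _ => t; rewrite -lerBlDl.
by have := hc t => /ler_normlP[].
Qed.

Lemma mean_square_lipschitz (R : realType) (Phi : nat -> R) (H : R) (a b : nat -> R[i]) (N : nat) :
  (1 <= N)%N -> 0 <= H -> admissible Phi N a -> admissible Phi N b ->
  `|mean_square H N a - mean_square H N b| <=
  2 * bound_coefs Phi N * H * \sum_(2 <= n < N.+1) normc (a n - b n).
Proof.
move=> N1 H0 ha hb; rewrite !mean_squareE // mulrAC.
apply: (@Rintegral_dist_le R _ _ _ _ H _ (lipschitz_sqr_dpoly (coefs a) N 0)
  (lipschitz_sqr_dpoly (coefs b) N 0) H0) => t.
exact: sqr_dpolyB_le.
Qed.

Lemma bound_coefs_ge0 (R : realType) (Phi : nat -> R) (N : nat) :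
  (forall n, (2 <= n)%N -> 0 < Phi n) -> 0 <= bound_coefs Phi N.
Proof.
move=> Phi0; rewrite addr_ge0 // big_nat sumr_ge0 // => n /andP[n2 _].
exact/ltW/Phi0.
Qed.

Definition riemann_square (R : realType) (H : R) (M N : nat) (a : nat -> R[i]) : R :=
  H / M%:R * \sum_(k < M) normc (dpoly (coefs a) N ((k%:R * (H / M%:R))%:C)%C) ^+ 2.

Lemma riemann_square_lipschitz (R : realType) (Phi : nat -> R) (H : R) M N (a b : nat -> R[i]) :
  (1 <= N)%N -> (0 < M)%N -> 0 <= H -> admissible Phi N a -> admissible Phi N b ->
  `|riemann_square H M N a - riemann_square H M N b| <=
  2 * bound_coefs Phi N * H * \sum_(2 <= n < N.+1) normc (a n - b n).
Proof.
move=> N1 M0 H0 ha hb; rewrite /riemann_square -mulrBr -sumrB normrM.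
have HM : 0 <= H / M%:R by rewrite divr_ge0.
rewrite ger0_norm //; apply: (@le_trans _ _ (H / M%:R *
  \sum_(k < M) (2 * bound_coefs Phi N * \sum_(2 <= n < N.+1) normc (a n - b n)))).
  rewrite ler_wpM2l //; apply: (le_trans (ler_norm_sum _ _ _)); apply: ler_sum => k _.
  exact: sqr_dpolyB_le.
have sc (c : R) : \sum_(k < M) c = M%:R * c by rewrite sumr_const card_ord mulr_natl.
rewrite sc mulrA divfK ?pnatr_eq0 -?lt0n // le_eqVlt.
by apply/orP; left; apply/eqP; ring.
Qed.

Lemma mean_square_le_riemann (R : realType) (Phi : nat -> R) (H : R) M N (a : nat -> R[i]) :
  (1 <= N)%N -> (0 < M)%N -> 0 <= H -> admissible Phi N a ->
  mean_square H N a <= riemann_square H M N a +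
     2 * bound_coefs Phi N * (bound_coefs Phi N * ln N%:R) * H ^+ 2 / M%:R.
Proof.
move=> N1 M0 H0 ha; rewrite mean_squareE //.
have MN : (M%:R : R) != 0 by rewrite pnatr_eq0 -lt0n.
have HM : 0 <= H / M%:R by rewrite divr_ge0.
have := @riemann_sum R _ _ 0 (H / M%:R) M (lipschitz_sqr_dpoly (coefs a) N 0) _ HM.
rewrite add0r [_ * (H / _)]mulrC divfK // => /(_ _)/ler_normlP[|_].
  by rewrite !mulr_ge0 ?sum_coefs_ge0 ?lip_const_ge0.
rewrite lerBlDr [leLHS]/= => h; apply: (le_trans h); rewrite addrC lerD //.
  rewrite /riemann_square ler_wpM2l //; apply: ler_sum => k _.
  by rewrite !add0r.
have -> : 2 * bound_coefs Phi N * (bound_coefs Phi N * ln N%:R) * H ^+ 2 / M%:R =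
   M%:R * (2 * bound_coefs Phi N * (bound_coefs Phi N * ln N%:R) * (H / M%:R) ^+ 2) by field.
rewrite ler_wpM2l // ler_wpM2r ?exprn_ge0 //.
apply: ler_pM; rewrite ?mulr_ge0 ?sum_coefs_ge0 ?lip_const_ge0 ?lip_const_le //.
by rewrite ler_wpM2l ?sum_coefs_le.
Qed.

(** * The dual certificate of a discrete minimiser *)

Local Open Scope complex_scope.

Definition esum_poly (R : realType) (M : nat) (q : nat -> R[i]) (t : nat -> R) (z : R[i]) : R[i] :=
  \sum_(k < M) q k * expi (t k) z.

Lemma sqr_normcD (R : rcfType) (x y : R[i]) :
  normc (x + y) ^+ 2 = normc x ^+ 2 + 2 * complex.Re (x^* * y) + normc y ^+ 2.
Proof. by rewrite !sqr_normcE; case: x y => [a b] [c d] /=; ring. Qed.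

Lemma normcJ (R : rcfType) (x : R[i]) : normc x^* = normc x.
Proof. by case: x => a b /=; rewrite sqrrN. Qed.

Lemma Re_conjM (R : rcfType) (x : R[i]) : complex.Re (x^* * x) = normc x ^+ 2.
Proof. by rewrite sqr_normcE; case: x => a b /=; ring. Qed.

Lemma conjMr (R : rcfType) (x : R[i]) : x^* * x = (normc x ^+ 2)%:C.
Proof. by apply: complex_eqP; [rewrite Re_conjM|]; case: x => a b //=; ring. Qed.

Lemma normcZ (R : rcfType) (s : R) (x : R[i]) : 0 <= s -> normc (s%:C * x) = s * normc x.
Proof. by move=> s0; rewrite normcM normc_real ger0_norm. Qed.

Lemma ReZ (R : rcfType) (s : R) (x : R[i]) : complex.Re (s%:C * x) = s * complex.Re x.
Proof. by case: x => a b /=; ring. Qed.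

Lemma expi_swap (R : realType) (s t : R) : expi s (t%:C) = expi t (s%:C).
Proof. by rewrite !expi_real mulrC. Qed.

Lemma admissible_convex (R : realType) (Phi : nat -> R) (N : nat) (a b : nat -> R[i]) (s : R) :
  admissible Phi N a -> admissible Phi N b -> 0 <= s <= 1 ->
  admissible Phi N (fun n => a n + s%:C * (b n - a n)).
Proof.
move=> ha hb /andP[s0 s1] n hn.
have -> : a n + s%:C * (b n - a n) = (1 - s)%:C * a n + s%:C * b n.
  by rewrite rmorphB rmorph1; ring.
apply: (le_trans (le_normcD _ _)); rewrite !normcZ ?subr_ge0 //.
have := ha n hn; have := hb n hn => h1 h2.
have : (1 - s) * normc (a n) <= (1 - s) * Phi n by rewrite ler_wpM2l // subr_ge0.
have : s * normc (b n) <= s * Phi n by rewrite ler_wpM2l.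
lra.
Qed.

Lemma dpoly_affine (R : realType) (N : nat) (a b : nat -> R[i]) (s : R) (z : R[i]) :
  dpoly (coefs (fun n => a n + s%:C * (b n - a n))) N z =
  dpoly (coefs a) N z + s%:C * (dpoly (coefs b) N z - dpoly (coefs a) N z).
Proof.
rewrite /dpoly -sumrB mulr_sumr -big_split /=; apply: eq_bigr => n _.
by rewrite /coefs; case: ifP => _; ring.
Qed.

(** A variational inequality: along the segment from [a] to [b], which stays admissible, the
    objective is quadratic in [s] and its slope at the minimiser [a] is nonnegative. *)
Lemma riemann_minimizer_dual (R : realType) (Phi : nat -> R) (H : R) (M N : nat) (a b : nat -> R[i]) :
  (0 < M)%N -> 0 < H -> admissible Phi N a -> admissible Phi N b ->
  (forall c, admissible Phi N c -> riemann_square H M N a <= riemann_square H M N c) ->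
  riemann_square H M N a <=
  H / M%:R * \sum_(k < M) complex.Re ((dpoly (coefs a) N ((k%:R * (H / M%:R))%:C))^* *
                                     dpoly (coefs b) N ((k%:R * (H / M%:R))%:C)).
Proof.
move=> M0 H0 ha hb hmin; set w := H / M%:R.
have w0 : 0 < w by rewrite divr_gt0 // ltr0n.
pose F k := dpoly (coefs a) N ((k%:R * w)%:C).
pose G k := dpoly (coefs b) N ((k%:R * w)%:C).
pose X := \sum_(k < M) complex.Re ((F k)^* * (G k - F k)).
pose Y := \sum_(k < M) normc (G k - F k) ^+ 2.
have key s : 0 < s <= 1 -> 0 <= 2 * X + s * Y.
  move=> /andP[s0 s1].
  have := hmin _ (admissible_convex ha hb (_ : 0 <= s <= 1)); rewrite (ltW s0) s1 => /(_ isT).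
  rewrite /riemann_square -/w ler_pM2l //.
  have -> : \sum_(k < M) normc (dpoly (coefs (fun n => a n + s%:C * (b n - a n))) N (k%:R * w)%:C) ^+ 2
    = \sum_(k < M) normc (F k) ^+ 2 + s * (2 * X + s * Y).
    rewrite /X /Y !mulr_sumr -big_split mulr_sumr -big_split /=; apply: eq_bigr => k _.
    rewrite dpoly_affine sqr_normcD -/(F k) -/(G k) mulrCA ReZ normcZ ?(ltW s0) //.
    by rewrite !exprMn; ring.
  by rewrite lerDl pmulr_rge0.
have X0 : 0 <= X.
  have Y0 : 0 <= Y by apply: sumr_ge0 => k _; rewrite sqr_ge0.
  rewrite leNgt; apply/negP => Xn.
  (* For X < 0 this gives s Y <= - X, and 2 X + s Y <= X < 0 contradicts [key]. *)
  pose s := Num.min 1 (- X / (Y + 1)).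
  have Y1 : 0 < Y + 1 by rewrite ltr_wpDl.
  have s0 : 0 < s by rewrite lt_min ltr01 divr_gt0 // oppr_gt0.
  have := key s; rewrite s0 ge_min lexx => /(_ isT).
  have : s * Y <= - X.
    apply: (@le_trans _ _ (- X / (Y + 1) * Y)).
      by rewrite ler_wpM2r // ge_min lexx orbT.
    by rewrite mulrAC ler_pdivrMr // ler_wpM2l ?oppr_ge0 ?(ltW Xn) ?lerDl //.
  by move: Xn; lra.
rewrite /riemann_square -/w ler_pM2l // -subr_ge0 -sumrB.
apply: le_trans X0 _; rewrite /X le_eqVlt; apply/orP; left; apply/eqP.
apply: eq_bigr => k _; rewrite -/(F k) -/(G k) -Re_conjM.
by case: (F k) (G k) => [x y] [x' y'] /=; ring.
Qed.

(* f = esum_poly M q t is the discretised Fourier transform of the conjugate of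
   the minimiser. *)
Lemma dual_certificate (R : realType) (Phi : nat -> R) (H mu : R) (N : nat) :
  (2 <= N)%N -> 0 < H -> 0 < mu -> (forall n, (2 <= n)%N -> 0 < Phi n) ->
  (forall a, admissible Phi N a -> mu <= mean_square H N a) ->
  exists M, exists q : nat -> R[i], exists t : nat -> R,
    [/\ forall k, (k < M)%N -> 0 <= t k <= H, \sum_(k < M) normc (q k) <= H &
      mu / 2 + \sum_(2 <= n < N.+1) Phi n / n%:R * normc (esum_poly M q t ((ln n%:R)%:C))
        <= complex.Re (esum_poly M q t 0)].
Proof.
move=> N2 H0 mu0 Phi0 hmu.
have N1 : (1 <= N)%N by exact: ltnW.
pose B := 2 * bound_coefs Phi N * (bound_coefs Phi N * ln N%:R) * H ^+ 2.
have B0 : 0 <= B.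
  have lnN : 0 <= ln N%:R :> R by apply: ln_ge0; rewrite ler1n.
  have Bc := bound_coefs_ge0 N Phi0.
  exact: (mulr_ge0 (mulr_ge0 (mulr_ge0 (ler0n _ 2) Bc) (mulr_ge0 Bc lnN)) (sqr_ge0 H)).
(* Enough sample points for a Riemann error of at most mu / 2; the other half of [mu] survives. *)
pose M := (Num.truncn (2 * B / mu)).+1.
have M0 : (0 < M)%N by [].
have BM : B / M%:R <= mu / 2.
  rewrite ler_pdivrMr ?ltr0n // mulrC -ler_pdivrMr ?divr_gt0 //.
  rewrite (_ : B / (mu / 2) = 2 * B / mu); last by field; rewrite gt_eqF.
  by apply: ltW; rewrite /M; apply: truncnS_gt.
pose w := H / M%:R.
have w0 : 0 < w by rewrite divr_gt0 // ltr0n.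
have [a ha hmin] := @admissible_minimizer R Phi N (riemann_square H M N)
  (2 * bound_coefs Phi N * H) Phi0 (mulr_ge0 (mulr_ge0 (ler0n _ 2) (bound_coefs_ge0 N Phi0)) (ltW H0))
  (fun a b => @riemann_square_lipschitz R Phi H M N a b N1 M0 (ltW H0)).
have Da : mu / 2 <= riemann_square H M N a.
  have := mean_square_le_riemann N1 M0 (ltW H0) ha; rewrite -/B.
  have := hmu a ha; lra.
have wM : w * M%:R = H by rewrite /w divfK // pnatr_eq0.
(* The zero coefficients compete with the value H. *)
have DaH : riemann_square H M N a <= H.
  have h0 : admissible Phi N (fun=> 0) by move=> n /andP[n2 _]; rewrite normc0 ltW // Phi0.
  apply: (le_trans (hmin _ h0)); rewrite /riemann_square -/w.
  rewrite (eq_bigr (fun=> 1)) ?sumr_const ?card_ord ?wM // => k _.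
  rewrite /dpoly big_ltn // big_nat big1 ?addr0.
    by rewrite /coefs eqxx mul1r normc_expi ln1 mul0r oppr0 expR0 expr1n.
  move=> n /andP[n2 _]; rewrite /coefs; have -> : (n == 1%N) = false by case: n n2 => [|[|]].
  by rewrite !mul0r.
pose F k := dpoly (coefs a) N ((k%:R * w)%:C).
pose q k := w%:C * (F k)^*.
pose t k := k%:R * w.
pose f := esum_poly M q t.
exists M, q, t; split.
- move=> k kM; rewrite /t mulr_ge0 ?(ltW w0) //= -wM mulrC ler_wpM2l ?(ltW w0) //.
  by rewrite ler_nat ltnW.
- rewrite (eq_bigr (fun k : 'I_M => w * normc (F k))); last first.
    by move=> k _; rewrite /q normcZ ?(ltW w0) // normcJ.
  (* w |F| <= w/2 + w |F|^2 / 2, and each half sums to at most H / 2. *)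
  apply: (@le_trans _ _ (\sum_(k < M) (w / 2 + (w * normc (F k) ^+ 2) / 2))).
    apply: ler_sum => k _; have := sqr_ge0 (normc (F k) - 1); rewrite sqrrB1.
    move: (normc (F k)) => x h; rewrite -mulrDl -[X in X + _]mulr1 -mulrDr -mulrA.
    by rewrite ler_pM2l // ler_pdivlMr //; rewrite -mulr_natr in h *; lra.
  have sc (c : R) : \sum_(k < M) c = M%:R * c by rewrite sumr_const card_ord mulr_natl.
  rewrite big_split /= sc -mulr_suml -mulr_sumr mulrA [M%:R * w]mulrC wM.
  have -> : w * \sum_(k < M) normc (F k) ^+ 2 = riemann_square H M N a by [].
  by move: DaH; lra.
(* The extremal competitor: its phase turns every term with n >= 2 of the pairing into - Phi n / n
   |f(log n)|. Where [f] vanishes the quotient is 0 by convention, which is still admissible. *)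
pose b n := - (Phi n)%:C * (f ((ln n%:R)%:C))^* / (normc (f ((ln n%:R)%:C)))%:C.
have hb : admissible Phi N b.
  move=> n /andP[n2 _]; rewrite /b mulNr mulNr normcN normcM normcV normcZ ?(ltW (Phi0 _ n2)) //.
  rewrite normcJ normc_real ger0_norm ?normc_ge0 //.
  have [->|h] := eqVneq (normc (f (ln n%:R)%:C)) 0; first by rewrite mulr0 mul0r (ltW (Phi0 _ n2)).
  by rewrite mulfK.
have := riemann_minimizer_dual M0 H0 ha hb hmin; rewrite -/w.
set D := riemann_square H M N a in Da *.
suff -> : w * \sum_(k < M) complex.Re ((F k)^* * dpoly (coefs b) N (k%:R * w)%:C) =
  complex.Re (f 0) - \sum_(2 <= n < N.+1) Phi n / n%:R * normc (f ((ln n%:R)%:C)).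
  move: Da; rewrite -/f; lra.
rewrite mulr_sumr (eq_bigr (fun k : 'I_M => complex.Re (\sum_(1 <= n < N.+1) coefs b n * (q k * expi (t k) (ln n%:R)%:C)))); last first.
  move=> k _; rewrite -ReZ /q mulrA mulr_sumr; congr complex.Re; apply: eq_bigr => n _.
  by rewrite (expi_swap (ln _)) /t; ring.
rewrite -Re_sum exchange_big /=.
rewrite (eq_bigr (fun n => coefs b n * f (ln n%:R)%:C)); last by move=> n _; rewrite mulr_sumr.
rewrite big_ltn // ReD {1}/coefs eqxx mul1r ln1; congr (_ + _).
rewrite Re_sum -sumrN; apply: eq_big_nat => n /andP[n2 _].
rewrite /coefs; have -> : (n == 1%N) = false by case: n n2 => [|[|]].
rewrite /b; set u := f _.
have [u0|u0] := eqVneq u 0; first by rewrite u0 !mulr0 normc0 mulr0 oppr0.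
have nu : normc u != 0 by rewrite normc_eq0.
have -> : - (Phi n)%:C * u^* / (normc u)%:C / n%:R * u = (- (Phi n / n%:R * normc u))%:C.
  transitivity (- (Phi n)%:C * (u^* * u) / (normc u)%:C / n%:R); first by ring.
  rewrite conjMr -(rmorph_nat (real_complex R)) -!fmorphV -rmorphN -!rmorphM; congr (_ %:C).
  by field; rewrite nu pnatr_eq0 -lt0n ltnW.
by [].
Qed.

(** * Barrier functions in the upper half-plane *)

(** This is (1 - w) / 2 for the usual Cayley transform w = (z - i) / (z + i). It sends the upper
    half-plane into the disc |q - 1/2| <= 1/2 and infinity to 0, so polynomials in it without
    constant term are bounded there and decay like 1 / |z|. *)
Definition cayley (R : rcfType) (z : R[i]) : R[i] := 'i%C * (z + 'i%C)^-1.

Lemma Di_neq0 (R : rcfType) (z : R[i]) : 0 <= complex.Im z -> z + 'i%C != 0.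
Proof.
case: z => x y /= y0; apply/negP => /eqP [_ h].
by have : 0 < y + 1 by [rewrite ltr_wpDl|]; rewrite h ltxx.
Qed.

Lemma normc_i (R : rcfType) : normc ('i%C : R[i]) = 1.
Proof. by rewrite /= expr0n expr1n /= add0r sqrtr1. Qed.

Lemma normcDi_ge (R : rcfType) (z : R[i]) : 0 <= complex.Im z ->
  1 <= normc (z + 'i%C) /\ normc z <= normc (z + 'i%C).
Proof.
case: z => x y /= y0; split.
  rewrite -[leLHS]sqrtr1 ler_wsqrtr //.
  by have := sqr_ge0 (x + 0); have := sqr_ge0 y; move: ((x + 0)^+2) => a; rewrite !expr2; nra.
rewrite ler_wsqrtr // addr0 lerD2l lerXn2r ?nnegrE ?addr_ge0 //.
by rewrite lerDl.
Qed.

Lemma cayley_le1 (R : rcfType) (z : R[i]) : 0 <= complex.Im z -> normc (cayley z) <= 1.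
Proof.
move=> /normcDi_ge[h _]; rewrite normcM normc_i mul1r normcV invf_le1 //.
exact: lt_le_trans h.
Qed.

Lemma cayley_decay (R : rcfType) (z : R[i]) : 0 <= complex.Im z -> 0 < normc z ->
  normc (cayley z) <= (normc z)^-1.
Proof.
move=> /normcDi_ge[_ h] z0; rewrite normcM normc_i mul1r normcV lef_pV2 // posrE //.
exact: lt_le_trans h.
Qed.

Lemma cayley_real (R : rcfType) (u : R) :
  cayley (u%:C) = (u ^+ 2 + 1)^-1 +i* (u / (u ^+ 2 + 1)).
Proof.
have u0 : 0 < u ^+ 2 + 1 by rewrite ltr_wpDl ?sqr_ge0.
apply: complex_eqP; rewrite /cayley /= !add0r ?addr0 !expr1n.
  by field; rewrite gt_eqF.
by field; rewrite gt_eqF.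
Qed.

Lemma cayley_imag (R : rcfType) (v : R) : 0 <= v ->
  cayley (0 +i* v) = (1 + v)^-1%:C.
Proof.
move=> v0; have h0 : 1 + v != 0 by rewrite gt_eqF // ltr_wpDr.
apply: complex_eqP; rewrite /cayley /= ?addr0 expr0n /= ?add0r.
  by field; rewrite h0.
by rewrite !mul0r mulr0 addr0.
Qed.

Lemma taylor2_cayley (R : realType) (z : R[i]) : 0 <= complex.Im z -> taylor2 (@cayley R) z.
Proof.
move=> z0; apply: taylor2M; first exact: taylor2_cst.
by apply: taylor2_inv; exact: Di_neq0.
Qed.

Lemma taylor2_cayley_scale (R : realType) (s : R) (z : R[i]) : 0 <= s -> 0 <= complex.Im z ->
  taylor2 (fun z => cayley (s%:C * z)) z.
Proof.
move=> s0 z0; have [->|sn0] := eqVneq s 0.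
  have -> : (fun z : R[i] => cayley (0%:C * z)) = (fun=> cayley (0 : R[i])).
    by apply/funext => w; rewrite rmorph0 mul0r.
  exact: taylor2_cst.
have sC0 : (s%:C : R[i]) != 0 by rewrite eq_complex /= (negbTE sn0).
have -> : (fun z : R[i] => cayley (s%:C * z)) = (fun z => ('i%C / s%:C) * (z + 'i%C / s%:C)^-1).
  apply/funext => w; rewrite /cayley -mulrA -invfM; congr (_ * _^-1).
  by field.
apply: taylor2M; first exact: taylor2_cst.
apply: taylor2_inv; have /Di_neq0 : 0 <= complex.Im (s%:C * z).
  by case: z z0 => x y /= y0; rewrite mul0r addr0 mulr_ge0.
apply: contra => /eqP h; apply/eqP.
have -> : s%:C * z + 'i%C = s%:C * (z + 'i%C / s%:C) by field.
by rewrite h mulr0.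
Qed.

(* The coefficients are chosen so that, for z in the real line, the real part
   is z^2 (4 z^2 - 1) (2 z + 1) / (z^2 + 1)^3: it is nonpositive left of 1/2,
   with a double zero at 0, while on the imaginary axis it grows linearly
   from 0. *)
Definition barrier_of (R : rcfType) (q : R[i]) : R[i] :=
  q * ((11 / 8)%:C - (21 / 8)%:C * q + (10 / 8)%:C * q ^+ 2)
  - 'i%C * q * (8%:C - (31 / 4)%:C * q + (5 / 2)%:C * q ^+ 2).

Definition barrier (R : rcfType) (z : R[i]) := barrier_of (cayley z).

Lemma barrier_le (R : rcfType) (z : R[i]) : 0 <= complex.Im z ->
  normc (barrier z) <= 40 * normc (cayley z).
Proof.
move=> z0; rewrite /barrier /barrier_of; set q := cayley z.
have q1 : normc q <= 1 by exact: cayley_le1.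
have -> : q * ((11 / 8)%:C - (21 / 8)%:C * q + (10 / 8)%:C * q ^+ 2)
  - 'i%C * q * (8%:C - (31 / 4)%:C * q + (5 / 2)%:C * q ^+ 2) =
 ((11 / 8)%:C + - (21 / 8)%:C * q + (10 / 8)%:C * q ^+ 2
  + - 'i%C * (8%:C + - (31 / 4)%:C * q + (5 / 2)%:C * q ^+ 2)) * q by ring.
rewrite normcM ler_wpM2r ?normc_ge0 //.
have cb (r : R) : 0 <= r -> normc (r%:C) <= r by move=> r0; rewrite normc_real ger0_norm.
have q2 : normc (q ^+ 2) <= 1 by rewrite normcX exprn_ile1 ?normc_ge0.
apply: (@le_trans _ _ (11 / 8 + 21 / 8 * 1 + 10 / 8 * 1 + 1 * (8 + 31 / 4 * 1 + 5 / 2 * 1))); last lra.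
do ![apply: normcD_le | apply: normcM_le]; rewrite ?normcN ?normc_i //; apply: cb; lra.
Qed.

Lemma barrier_real (R : rcfType) (u : R) :
  complex.Re (barrier u%:C) = u ^+ 2 * (4 * u ^+ 2 - 1) * (2 * u + 1) / (u ^+ 2 + 1) ^+ 3.
Proof.
have u0 : u ^+ 2 + 1 != 0 by rewrite gt_eqF // ltr_wpDl ?sqr_ge0.
rewrite /barrier cayley_real /barrier_of !expr2 /=.
by field; rewrite -expr2 u0.
Qed.

Lemma barrier_imag (R : rcfType) (v : R) : 0 <= v ->
  complex.Re (barrier (0 +i* v)) = v * (11 * v + 1) / (8 * (1 + v) ^+ 3).
Proof.
move=> v0; have h0 : 1 + v != 0 by rewrite gt_eqF // ltr_wpDr.
rewrite /barrier cayley_imag // /barrier_of !expr2 /=.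
by field; rewrite h0.
Qed.

Lemma barrier_real_le0 (R : rcfType) (u : R) : u <= 1 / 2 -> complex.Re (barrier u%:C) <= 0.
Proof.
move=> u2; rewrite barrier_real.
have u0 : 0 < u ^+ 2 + 1 by rewrite ltr_wpDl ?sqr_ge0.
rewrite ler_pdivrMr ?exprn_gt0 // mul0r.
have -> : u ^+ 2 * (4 * u ^+ 2 - 1) * (2 * u + 1) = - ((u * (2 * u + 1)) ^+ 2 * (1 - 2 * u)) by ring.
by rewrite oppr_le0 mulr_ge0 ?sqr_ge0 //; lra.
Qed.

Lemma barrier_real_le (R : rcfType) (u : R) : 0 < u -> complex.Re (barrier u%:C) <= 12 / u.
Proof.
move=> u0; rewrite barrier_real.
have h0 : 0 < u ^+ 2 + 1 by rewrite ltr_wpDl ?sqr_ge0.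
rewrite ler_pdivrMr ?exprn_gt0 // [leRHS]mulrAC ler_pdivlMr //.
have h2 := sqr_ge0 u; have h4 := sqr_ge0 (u ^+ 2); have h3 : 0 <= u ^+ 3 by rewrite exprn_ge0 // ltW.
have h6 : 0 <= u ^+ 4 * (u - 1) ^+ 2 by rewrite mulr_ge0 ?sqr_ge0 ?exprn_ge0 // ltW.
have h7 : 0 <= u ^+ 6 by rewrite exprn_ge0 // ltW.
(* The difference is split into nonnegative terms; its only negative monomial, - 4 u^5, is absorbed
   by 2 u^4 (u - 1)^2. *)
rewrite -subr_ge0.
have -> : 12 * (u ^+ 2 + 1) ^+ 3 - u ^+ 2 * (4 * u ^+ 2 - 1) * (2 * u + 1) * u =
  2 * (u ^+ 4 * (u - 1) ^+ 2) + 2 * u ^+ 6 + 36 * (u ^+ 2) ^+ 2 - 2 * (u ^+ 2) ^+ 2 + 36 * u ^+ 2 + 12 + 2 * (u ^+ 2) ^+ 2 + u ^+ 3 by ring.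
lra.
Qed.

Lemma barrier_imag_ge (R : rcfType) (v : R) : 0 <= v <= 1 ->
  v / 64 <= complex.Re (barrier (0 +i* v)).
Proof.
move=> /andP[v0 v1]; rewrite barrier_imag //.
have h3 : (1 + v) ^+ 3 <= 8.
  have -> : (8 : R) = 2 ^+ 3 by ring.
  by rewrite lerXn2r ?nnegrE ?addr_ge0 //; lra.
have h0 : 0 < (1 + v) ^+ 3 by rewrite exprn_gt0 // ltr_wpDr.
rewrite ler_pdivlMr ?mulr_gt0 //.
have -> : v / 64 * (8 * (1 + v) ^+ 3) = v * ((1 + v) ^+ 3 / 8) by field.
by rewrite ler_wpM2l //; lra.
all: by rewrite ltr_wpDr.
Qed.

Lemma ln2_bounds (R : realType) : 1 / 2 <= ln (2 : R) <= 1.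
Proof.
have h : expR (1 / 2) <= 2 :> R.
  have := expR_ge1Dx (- (1 / 2) : R); rewrite expRN => h.
  rewrite -[expR _]invrK -[leRHS]invrK lef_pV2 ?posrE ?invr_gt0 ?expR_gt0 //.
  by apply: le_trans h; lra.
apply/andP; split.
  by rewrite -ler_expR lnK // posrE.
by rewrite -ler_expR lnK ?posrE //; apply: le_trans (expR_ge1Dx 1); lra.
Qed.

(** With j = k + 1, the j-th barrier is stretched by 2 j ln 2, so that on the real line it is
    nonpositive left of j ln 2 = log 2^j. The weight psi_j / (24 j) turns its bound 12 / u into
    psi_j ln 2 / x. At most x / ln 2 scales are active at x, so together they contribute at most the
    largest active psi. *)
Definition barrier_sum (R : realType) (J : nat) (psi : nat -> R) (z : R[i]) : R[i] :=
  \sum_(k < J) (psi k.+1 / (24 * k.+1%:R))%:C * barrier (((2 * k.+1%:R * ln 2)^-1)%:C * z).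

Lemma taylor2_barrier_sum (R : realType) (J : nat) (psi : nat -> R) (z : R[i]) :
  0 <= complex.Im z -> taylor2 (barrier_sum J psi) z.
Proof.
move=> z0; apply: taylor2_sum => k; apply: taylor2M; first exact: taylor2_cst.
have /andP[l2 _] := ln2_bounds R.
have hq : taylor2 (fun z => cayley (((2 * k.+1%:R * ln 2)^-1)%:C * z)) z.
  by apply: taylor2_cayley_scale; rewrite ?invr_ge0 ?mulr_ge0 //; lra.
rewrite /barrier /barrier_of.
have hq2 : taylor2 (fun z => cayley (((2 * k.+1%:R * ln 2)^-1)%:C * z) ^+ 2) z by exact: (taylor2M hq hq).
by do ?[exact: hq | exact: hq2 | exact: taylor2_cst | apply: taylor2D | apply: taylor2N | apply: taylor2M].
Qed.

Lemma barrier_sum_real_le (R : realType) (J : nat) (psi : nat -> R) (x phi : R) :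
  (forall k, 0 <= psi k) -> 0 <= phi ->
  (forall j, (0 < j <= J)%N -> j%:R * ln 2 <= x -> psi j <= phi) ->
  complex.Re (barrier_sum J psi x%:C) <= phi.
Proof.
move=> psi0 phi0 hphi.
have /andP[l2 l2'] := ln2_bounds R.
have l0 : 0 < ln (2 : R) by lra.
rewrite Re_sum.
apply: (@le_trans _ _ (\sum_(k < J) (if k.+1%:R * ln 2 <= x then phi * (ln 2 / x) else 0))).
  apply: ler_sum => k _.
  have k0 : 0 < k.+1%:R :> R by rewrite ltr0n.
  have s0 : 0 < 2 * k.+1%:R * ln (2 : R) by rewrite !mulr_gt0.
  have c0 : 0 <= psi k.+1 / (24 * k.+1%:R) by rewrite divr_ge0 ?psi0 ?mulr_ge0.
  rewrite ReZ.
  have -> : ((2 * k.+1%:R * ln 2)^-1)%:C * x%:C = ((2 * k.+1%:R * ln 2)^-1 * x)%:C by rewrite rmorphM.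
  case: ifPn => [kx|]; last first.
    rewrite -ltNge => xk; rewrite mulr_ge0_le0 //; apply: barrier_real_le0.
    by rewrite mulrC ler_pdivrMr //; lra.
  have x0 : 0 < x by apply: lt_le_trans kx; rewrite mulr_gt0.
  have u0 : 0 < (2 * k.+1%:R * ln 2)^-1 * x by rewrite mulr_gt0 ?invr_gt0.
  apply: (@le_trans _ _ (psi k.+1 / (24 * k.+1%:R) * (12 / ((2 * k.+1%:R * ln 2)^-1 * x)))).
    by rewrite ler_wpM2l // barrier_real_le.
  have -> : psi k.+1 / (24 * k.+1%:R) * (12 / ((2 * k.+1%:R * ln 2)^-1 * x)) = psi k.+1 * (ln 2 / x).
    by field; rewrite !gt_eqF.
  rewrite ler_wpM2r ?divr_ge0 ?(ltW l0) ?(ltW x0) //; apply: hphi => //=.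
have [x1|x1] := ltP x (ln 2).
  rewrite big1 // => k _; case: ifPn => // h.
  have : ln 2 <= k.+1%:R * ln 2 :> R by rewrite ler_peMl ?(ltW l0) // ler1n.
  by move=> /le_trans/(_ h); rewrite leNgt x1.
have x0 : 0 < x by exact: lt_le_trans x1.
have count : \sum_(k < J) (if k.+1%:R * ln 2 <= x then ln 2 else 0 : R) <= x.
  (* The minimum makes the induction close: scale K + 1 is counted only if (K + 1) ln 2 <= x. *)
  suff : \sum_(k < J) (if k.+1%:R * ln 2 <= x then ln 2 else 0 : R) <= Num.min x (J%:R * ln 2).
    by rewrite le_min => /andP[].
  elim: (J) => [|K IH]; first by rewrite big_ord0 mul0r le_min lexx ltW.
  rewrite big_ord_recr /= le_min; move: IH; rewrite le_min => /andP[h1 h2].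
  rewrite -[K.+1%:R]natr1 mulrDl mul1r lerD ?andbT //; last by case: ifP => // _; exact: ltW.
  case: ifPn => [|_]; last by rewrite addr0.
  by apply: le_trans; rewrite lerD2r.
have -> : \sum_(k < J) (if k.+1%:R * ln 2 <= x then phi * (ln 2 / x) else 0) =
  phi / x * \sum_(k < J) (if k.+1%:R * ln 2 <= x then ln 2 else 0 : R).
  rewrite mulr_sumr; apply: eq_bigr => k _; case: ifP => _; rewrite ?mulr0 //.
  by field; rewrite gt_eqF.
by rewrite mulrAC ler_pdivrMr // ler_wpM2l.
Qed.

(** Needed at infinity: beyond radius [A] the sum has modulus at most 1 and its exponential at most
    4. *)
Lemma barrier_sum_decay (R : realType) (J : nat) (psi : nat -> R) :
  exists2 A : R, 0 <= A & forall z, 0 <= complex.Im z -> 0 < normc z ->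
    normc (barrier_sum J psi z) <= A / normc z.
Proof.
have /andP[l2 _] := ln2_bounds R.
have l0 : 0 < ln (2 : R) by lra.
exists (\sum_(k < J) `|psi k.+1 / (24 * k.+1%:R)| * (40 * (2 * k.+1%:R * ln 2))).
  by apply: sumr_ge0 => k _; rewrite !mulr_ge0 // ltW.
move=> z z0 nz; apply: (le_trans (normc_sum _ _ _)).
rewrite mulr_suml; apply: ler_sum => k _.
have s0 : 0 < 2 * k.+1%:R * ln (2 : R) by rewrite !mulr_gt0 // ltr0n.
rewrite normcM normc_real -[leRHS]mulrA ler_wpM2l //.
set s := _ * ln 2 in s0 *.
have sV : 0 < s^-1 by rewrite invr_gt0.
have hi : 0 <= complex.Im (s^-1%:C * z).
  by case: (z) z0 => x y /= y0; rewrite mul0r addr0 mulr_ge0 // ltW.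
have hn : normc (s^-1%:C * z) = s^-1 * normc z by rewrite normcZ // ltW.
apply: (le_trans (barrier_le hi)); rewrite -mulrA ler_wpM2l //.
apply: (le_trans (cayley_decay hi _)); first by rewrite hn mulr_gt0.
by rewrite hn invfM invrK.
Qed.

(** 3072 = 24 * 2 * 64: the weight, the stretching with ln 2 <= 1, and the slope bound of one
    barrier on the imaginary axis. *)
Lemma barrier_sum_imag_ge (R : realType) (J : nat) (psi : nat -> R) (y : R) :
  (forall k, 0 <= psi k) -> 0 <= y <= 1 ->
  y / 3072 * \sum_(k < J) psi k.+1 / k.+1%:R ^+ 2 <= complex.Re (barrier_sum J psi (0 +i* y)).
Proof.
move=> psi0 /andP[y0 y1]; rewrite Re_sum mulr_sumr; apply: ler_sum => k _.
have /andP[l2 l2'] := ln2_bounds R.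
have l0 : 0 < ln (2 : R) by lra.
have k1 : 1 <= k.+1%:R :> R by rewrite ler1n.
have k0 : 0 < k.+1%:R :> R by rewrite ltr0n.
have s0 : 0 < 2 * k.+1%:R * ln (2 : R) by rewrite !mulr_gt0.
have c0 : 0 <= psi k.+1 / (24 * k.+1%:R) by rewrite divr_ge0 ?psi0 ?mulr_ge0.
rewrite ReZ.
have -> : ((2 * k.+1%:R * ln 2)^-1)%:C * (0 +i* y) = 0 +i* (y / (2 * k.+1%:R * ln 2)).
  by apply: complex_eqP => /=; ring.
set v := y / (2 * k.+1%:R * ln 2).
have v0 : 0 <= v by apply: divr_ge0 => //; exact: (ltW s0).
have v1 : v <= 1.
  rewrite ler_pdivrMr // mul1r; apply: (le_trans y1).
  have : 1 * (1 / 2) <= k.+1%:R * ln (2 : R) by apply: ler_pM => //; lra.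
  by rewrite -mulrA; lra.
apply: le_trans (_ : psi k.+1 / (24 * k.+1%:R) * (v / 64) <= _); last first.
  by rewrite ler_wpM2l // barrier_imag_ge // v0 v1.
have -> : y / 3072 * (psi k.+1 / k.+1%:R ^+ 2) = psi k.+1 / (24 * k.+1%:R) * (y / (2 * k.+1%:R * 1) / 64).
  by field; rewrite gt_eqF.
rewrite ler_wpM2l // ler_pM2r ?invr_gt0 // /v ler_wpM2l // lef_pV2 ?posrE ?mulr_gt0 //.
by rewrite ler_wpM2l // mulr_ge0 // ltW.
Qed.

(** * The divergent case *)

(** Visits of an arithmetic progression to [n, n + 1), times the step, are bounded by the distance
    the progression has moved beyond [n], clamped between 0 and 1 + be; this is the induction
    invariant. *)
Lemma count_truncn_le (R : realType) (K n : nat) (al be : R) : 0 <= al -> 0 < be ->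
  \sum_(k < K) (n == Num.truncn (al + be * k%:R))%:R <= be^-1 + 1.
Proof.
move=> al0 be0; rewrite -(ler_pM2l be0) mulrDr divff ?gt_eqF // mulr1.
suff : be * \sum_(k < K) (n == Num.truncn (al + be * k%:R))%:R <=
   Num.max 0 (Num.min (al + be * K%:R - n%:R) (1 + be)).
  by move/le_trans; apply; rewrite ge_max ge_min lexx orbT andbT addr_ge0 // ltW.
elim: K => [|K IH]; first by rewrite big_ord0 mulr0 le_max lexx.
rewrite big_ord_recr /= mulrDr; apply: le_trans (lerD IH (lexx _)) _.
rewrite eq_sym truncn_eq; last by rewrite addr_ge0 // mulr_ge0 // ltW.
rewrite -!natr1; set S := al + be * K%:R - n%:R.
have -> : al + be * (K%:R + 1) - n%:R = S + be by rewrite /S; ring.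
have -> : (n%:R <= al + be * K%:R < n%:R + 1) = (0 <= S < 1).
  by rewrite /S subr_ge0 ltrBlDl.
case: (boolP (0 <= S < 1)) => [/andP[s0 s1]|_]; last first.
  rewrite mulr0 addr0 ge_max [0 <= Num.max _ _]le_max lexx /=.
  by rewrite le_max le_min !ge_min lexx !orbT andbT lerDl (ltW be0) !orbT.
rewrite mulr1 (min_idPl _); last by lra.
rewrite (max_idPr _) // le_max le_min; apply/orP; right; lra.
Qed.

(* The exponentials of the shifted points spread evenly over the integers of
   an interval of length comparable to exp x, so that the weighted sum over
   the points log n controls the average. *)
Lemma log_average_le (R : realType) (Phi : nat -> R) (f : R -> R) (H L eta x : R) (N K : nat) :
  (forall n, (2 <= n)%N -> 0 < Phi n) ->
  (forall m n, (2 <= m)%N -> (m <= n)%N -> Phi m <= Phi n) ->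
  (forall u, 0 <= f u) -> (forall u v, f u <= f v + L * `|u - v|) -> 0 <= L ->
  \sum_(2 <= n < N.+1) Phi n / n%:R * f (ln n%:R) <= H ->
  0 < eta <= 1 -> ln 2 <= x -> 2 * expR x <= N%:R -> (N <= K)%N ->
  \sum_(k < K) f (x + ln (1 + eta * k%:R / K%:R)) <=
  K%:R * (4 * H / (eta * Phi (Num.truncn (expR x))) + 2 * L / expR x).
Proof.
move=> Phi0 Phim f0 fL L0 hH /andP[eta0 eta1] x2 xN NK.
set E := expR x; set m := Num.truncn E.
have E2 : 2 <= E by rewrite -(@lnK R 2) ?posrE // ler_expR.
have E0 : 0 < E by exact: expR_gt0.
have /andP[mE Em] := truncn_itv (ltW E0); rewrite -/m in mE Em.
have m2 : (2 <= m)%N by rewrite truncn_ge_nat // ltW.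
have KE : 2 * E <= K%:R by apply: (le_trans xN); rewrite ler_nat.
have K0 : 0 < K%:R :> R by apply: lt_le_trans KE; lra.
have Phim0 := Phi0 _ m2.
(* E (1 + eta k / K) = E + be k: the exponentials of the shifted points form an arithmetic
   progression. *)
pose be := E * eta / K%:R.
have be0 : 0 < be by rewrite divr_gt0 // mulr_gt0.
pose n k := Num.truncn (E + be * k%:R).
pose w j := Phi j / j%:R * f (ln j%:R).
have yk k : (k < K)%N -> [/\ E <= E + be * k%:R, E + be * k%:R <= 2 * E & x + ln (1 + eta * k%:R / K%:R) = ln (E + be * k%:R)].
  move=> kK.
  have k1 : 0 <= eta * k%:R / K%:R <= 1.
    rewrite divr_ge0 ?mulr_ge0 ?(ltW eta0) //= ler_pdivrMr // mul1r.
    by apply: (@le_trans _ _ (1 * k%:R)); [rewrite ler_wpM2r|rewrite mul1r ler_nat ltnW].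
  have ybe : E + be * k%:R = E * (1 + eta * k%:R / K%:R).
    by rewrite /be; field; rewrite gt_eqF.
  have y0 : 0 < 1 + eta * k%:R / K%:R by case/andP: k1; lra.
  split.
  - by rewrite lerDl mulr_ge0 // ltW.
  - by rewrite ybe mulrC ler_pM2r //; case/andP: k1; lra.
  - by rewrite ybe lnM ?posrE // expRK.
(* Rounding a point y >= E down to an integer n moves its logarithm by at most 1 / n <= 2 / E. *)
have step1 k : (k < K)%N -> f (x + ln (1 + eta * k%:R / K%:R)) <= f (ln (n k)%:R) + 2 * L / E.
  move=> /yk[y1 y2 ->]; set y := E + be * k%:R in y1 y2 *.
  have y0 : 0 < y by lra.
  have /andP[ny yn] := truncn_itv (ltW y0); rewrite -/(n k) in ny yn.
  have nE : E / 2 <= (n k)%:R by move: yn; rewrite -natr1; lra.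
  have n0 : 0 < (n k)%:R :> R by lra.
  apply: (le_trans (fL _ (ln (n k)%:R))); rewrite lerD2l.
  have -> : 2 * L / E = L * (2 / E) by ring.
  rewrite ler_wpM2l // ger0_norm ?subr_ge0 ?ler_ln ?posrE // -ln_div ?posrE //.
  have -> : y / (n k)%:R = 1 + (y - (n k)%:R) / (n k)%:R by field; rewrite gt_eqF.
  apply: (le_trans (le_ln1Dx _)); first by apply: lt_le_trans (_ : 0 <= _); rewrite ?ltrN10 // divr_ge0 ?subr_ge0 // ltW.
  apply: (@le_trans _ _ (1 / (n k)%:R)).
    by rewrite ler_wpM2r ?invr_ge0 ?(ltW n0) //; move: yn; rewrite -natr1; lra.
  by rewrite ler_pdivrMr // mulrAC ler_pdivlMr //; lra.
have nk k : (k < K)%N -> (m <= n k <= N)%N.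
  move=> /yk[y1 y2 _]; have y0 : 0 <= E + be * k%:R by apply: le_trans y1; exact: ltW.
  rewrite /n truncn_ge_nat // (le_trans mE) //=.
  rewrite -(ler_nat R); apply: le_trans xN; apply: le_trans y2.
  by case/andP: (truncn_itv y0).
(* As m <= n k <= 2 E, the value at n = n k is at most 2 E / Phi m times [w n], and each n is hit at
   most be^-1 + 1 <= 2 K / (eta E) times. The product of the two factors is 4 K / (eta Phi m). *)
have step2 : \sum_(k < K) f (ln (n k)%:R) <= K%:R * (4 * H / (eta * Phi m)).
  apply: (@le_trans _ _ (\sum_(k < K) \sum_(2 <= j < N.+1) (j == n k)%:R * (2 * E / Phi m * w j))).
    apply: ler_sum => k _; have /andP[mk kN] := nk k (ltn_ord k).
    have k2 : (2 <= n k)%N by exact: leq_trans mk.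
    have [y1 y2 _] := yk _ (ltn_ord k).
    have nE : (n k)%:R <= 2 * E.
      have y0 : 0 <= E + be * k%:R by apply: le_trans y1; exact: ltW.
      by apply: le_trans y2; case/andP: (truncn_itv y0).
    have n0 : 0 < (n k)%:R :> R by rewrite ltr0n ltnW.
    rewrite (@bigD1_seq _ _ _ _ _ (n k)) ?iota_uniq //=; last by rewrite mem_index_iota k2 ltnS.
    rewrite eqxx mul1r big1 ?addr0; last by move=> j /negbTE ->; rewrite mul0r.
    rewrite /w.
    have -> : 2 * E / Phi m * (Phi (n k) / (n k)%:R * f (ln (n k)%:R)) =
       (2 * E / (n k)%:R) * (Phi (n k) / Phi m) * f (ln (n k)%:R).
      by field; rewrite !gt_eqF.
    rewrite ler_peMl // -[leLHS]mulr1; apply: ler_pM => //.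
      by rewrite ler_pdivlMr // mul1r.
    by rewrite ler_pdivlMr // mul1r Phim.
  rewrite exchange_big /=.
  have w0 j : (2 <= j)%N -> 0 <= 2 * E / Phi m * w j.
    by move=> j2; rewrite !mulr_ge0 ?invr_ge0 ?(ltW (Phi0 _ j2)) // ltW.
  apply: (@le_trans _ _ (\sum_(2 <= j < N.+1) (2 * K%:R / (eta * E)) * (2 * E / Phi m * w j))).
    apply: ler_sum_nat => j /andP[j2 _]; rewrite -mulr_suml ler_wpM2r ?w0 //.
    apply: (le_trans (count_truncn_le _ _ (ltW E0) be0)).
    have -> : be^-1 = K%:R / (eta * E) by rewrite /be; field; rewrite !gt_eqF.
    have : 1 <= K%:R / (eta * E).
      rewrite ler_pdivlMr ?mulr_gt0 // mul1r; apply: (@le_trans _ _ (1 * E)); first by rewrite ler_wpM2r // ltW.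
      lra.
    by rewrite -[2 * K%:R / _]mulrA; lra.
  rewrite -!mulr_sumr.
  have -> : 2 * K%:R / (eta * E) * (2 * E / Phi m * \sum_(2 <= j < N.+1) w j) =
    K%:R * (4 * (\sum_(2 <= j < N.+1) w j) / (eta * Phi m)) by field; rewrite !gt_eqF.
  by rewrite ler_pM2l // ler_pM2r ?invr_gt0 ?mulr_gt0 // ler_pM2l.
rewrite mulrDr; apply: le_trans (lerD step2 (lexx _)).
have -> : K%:R * (2 * L / E) = \sum_(k < K) 2 * L / E by rewrite sumr_const card_ord mulr_natl.
by rewrite -big_split /=; apply: ler_sum => k _; exact: step1.
Qed.

Lemma normc_cexp_le4 (R : realType) (z : R[i]) : normc z <= 1 -> normc (cexp z) <= 4.
Proof.
move=> z1; rewrite normc_cexp; apply: (@le_trans _ _ (expR 1)).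
  by rewrite ler_expR (le_trans (ler_norm _)) // (le_trans (ge_normc_Re _)).
by apply: expR_le4; rewrite normr1.
Qed.

Lemma esum_poly_le (R : realType) (M : nat) (q : nat -> R[i]) (t : nat -> R) (B : R) (z : R[i]) :
  (forall k, (k < M)%N -> 0 <= t k) -> \sum_(k < M) normc (q k) <= B -> 0 <= complex.Im z ->
  normc (esum_poly M q t z) <= B.
Proof.
move=> t0 hB z0; apply: (le_trans (normc_sum _ _ _)); apply: le_trans hB.
apply: ler_sum => k _; rewrite normcM normc_expi ler_piMr ?normc_ge0 //.
by rewrite -[leRHS]expR0 ler_expR oppr_le0 mulr_ge0 // t0.
Qed.

Lemma esum_poly_dist_le (R : realType) (M : nat) (q : nat -> R[i]) (t : nat -> R) (B c : R) (z w : R[i]) :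
  \sum_(k < M) normc (q k) <= B -> 0 <= c ->
  (forall k, (k < M)%N -> normc (expi (t k) z - expi (t k) w) <= c) ->
  normc (esum_poly M q t z - esum_poly M q t w) <= B * c.
Proof.
move=> hB c0 hc; rewrite /esum_poly -sumrB; apply: (le_trans (normc_sum _ _ _)).
apply: (@le_trans _ _ (\sum_(k < M) normc (q k) * c)); last by rewrite -mulr_suml ler_wpM2r.
by apply: ler_sum => k _; rewrite -mulrBr normcM ler_wpM2l ?normc_ge0 // hc.
Qed.

Lemma esum_poly_lipschitz (R : realType) (M : nat) (q : nat -> R[i]) (t : nat -> R) (B H u v : R) :
  (forall k, (k < M)%N -> 0 <= t k <= H) -> \sum_(k < M) normc (q k) <= B -> 0 <= H ->
  normc (esum_poly M q t u%:C - esum_poly M q t v%:C) <= B * (H * `|u - v|).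
Proof.
move=> ht hB H0; apply: esum_poly_dist_le => //; first by rewrite mulr_ge0.
move=> k /ht/andP[t0 tH]; apply: (le_trans (expi_lipschitz _ _ _)).
by rewrite ger0_norm // ler_wpM2r.
Qed.

Lemma esum_poly_vertical (R : realType) (M : nat) (q : nat -> R[i]) (t : nat -> R) (B H u y : R) :
  (forall k, (k < M)%N -> 0 <= t k <= H) -> \sum_(k < M) normc (q k) <= B -> 0 <= H -> 0 <= y ->
  normc (esum_poly M q t (u +i* y) - esum_poly M q t u%:C) <= B * (H * y).
Proof.
move=> ht hB H0 y0; apply: esum_poly_dist_le => //; first by rewrite mulr_ge0.
move=> k /ht/andP[t0 tH].
have -> : u +i* y = u%:C + 0 +i* y by apply: complex_eqP => /=; ring.
have -> : expi (t k) (u%:C + 0 +i* y) - expi (t k) u%:C = expi (t k) u%:C * (expR (- (t k * y)) - 1)%:C.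
  rewrite expiD -[X in _ - X]mulr1 -mulrBr; congr (_ * _).
  rewrite rmorphB rmorph1; congr (_ - _).
  apply: complex_eqP; rewrite /expi /cexp /= !(mul0r, mulr0, mul1r, add0r, addr0, subr0, sub0r, oppr0, cos0, sin0, mulr1) //.
rewrite normcM normc_expi_real mul1r normc_real distrC.
have ty : 0 <= t k * y by rewrite mulr_ge0.
rewrite ger0_norm ?subr_ge0 -?[leRHS]expR0 ?ler_expR ?oppr_le0 //.
apply: (@le_trans _ _ (t k * y)); last by rewrite ler_wpM2r.
by have := expR_ge1Dx (- (t k * y)); lra.
Qed.

(** The maximum principle is applied to an average of |f(z + u_k)| times |exp W(z)|, W being the
    barrier sum of the capped logarithms, and is read off at i eta. [N] and [f] depend on [J], but
    the bound [Mt] does not, so the conclusion is uniform in [J]. *)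
Lemma divergent_bound (R : realType) (Phi : nat -> R) (H mu : R) :
  (forall n, (2 <= n)%N -> 0 < Phi n) ->
  (forall m n, (2 <= m)%N -> (m <= n)%N -> Phi m <= Phi n) ->
  0 < H -> 0 < mu ->
  (forall N a, (2 <= N)%N -> admissible Phi N a -> mu <= mean_square H N a) ->
  exists B : R, forall J,
    \sum_(k < J) Num.max 0 (Num.min (ln (Phi (2 ^ k.+1)%N)) (k.+1%:R * ln 2)) / k.+1%:R ^+ 2 <= B.
Proof.
move=> Phi0 Phim H0 mu0 hmu.
pose psi k := Num.max 0 (Num.min (ln (Phi (2 ^ k)%N)) (k%:R * ln 2)).
have psi0 k : 0 <= psi k by rewrite le_max lexx.
(* Going from 0 to u_k + i eta changes f by at most 2 eta H^2; this [eta] makes that at most mu / 4,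
   so that |f| >= mu / 4 there. *)
pose eta := Num.min 1 (mu / (8 * H ^+ 2)).
have HH : 0 < H ^+ 2 by rewrite exprn_gt0.
have eta0 : 0 < eta by rewrite lt_min ltr01 divr_gt0 // mulr_gt0.
have eta1 : eta <= 1 by rewrite ge_min lexx.
have etamu : eta * (8 * H ^+ 2) <= mu by rewrite -ler_pdivlMr ?mulr_gt0 // ge_min lexx orbT.
(* 4 H covers the points near infinity and those with Re W <= 0; the other terms bound the average
   on the rest of the real line after multiplication by exp(Re W). *)
pose Mt := 4 * H + 4 * H / eta + 2 * H ^+ 2.
have He0 : 0 < 4 * H / eta by rewrite divr_gt0 // mulr_gt0.
have Mt0 : 0 < Mt by rewrite /Mt; lra.
exists (3072 / eta * ln (4 * Mt / mu)) => J.
have [A A0 hA] := barrier_sum_decay J psi.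
(* A real x with 2 exp x > N then lies beyond [A], where exp W is bounded; [log_average_le] serves
   the x from ln 2 up to that point. *)
pose N := (2 * (Num.truncn (expR A)).+2)%N.
have N2 : (2 <= N)%N by rewrite /N mulnS.
have hN : 2 * expR A <= N%:R.
  rewrite /N natrM ler_wpM2l //; have := truncnS_gt (expR A).
  by rewrite -[_.+2%:R]natr1; lra.
have [M [q [t [ht hq hd]]]] := dual_certificate N2 H0 mu0 Phi0 (fun a => hmu N a N2).
set f := esum_poly M q t in hd.
have t0 k : (k < M)%N -> 0 <= t k by move=> /ht/andP[].
have fH z : 0 <= complex.Im z -> normc (f z) <= H by apply: esum_poly_le.
have fL u v : normc (f u%:C) <= normc (f v%:C) + H * H * `|u - v|.
  have := @esum_poly_lipschitz R M q t H H u v ht hq (ltW H0); rewrite -/f => h.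
  rewrite -lerBlDl -mulrA; apply: le_trans h.
  by apply: le_trans (ler_norm _) (ler_dist_normc _ _).
have hs : \sum_(2 <= n < N.+1) Phi n / n%:R * normc (f (ln n%:R)%:C) <= H.
  have h1 : complex.Re (f 0) <= H.
    by apply: (le_trans (ler_norm _)); apply: (le_trans (ge_normc_Re _)); apply: fH.
  by move: hd; lra.
have f0 : mu / 2 <= normc (f 0).
  apply: (@le_trans _ _ (complex.Re (f 0))); last by apply: (le_trans (ler_norm _)); exact: ge_normc_Re.
  apply: le_trans hd; rewrite lerDl big_nat sumr_ge0 // => n /andP[n2 _].
  by rewrite mulr_ge0 ?normc_ge0 // divr_ge0 // ltW // Phi0.
pose W := barrier_sum J psi.
pose K := N.
have K0 : 0 < K%:R :> R by rewrite ltr0n /K ltnW.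
pose u k : R := ln (1 + eta * k%:R / K%:R).
pose g k z : R[i] := K%:R^-1%:C * f (z + (u k)%:C) * cexp (W z).
have gE z : sum_norms K g z = K%:R^-1 * (\sum_(k < K) normc (f (z + (u k)%:C))) * normc (cexp (W z)).
  rewrite mulr_sumr mulr_suml; apply: eq_bigr => k _.
  by rewrite /g !normcM normc_real ger0_norm // invr_ge0 ltW.
have gle z B : 0 <= complex.Im z -> normc (cexp (W z)) <= B -> sum_norms K g z <= H * B.
  move=> z0 hB; rewrite gE; apply: ler_pM => //; rewrite ?normc_ge0 //.
    by rewrite mulr_ge0 ?invr_ge0 ?(ltW K0) // sumr_ge0 // => k _; exact: normc_ge0.
  rewrite mulrC ler_pdivrMr //.
  apply: (@le_trans _ _ (\sum_(k < K) H)).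
    by apply: ler_sum => k _; apply: fH; case: (z) z0 => a b /=; rewrite addr0.
  by rewrite sumr_const card_ord mulr_natr.
have far z : 0 <= complex.Im z -> A <= normc z -> 0 < normc z -> sum_norms K g z <= Mt.
  move=> z0 zA zn; apply: (@le_trans _ _ (H * 4)); last by rewrite /Mt; lra.
  apply: gle => //; apply: normc_cexp_le4; apply: (le_trans (hA _ z0 zn)).
  by rewrite ler_pdivrMr // mul1r.
have main z : 0 <= complex.Im z -> sum_norms K g z <= Mt.
  apply: max_principle_halfplane => //.
  - move=> k w w0; apply: taylor2M; last exact: taylor2_cexp (taylor2_barrier_sum J psi w0).
    apply: taylor2M; first exact: taylor2_cst.
    apply: taylor2_sum => j; apply: taylor2M; first exact: taylor2_cst.
    apply: taylor2_expi; apply: taylor2D; [exact: taylor2_id|exact: taylor2_cst].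
  - move=> x.
    have [x2|x2] := ltP x (ln 2).
      apply: (@le_trans _ _ (H * 1)); last by rewrite /Mt; lra.
      apply: gle => //; rewrite normc_cexp -[leRHS]expR0 ler_expR.
      apply: barrier_sum_real_le => // j /andP[j0 _] jx.
      have : ln 2 <= j%:R * ln 2 :> R.
        by rewrite ler_peMl ?ler1n // ln_ge0 // ler1n.
      by move=> /le_trans/(_ jx); rewrite leNgt x2.
    have l2 : 0 < ln (2 : R) by have := ln2_bounds R; lra.
    have x0 : 0 < x by exact: lt_le_trans x2.
    have [xN|xN] := leP (2 * expR x) N%:R; last first.
      apply: far => //; rewrite normc_real gtr0_norm //.
      by rewrite -ler_expR; move: hN xN; lra.
    set E := expR x; set m := Num.truncn E.
    have E2 : 2 <= E by rewrite -(@lnK R 2) ?posrE // ler_expR.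
    have E0 : 0 < E by exact: expR_gt0.
    have m2 : (2 <= m)%N by rewrite truncn_ge_nat // ltW.
    have Phm := Phi0 _ m2.
    (* The two caps match the two terms of the average: exp phi <= Phi m (when Phi m > 1) offsets 1
       / Phi m, and exp phi <= exp x offsets the Lipschitz error. *)
    pose phi := Num.max 0 (Num.min (ln (Phi m)) x).
    have hW : complex.Re (W x%:C) <= phi.
      apply: barrier_sum_real_le => //; first by rewrite le_max lexx.
      move=> j /andP[j0 _] jx; rewrite /psi /phi ge_max le_max lexx /= le_max.
      rewrite le_min !ge_min; apply/orP; right; rewrite jx orbT andbT.
      have jm : (2 ^ j <= m)%N.
        rewrite truncn_ge_nat ?(ltW E0) // natrX.
        by rewrite -[2%:R](@lnK R) ?posrE // -expRM_natl ler_expR.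
      have j2 : (2 <= 2 ^ j)%N by rewrite -{1}(expn1 2) leq_exp2l.
      by apply/orP; left; rewrite ler_ln ?posrE; [exact: Phim|exact: Phi0|exact: Phm].
    have [Ph1|Ph1] := leP (Phi m) 1.
      apply: (@le_trans _ _ (H * 1)); last by rewrite /Mt; lra.
      apply: gle => //; rewrite normc_cexp -[leRHS]expR0 ler_expR.
      apply: (le_trans hW); rewrite /phi ge_max lexx /= ge_min ln_le0 //.
    have eE : expR phi <= E.
      by rewrite ler_expR /phi ge_max (ltW x0) ge_min lexx orbT.
    have ePhi : expR phi <= Phi m.
      rewrite -[leRHS]lnK ?posrE // ler_expR /phi ge_max ge_min lexx andbT.
      by apply: ln_ge0; exact: ltW.
    have avg := @log_average_le R Phi (fun v => normc (f v%:C)) H (H * H) eta x N K Phi0 Phim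
      (fun _ => normc_ge0 _) fL (mulr_ge0 (ltW H0) (ltW H0)) hs _ x2 xN (leqnn _).
    have {avg} := avg; rewrite eta0 eta1 => /(_ isT) avg.
    rewrite gE normc_cexp.
    have h1 : K%:R^-1 * (\sum_(k < K) normc (f (x%:C + (u k)%:C))) <=
        4 * H / (eta * Phi m) + 2 * (H * H) / E.
      rewrite mulrC ler_pdivrMr // mulrC; apply: le_trans avg.
      by apply: ler_sum => k _; rewrite -rmorphD.
    apply: (@le_trans _ _ ((4 * H / (eta * Phi m) + 2 * (H * H) / E) * expR phi)).
      apply: ler_pM => //; rewrite ?expR_ge0 ?ler_expR //.
      by rewrite mulr_ge0 ?invr_ge0 ?(ltW K0) // sumr_ge0 // => k _; exact: normc_ge0.
    have -> : (4 * H / (eta * Phi m) + 2 * (H * H) / E) * expR phi =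
      4 * H / eta * (expR phi / Phi m) + 2 * H ^+ 2 * (expR phi / E) by field; rewrite !gt_eqF.
    have a1 : expR phi / Phi m <= 1 by rewrite ler_pdivrMr // mul1r.
    have a2 : expR phi / E <= 1 by rewrite ler_pdivrMr // mul1r.
    have b1 : 4 * H / eta * (expR phi / Phi m) <= 4 * H / eta * 1 by rewrite ler_wpM2l // ltW.
    have b2 : 2 * H ^+ 2 * (expR phi / E) <= 2 * H ^+ 2 * 1 by rewrite ler_wpM2l // mulr_ge0 // ltW.
    by rewrite /Mt; lra.
  - move=> e e0; exists (A + 1) => w w0 wA.
    by rewrite (le_trans (far _ w0 _ _)) ?lerDl //; lra.
have := main (0 +i* eta) (ltW eta0).
rewrite gE normc_cexp => hmain.
have low : mu / 4 <= K%:R^-1 * (\sum_(k < K) normc (f (0 +i* eta + (u k)%:C))).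
  rewrite [leRHS]mulrC ler_pdivlMr //.
  have -> : mu / 4 * K%:R = \sum_(k < K) mu / 4 by rewrite sumr_const card_ord mulr_natr.
  apply: ler_sum => k _.
  have -> : 0 +i* eta + (u k)%:C = u k +i* eta by apply: complex_eqP => /=; ring.
  have k1 : 0 <= eta * k%:R / K%:R <= eta.
    rewrite divr_ge0 ?mulr_ge0 ?(ltW eta0) ?(ltW K0) //= ler_pdivrMr // ler_wpM2l ?(ltW eta0) //.
    by rewrite ler_nat ltnW.
  have u0 : 0 <= u k by apply: ln_ge0; case/andP: k1; lra.
  have u1 : u k <= eta.
    by apply: (le_trans (le_ln1Dx _)); case/andP: k1; lra.
  have h1 := @esum_poly_vertical R M q t H H (u k) eta ht hq (ltW H0) (ltW eta0).
  have h2 := fL 0 (u k); rewrite sub0r normrN ger0_norm // in h2.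
  have h3 := ler_dist_normc (f (u k +i* eta)) (f (u k)%:C).
  have {}h3 := le_trans h3 h1; have /ler_normlP[h4 _] := h3.
  have h5 : H * H * u k <= H * H * eta by rewrite ler_wpM2l // mulr_ge0 // ltW.
  have h6 : H ^+ 2 = H * H by [].
  have f0' : mu / 2 <= normc (f 0%:C) by [].
  by move: etamu; rewrite h6; move: h2 h4 h5 f0'; rewrite mulrA; lra.
have : mu / 4 * expR (complex.Re (W (0 +i* eta))) <= Mt.
  by apply: le_trans hmain; rewrite ler_wpM2r // expR_ge0.
rewrite mulrC -ler_pdivlMr ?divr_gt0 // => hM.
have hM' : complex.Re (W (0 +i* eta)) <= ln (4 * Mt / mu).
  rewrite -ler_expR lnK ?posrE ?divr_gt0 ?mulr_gt0 //; apply: (le_trans hM).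
  by rewrite le_eqVlt; apply/orP; left; apply/eqP; field; rewrite gt_eqF.
have := @barrier_sum_imag_ge R J psi eta psi0; rewrite (ltW eta0) eta1 => /(_ isT) hl.
rewrite -/W in hl; move: (le_trans hl hM').
set S := \sum_(k < J) _; set l := ln (_ * _ / _).
have : 0 < 3072%:R :> R by rewrite ltr0n.
move: (3072%:R : R) => c c0 h.
rewrite -(@ler_pM2l _ (eta / c)) ?divr_gt0 //; apply: (le_trans h).
by rewrite mulrA (_ : eta / c * (c / eta) = 1) ?mul1r //; field; rewrite !gt_eqF.
Qed.

(** * Cauchy condensation *)

(** [Phi] may start below 1, so negative terms occur. If the terms are eventually nonnegative, the
    partial sums end up increasing and the earlier terms only change the bound; if none is positive,
    both sides hold. *)
Lemma series_lty_bounded (R : realType) (u : nat -> R) :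
  (exists n0, forall n, (n0 <= n)%N -> 0 <= u n) \/ (forall n, (2 <= n)%N -> u n <= 0) ->
  ((\sum_(2 <= n <oo) (u n)%:E < +oo)%E <-> exists B, forall N, \sum_(2 <= n < N) u n <= B).
Proof.
case=> [[n0 h0]|hneg]; last first.
  split=> _.
    exists 0 => N; rewrite big_nat sumr_le0 // => n /andP[n2 _]; exact: hneg.
  apply: (@le_lt_trans _ _ 0%E); last exact: ltry.
  by apply: npeseries_le0 => n n2 _; rewrite lee_fin hneg.
pose m := maxn n0 2.
pose s N := \sum_(2 <= n < N) u n.
have hs N : s (N.+1 + m)%N = s (N + m)%N + u (N + m)%N.
  by rewrite /s addSn big_nat_recr //= (leq_trans (leq_maxr n0 2)) // leq_addl.
pose v N := (s (N + m)%N)%:E.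
have hv : {homo v : n k / (n <= k)%N >-> (n <= k)%E}.
  apply: homo_leq; [by move=> x; exact: lexx|by move=> x y z; exact: le_trans|].
  by move=> n; rewrite lee_fin hs lerDl h0 // (leq_trans (leq_maxl n0 2)) // leq_addl.
have cv : (\sum_(2 <= n < N) (u n)%:E)%E @[N --> \oo] --> ereal_sup (range v).
  rewrite -(cvg_shiftn m).
  have -> : [sequence (\sum_(2 <= n < N + m) (u n)%:E)%E]_N = v.
    by apply/funext => N; rewrite /= sumEFin.
  exact: (ereal_nondecreasing_cvgn hv).
have -> : (\sum_(2 <= n <oo) (u n)%:E)%E = ereal_sup (range v) by apply/cvg_lim.
pose A := \sum_(2 <= n < m) `|u n|.
split=> [hlt|[B hB]]; last first.
  apply: (@le_lt_trans _ _ B%:E); last exact: ltry.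
  by apply: ge_ereal_sup => _ [N _ <-]; rewrite lee_fin; exact: hB.
have hsup N : (v N <= ereal_sup (range v))%E by apply: ereal_sup_ubound; exists N.
have hfin : ereal_sup (range v) \is a fin_num.
  by rewrite fin_real // hlt andbT (lt_le_trans _ (hsup 0%N)) // ltNyr.
exists (`|fine (ereal_sup (range v))| + A) => N.
have [Nm|Nm] := leqP m N.
  have := hsup (N - m)%N; rewrite /v subnK // -(fineK hfin) lee_fin => h.
  apply: (le_trans h); apply: (le_trans (ler_norm _)); rewrite lerDl.
  by apply: sumr_ge0 => n _; exact: normr_ge0.
apply: (@le_trans _ _ A); last by rewrite lerDr.
apply: (@le_trans _ _ (\sum_(2 <= n < N) `|u n|)); first by apply: ler_sum => n _; exact: ler_norm.
have [N2|N2] := leqP 2 N; last by rewrite big_geq ?sumr_ge0 // ltnW.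
by rewrite /A (big_cat_nat N2 (ltnW Nm)) /= lerDl sumr_ge0.
Qed.

Lemma sum_dyadic (R : realType) (u : nat -> R) (K : nat) :
  \sum_(2 <= n < 2 ^ K.+1) u n = \sum_(k < K) \sum_(2 ^ k.+1 <= n < 2 ^ k.+2) u n.
Proof.
elim: K => [|K IH]; first by rewrite big_ord0 big_geq.
rewrite big_ord_recr /= -IH -big_cat_nat //=.
  by rewrite -{1}(expn1 2) leq_exp2l.
by rewrite leq_exp2l.
Qed.

Lemma sum_dyadic_cst (R : realType) (c : R) (j : nat) :
  \sum_(2 ^ j <= n < 2 ^ j.+1) c = (2 ^ j)%:R * c.
Proof. by rewrite sumr_const_nat expnS mul2n -addnn addnK mulr_natl. Qed.

Lemma bounded_sum_tail (R : realType) (a : nat -> R) (B eta : R) :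
  (forall k, 0 <= a k) -> (forall K, \sum_(0 <= k < K) a k <= B) -> 0 < eta ->
  exists k0, forall K, \sum_(k0 <= k < K) a k <= eta.
Proof.
move=> a0 hB eta0.
pose S := range (fun K => \sum_(0 <= k < K) a k).
have hS : has_sup S by split; [exists 0, 0%N => //; rewrite big_geq|exists B => _ [K _ <-]].
have [_ [k0 _ <-] hk] := sup_adherent eta0 hS.
exists k0 => K; have [Kk|Kk] := leqP k0 K; last by rewrite big_geq ?ltW // ltnW.
have : \sum_(0 <= k < K) a k <= sup S by apply: sup_upper_bound => //; exists K.
rewrite (big_cat_nat (leq0n k0) Kk) /=.
by move: hk; set x := \sum_(0 <= i < k0) _; set y := \sum_(k0 <= i < K) _; lra.
Qed.

Definition log_weight (R : realType) (Phi : nat -> R) (n : nat) : R :=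
  ln (Phi n) / (n%:R * ln n%:R ^+ 2).

Lemma ln_pow2 (R : realType) j : ln (2 ^ j)%:R = j%:R * ln 2 :> R.
Proof. by rewrite natrX lnXn // mulr_natl. Qed.

Lemma ln_nat_gt0 (R : realType) n : (2 <= n)%N -> 0 < ln n%:R :> R.
Proof. by move=> n2; apply: ln_gt0; rewrite ltr1n. Qed.

Lemma log_weight_sign (R : realType) (Phi : nat -> R) :
  (forall n, (2 <= n)%N -> 0 < Phi n) ->
  (forall m n, (2 <= m)%N -> (m <= n)%N -> Phi m <= Phi n) ->
  (exists n0, forall n, (n0 <= n)%N -> 0 <= log_weight Phi n) \/
  (forall n, (2 <= n)%N -> log_weight Phi n <= 0).
Proof.
move=> Phi0 Phim.
have d0 n : 0 <= (n%:R * ln n%:R ^+ 2)^-1 :> R by rewrite invr_ge0 mulr_ge0 ?sqr_ge0.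
case: (pselect (exists2 n0, (2 <= n0)%N & 1 <= Phi n0)) => [[n0 n2 h]|h].
  left; exists n0 => n nn; apply: mulr_ge0 => //; apply: ln_ge0.
  by apply: (le_trans h); exact: Phim.
right => n n2; apply: mulr_le0_ge0 => //; apply: ln_le0.
by rewrite leNgt; apply/negP => h1; apply: h; exists n => //; exact: ltW.
Qed.

(** Cauchy condensation twice, from below by monotonicity: the block 2^j <= n < 2^(j+1) yields psi_j
    / (8 j^2), and the block 2^(k+1) <= j < 2^(k+2) of these yields psi(2^(k+1)) / (8 * 2^k). *)
Lemma convergent_dyadic_bound (R : realType) (Phi : nat -> R) (B : R) :
  (forall n, (2 <= n)%N -> 0 < Phi n) ->
  (forall m n, (2 <= m)%N -> (m <= n)%N -> Phi m <= Phi n) ->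
  (forall N, \sum_(2 <= n < N) log_weight Phi n <= B) ->
  exists C : R, forall K,
    \sum_(0 <= k < K) Num.max 0 (ln (Phi (2 ^ (2 ^ k.+1))%N)) / (2 ^ k)%:R <= C.
Proof.
move=> Phi0 Phim hB.
pose psi j := Num.max 0 (ln (Phi (2 ^ j)%N)).
have psi0 j : 0 <= psi j by rewrite le_max lexx.
have p2 j : (0 < j)%N -> (2 <= 2 ^ j)%N by move=> j0; rewrite -{1}(expn1 2) leq_exp2l.
have psim i j : (0 < i)%N -> (i <= j)%N -> psi i <= psi j.
  move=> i0 ij; have j0 := leq_trans i0 ij.
  rewrite /psi ge_max le_max lexx /= le_max ler_ln ?posrE ?Phi0 ?p2 //.
  by rewrite Phim ?p2 ?orbT // leq_exp2l.
pose v n := Num.max 0 (log_weight Phi n).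
(* The hypothesis bounds signed sums while condensation needs nonnegative terms; positive parts
   differ from the terms at finitely many indices, or else all vanish. *)
have [B1 hB1] : exists B1, forall N, \sum_(2 <= n < N) v n <= B1.
  case: (log_weight_sign Phi0 Phim) => [[n0 h0]|h0]; last first.
    exists 0 => N; rewrite big_nat big1 // => n /andP[n2 _].
    by rewrite /v (max_idPl _) // h0.
  exists (B + \sum_(2 <= n < n0) `|log_weight Phi n|) => N.
  have vle n : v n <= log_weight Phi n + `|log_weight Phi n|.
    by rewrite /v ge_max lerDl normr_ge0 andbT -lerBlDl sub0r lerNl lerNnormlW.
  have vE n : (n0 <= n)%N -> v n = log_weight Phi n by move=> /h0 h; rewrite /v (max_idPr _).
  have [Nn|Nn] := leqP N n0.
    apply: (@le_trans _ _ (\sum_(2 <= n < N) (log_weight Phi n + `|log_weight Phi n|))).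
      by apply: ler_sum => n _.
    rewrite big_split /= lerD //.
    have [N2|N2] := leqP 2 N; last by rewrite big_geq ?sumr_ge0 // ltnW.
    by rewrite (big_cat_nat N2 Nn) /= lerDl sumr_ge0.
  have [n02|n02] := leqP 2 n0; last first.
    apply: le_trans (_ : B <= _); last by rewrite lerDl sumr_ge0.
    apply: le_trans (hB N); rewrite le_eqVlt; apply/orP; left; apply/eqP.
    by apply: eq_big_nat => n /andP[n2 _]; apply: vE; apply: leq_trans n2; exact: ltnW.
  have hh := hB N; rewrite (big_cat_nat n02 (ltnW Nn)) /= in hh.
  rewrite (big_cat_nat n02 (ltnW Nn)) /=.
  have -> : \sum_(n0 <= n < N) v n = \sum_(n0 <= n < N) log_weight Phi n.
    by apply: eq_big_nat => n /andP[n2 _]; exact: vE.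
  have : \sum_(2 <= n < n0) v n <= \sum_(2 <= n < n0) log_weight Phi n + \sum_(2 <= n < n0) `|log_weight Phi n|.
    by rewrite -big_split /=; apply: ler_sum => n _.
  move: hh; set x := \sum_(2 <= n < n0) v n; set y := \sum_(n0 <= n < N) _.
  set z := \sum_(2 <= n < n0) log_weight Phi n; set t := \sum_(2 <= n < n0) `| _ |.
  lra.
have l2 := ln2_bounds R.
have step1 j : (0 < j)%N -> psi j / (8 * j%:R ^+ 2) <= \sum_(2 ^ j <= n < 2 ^ j.+1) v n.
  move=> j0; have jR : 0 < j%:R :> R by rewrite ltr0n.
  apply: (@le_trans _ _ (\sum_(2 ^ j <= n < 2 ^ j.+1) psi j / ((2 ^ j.+1)%:R * (j.+1%:R) ^+ 2))).
    rewrite sum_dyadic_cst expnS natrM.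
    have P0 : 0 < (2 ^ j)%:R :> R by rewrite ltr0n expn_gt0.
    have -> : (2 ^ j)%:R * (psi j / (2%:R * (2 ^ j)%:R * j.+1%:R ^+ 2)) = psi j / (2 * j.+1%:R ^+ 2).
      by field; rewrite !gt_eqF // addrC natr1 ltr0n.
    rewrite ler_wpM2l // lef_pV2 ?posrE ?mulr_gt0 ?exprn_gt0 // ?ltr0n //.
    have -> : 8 * j%:R ^+ 2 = 2 * (2 * j%:R) ^+ 2 :> R by ring.
    rewrite ler_pM2l // lerXn2r ?nnegrE ?mulr_ge0 //.
    have : 1 <= j%:R :> R by rewrite ler1n.
    by rewrite -natr1; lra.
  apply: ler_sum_nat => n /andP[jn nj].
  have n2 : (2 <= n)%N by apply: leq_trans jn; exact: p2.
  have n0 : 0 < n%:R :> R by rewrite ltr0n ltnW.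
  have ln0 := ln_nat_gt0 R n2.
  have psin : psi j <= Num.max 0 (ln (Phi n)).
    rewrite /psi ge_max le_max lexx /= le_max ler_ln ?posrE ?Phi0 ?p2 //.
    by rewrite Phim ?p2 ?orbT.
  apply: (@le_trans _ _ (Num.max 0 (ln (Phi n)) / (n%:R * ln n%:R ^+ 2))); last first.
    rewrite /v /log_weight; have [h|h] := leP 0 (ln (Phi n)).
      by rewrite le_max lexx orbT.
    by rewrite mul0r le_max lexx.
  apply: ler_pM => //; rewrite ?invr_ge0 ?mulr_ge0 ?sqr_ge0 //.
  rewrite lef_pV2 ?posrE ?mulr_gt0 ?exprn_gt0 ?ltr0n ?expn_gt0 ?(ltnW n2) //.
  apply: ler_pM; rewrite ?sqr_ge0 ?(ltW n0) // ?ler_nat ?(ltnW nj) //.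
  rewrite lerXn2r ?nnegrE ?(ltW ln0) //.
  apply: (@le_trans _ _ (ln (2 ^ j.+1)%:R)).
    by rewrite ler_ln ?posrE ?ltr0n ?expn_gt0 // ?ler_nat 1?ltnW.
  by rewrite ln_pow2 ler_piMr //; lra.
have step2 k : psi (2 ^ k.+1)%N / (8 * (2 ^ k)%:R) <= \sum_(2 ^ k.+1 <= j < 2 ^ k.+2) psi j / j%:R ^+ 2.
  have P0 : 0 < (2 ^ k)%:R :> R by rewrite ltr0n expn_gt0.
  apply: (@le_trans _ _ (\sum_(2 ^ k.+1 <= j < 2 ^ k.+2) psi (2 ^ k.+1)%N / ((2 ^ k.+2)%:R) ^+ 2)).
    rewrite sum_dyadic_cst !expnS !natrM le_eqVlt; apply/orP; left; apply/eqP.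
    by field; rewrite gt_eqF.
  apply: ler_sum_nat => i /andP[ki ik].
  have i0 : (0 < i)%N by apply: leq_trans ki; rewrite expn_gt0.
  apply: ler_pM; rewrite ?invr_ge0 ?sqr_ge0 // ?psim ?expn_gt0 //.
  rewrite lef_pV2 ?posrE ?exprn_gt0 ?ltr0n ?expn_gt0 //.
  by rewrite lerXn2r ?nnegrE // ler_nat ltnW.
exists (64 * B1) => K.
apply: (@le_trans _ _ (8 * \sum_(2 <= j < 2 ^ K.+1) psi j / j%:R ^+ 2)).
  rewrite sum_dyadic mulr_sumr big_mkord; apply: ler_sum => k _.
  have P0 : 0 < (2 ^ k)%:R :> R by rewrite ltr0n expn_gt0.
  have := step2 k; rewrite -(@ler_pM2l _ 8) //; apply: le_trans.
  by rewrite le_eqVlt; apply/orP; left; apply/eqP; rewrite -/(psi _); field; rewrite gt_eqF.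
have -> : 64 * B1 = 8 * (8 * B1) by ring.
rewrite ler_pM2l //.
set J := (2 ^ K.+1)%N.
have J2 : (2 <= J)%N by exact: p2.
apply: (@le_trans _ _ (8 * \sum_(2 <= n < 2 ^ J.+1) v n)); last by rewrite ler_pM2l.
rewrite [X in _ <= 8 * X]sum_dyadic [leRHS]mulr_sumr.
have vs k : 0 <= \sum_(2 ^ k.+1 <= n < 2 ^ k.+2) v n.
  by apply: sumr_ge0 => n _; rewrite le_max lexx.
rewrite -(big_mkord xpredT (fun k => 8 * \sum_(2 ^ k.+1 <= n < 2 ^ k.+2) v n)).
rewrite [leRHS](@big_cat_nat _ _ _ J.-1) //=; last exact: leq_pred.
apply: (@le_trans _ _ (\sum_(0 <= i < J.-1) (8 * \sum_(2 ^ i.+1 <= n < 2 ^ i.+2) v n))); last first.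
  by rewrite lerDl sumr_ge0 // => k _; rewrite mulr_ge0.
rewrite -(prednK (ltnW J2)) -{1}[2%N]/(1.+1) big_add1 /=.
apply: (@le_trans _ _ (\sum_(0 <= i < J.-1) psi i.+1 / i.+1%:R ^+ 2)).
  case: (J.-1) => [|J']; first by rewrite !big_geq.
  by rewrite [leRHS]big_ltn // lerDr divr_ge0 ?sqr_ge0.
apply: ler_sum => i _.
have i0 : 0 < i.+1%:R :> R by rewrite ltr0n.
have := step1 i.+1 isT; rewrite -(@ler_pM2l _ 8) //; apply: le_trans.
by rewrite le_eqVlt; apply/orP; left; apply/eqP; field; rewrite gt_eqF.
Qed.

(** First the cap is removed: if log Phi(2^j) >= j ln 2 at one large j, monotonicity keeps the
    capped values above j ln 2 for j <= i < 2 j, and this block contributes at least ln 2 / 4,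
    whereas late tails are at most ln 2 / 8. Then the blocks are condensed from above. *)
Lemma bounded_dyadic_convergent (R : realType) (Phi : nat -> R) (B : R) :
  (forall n, (2 <= n)%N -> 0 < Phi n) ->
  (forall m n, (2 <= m)%N -> (m <= n)%N -> Phi m <= Phi n) ->
  (forall J, \sum_(k < J) Num.max 0 (Num.min (ln (Phi (2 ^ k.+1)%N)) (k.+1%:R * ln 2)) / k.+1%:R ^+ 2 <= B) ->
  exists C : R, forall N, \sum_(2 <= n < N) log_weight Phi n <= C.
Proof.
move=> Phi0 Phim hB.
pose b j := ln (Phi (2 ^ j)%N).
pose psi j := Num.max 0 (b j).
pose a k := Num.max 0 (Num.min (b k.+1) (k.+1%:R * ln 2)) / k.+1%:R ^+ 2.
have psi0 j : 0 <= psi j by rewrite /psi le_max lexx.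
have p2 j : (0 < j)%N -> (2 <= 2 ^ j)%N by move=> j0; rewrite -{1}(expn1 2) leq_exp2l.
have bm i j : (0 < i)%N -> (i <= j)%N -> b i <= b j.
  move=> i0 ij; have j0 := leq_trans i0 ij.
  by rewrite /b ler_ln ?posrE ?Phi0 ?p2 // Phim ?p2 // leq_exp2l.
have a0 k : 0 <= a k by rewrite divr_ge0 ?sqr_ge0 // le_max lexx.
have l2 := ln2_bounds R.
have l20 : 0 < ln (2 : R) by lra.
have haB K : \sum_(0 <= k < K) a k <= B by rewrite big_mkord; exact: hB.
have [j0 hj0] : exists j0, forall j, (j0 < j)%N -> b j < j%:R * ln 2.
  have [k0 hk0] := bounded_sum_tail a0 haB (divr_gt0 l20 (ltr0Sn _ 7)).
  exists k0 => -[//|j] kj; rewrite ltNge; apply/negP => hb.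
  have := hk0 (j + j.+1)%N; apply/negP; rewrite -ltNge.
  apply: (@lt_le_trans _ _ (\sum_(j <= k < j + j.+1) a k)); last first.
    rewrite [leRHS](@big_cat_nat _ _ _ j) //= ?leq_addr //.
    by rewrite lerDr sumr_ge0.
  apply: (@lt_le_trans _ _ (\sum_(j <= k < j + j.+1) ln 2 / (4 * j.+1%:R))).
    rewrite sumr_const_nat addKn -(mulr_natr (ln 2 / (4 * j.+1%:R)) j.+1).
    have -> : ln 2 / (4 * j.+1%:R) * j.+1%:R = ln 2 / 4 :> R.
      by field; rewrite addrC natr1 pnatr_eq0.
    lra.
  apply: ler_sum_nat => k /andP[jk kjj].
  have jR : 0 < j.+1%:R :> R by rewrite ltr0n.
  have -> : ln 2 / (4 * j.+1%:R) = (j.+1%:R * ln 2) / (2 * j.+1%:R) ^+ 2 :> R.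
    by field; rewrite addrC natr1 pnatr_eq0.
  apply: ler_pM; rewrite ?invr_ge0 ?sqr_ge0 ?mulr_ge0 ?(ltW l20) //.
    rewrite le_max le_min; apply/orP; right; apply/andP; split.
      by apply: (le_trans hb); apply: bm.
    by rewrite ler_pM2r // ler_nat ltnS.
  rewrite lef_pV2 ?posrE ?exprn_gt0 ?mulr_gt0 ?ltr0n // lerXn2r ?nnegrE ?mulr_ge0 //.
  by rewrite -natrM ler_nat mul2n -addnn addSn leqW.
pose c k := psi k.+1 / k.+1%:R ^+ 2.
have c0 k : 0 <= c k by rewrite divr_ge0 ?sqr_ge0 // le_max lexx.
pose B2 := \sum_(0 <= k < j0) c k + B.
have hc J : \sum_(0 <= k < J) c k <= B2.
  apply: (@le_trans _ _ (\sum_(0 <= k < j0 + J) c k)).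
    by rewrite [leRHS](@big_cat_nat _ _ _ J) //= ?leq_addl // lerDl sumr_ge0.
  rewrite (@big_cat_nat _ _ _ j0) //= ?leq_addr // lerD2l.
  apply: le_trans (haB (j0 + J)%N).
  rewrite [leRHS](@big_cat_nat _ _ _ j0) //= ?leq_addr //.
  rewrite -[leLHS]add0r lerD ?sumr_ge0 // le_eqVlt; apply/orP; left; apply/eqP.
  apply: eq_big_nat => k /andP[jk _]; rewrite /c /a /psi.
  by rewrite (min_idPl _) // ltW // hj0.
exists (16 * B2) => N.
pose v n := Num.max 0 (log_weight Phi n).
have v0 n : 0 <= v n by rewrite le_max lexx.
apply: (@le_trans _ _ (\sum_(2 <= n < N) v n)).
  by apply: ler_sum => n _; rewrite /v le_max lexx orbT.
apply: (@le_trans _ _ (\sum_(2 <= n < 2 ^ N.+1) v n)).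
  have NP : (N <= 2 ^ N.+1)%N by apply: ltnW; apply: ltn_trans (ltn_expl _ _) => //; rewrite ltn_exp2l.
  have [N2|N2] := leqP 2 N; last by rewrite big_geq ?sumr_ge0 // ltnW.
  by rewrite (big_cat_nat N2 NP) /= lerDl sumr_ge0.
rewrite sum_dyadic.
(* On the j-th block ln (Phi n) <= psi (j + 1), and j ln 2 >= j / 2 >= (j + 1) / 4 accounts for
   16. *)
apply: (@le_trans _ _ (\sum_(k < N) 16 * c k.+1)).
  apply: ler_sum => k _; set j := k.+1.
  have jR : 0 < j%:R :> R by rewrite ltr0n.
  have P0 : 0 < (2 ^ j)%:R :> R by rewrite ltr0n expn_gt0.
  apply: (@le_trans _ _ (\sum_(2 ^ j <= n < 2 ^ j.+1) psi j.+1 / ((2 ^ j)%:R * (j%:R * ln 2) ^+ 2))).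
    apply: ler_sum_nat => n /andP[jn nj].
    have n2 : (2 <= n)%N by apply: leq_trans jn; exact: p2.
    have n0 : 0 < n%:R :> R by rewrite ltr0n ltnW.
    have ln0 := ln_nat_gt0 R n2.
    rewrite /v /log_weight ge_max; apply/andP; split.
      by apply: divr_ge0; rewrite ?psi0 //; apply: mulr_ge0; rewrite ?sqr_ge0 ?(ltW n0).
    have h1 : ln (Phi n) <= psi j.+1.
      rewrite /psi /b le_max; apply/orP; right.
      by rewrite ler_ln ?posrE ?Phi0 ?p2 // Phim // ltnW.
    have h2 : 0 <= (n%:R * ln n%:R ^+ 2)^-1 :> R by rewrite invr_ge0 mulr_ge0 ?sqr_ge0.
    apply: (@le_trans _ _ (psi j.+1 / (n%:R * ln n%:R ^+ 2))); first by rewrite ler_wpM2r.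
    rewrite ler_wpM2l ?psi0 //.
    rewrite lef_pV2 ?posrE ?mulr_gt0 ?exprn_gt0 ?mulr_gt0 //.
    apply: ler_pM; rewrite ?sqr_ge0 // ?ler_nat //.
    rewrite lerXn2r ?nnegrE ?mulr_ge0 ?(ltW l20) ?(ltW ln0) // -ln_pow2.
    by rewrite ler_ln ?posrE // ler_nat.
  rewrite sum_dyadic_cst.
  have -> : (2 ^ j)%:R * (psi j.+1 / ((2 ^ j)%:R * (j%:R * ln 2) ^+ 2)) = psi j.+1 / (j%:R * ln 2) ^+ 2.
    by field; rewrite !gt_eqF.
  have -> : 16 * c j = psi j.+1 / (j.+1%:R / 4) ^+ 2.
    by rewrite /c; field; rewrite addrC natr1 pnatr_eq0.
  rewrite ler_wpM2l ?psi0 //.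
  rewrite lef_pV2 ?posrE ?exprn_gt0 ?mulr_gt0 ?divr_gt0 ?ltr0n //.
  rewrite lerXn2r ?nnegrE ?mulr_ge0 ?divr_ge0 ?(ltW l20) //.
  have j1 : 1 <= j%:R :> R by rewrite ler1n.
  have : j%:R * (1 / 2) <= j%:R * ln 2 :> R by rewrite ler_wpM2l //; lra.
  by rewrite -[j.+1%:R]natr1; lra.
rewrite -mulr_sumr ler_pM2l //.
apply: le_trans (hc N.+1).
rewrite big_ltn // big_add1 /= -[leLHS]add0r lerD //.
by rewrite big_mkord.
Qed.

(** * The convergent case *)

(* The Fourier multiplier of the average over the K points i r / K, i < K. *)
Definition avg_mult (R : realType) (K : nat) (r l : R) : R[i] :=
  K%:R^-1%:C * \sum_(i < K) expi l ((i%:R * (r / K%:R))%:C).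

Lemma avg_mult_le1 (R : realType) (K : nat) (r l : R) : (0 < K)%N ->
  normc (avg_mult K r l) <= 1.
Proof.
move=> K0; have KR : 0 < K%:R :> R by rewrite ltr0n.
rewrite /avg_mult normcZ ?invr_ge0 ?(ltW KR) // mulrC ler_pdivrMr // mul1r.
apply: (le_trans (normc_sum _ _ _)).
rewrite (eq_bigr (fun=> 1)) ?sumr_const ?card_ord // => i _.
by rewrite normc_expi_real.
Qed.

Lemma avg_mult0 (R : realType) (K : nat) (r : R) : (0 < K)%N -> avg_mult K r 0 = 1.
Proof.
move=> K0; rewrite /avg_mult (eq_bigr (fun=> 1)); last first.
  move=> i _; rewrite expi_real mul0r; apply: complex_eqP; rewrite /cexp /= expR0 cos0 sin0; ring.
rewrite sumr_const card_ord -[X in _ * X](rmorph_nat (real_complex R)) -rmorphM mulVf ?rmorph1 //.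
by rewrite pnatr_eq0 -lt0n.
Qed.

Lemma expi_natM (R : realType) (l s : R) i : expi l ((i%:R * s)%:C) = expi l (s%:C) ^+ i.
Proof.
elim: i => [|i IH].
  by rewrite mul0r expi_real mulr0 -[0 +i* 0]/(0 : R[i]) cexp0.
by rewrite exprS -IH -expiD -rmorphD; congr (expi l _ %:C); rewrite -natr1; ring.
Qed.

(** A geometric sum. The condition on r l / K keeps the phase of one step small; on a coarse grid
    the ratio could come back to 1 and nothing would be gained. *)
Lemma avg_mult_le (R : realType) (K : nat) (r l : R) : (0 < K)%N ->
  0 < r -> 0 < l -> r * l / K%:R <= 1 / 8 ->
  normc (avg_mult K r l) <= 4 / (r * l).
Proof.
move=> K0 r0 l0 h8; have KR : 0 < K%:R :> R by rewrite ltr0n.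
set s := r / K%:R; have s0 : 0 < s by rewrite divr_gt0.
set e := expi l (s%:C).
have e1 : l * s / 2 <= normc (e - 1).
  have nw : normc (0 +i* (l * s)) = l * s.
    by rewrite /= expr0n /= add0r sqrtr_sqr ger0_norm // mulr_ge0 // ltW.
  rewrite /e expi_real -[X in X / 2]nw; apply: cexp_B1_ge; rewrite nw /s.
  by rewrite mulrA [l * r]mulrC.
have ne : normc e = 1 by rewrite normc_expi_real.
have hs : (e - 1) * \sum_(i < K) expi l ((i%:R * s)%:C) = e ^+ K - 1.
  by rewrite subrX1; congr (_ * _); apply: eq_bigr => i _; rewrite expi_natM.
have hn : normc (e - 1) * normc (\sum_(i < K) expi l ((i%:R * s)%:C)) <= 2.
  rewrite -normcM hs; apply: (le_trans (normcB _ _)).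
  by rewrite normcX ne expr1n normc1.
rewrite /avg_mult -/s normcZ ?invr_ge0 ?(ltW KR) //.
set S := normc (\sum_(i < K) _) in hn *.
have S0 : 0 <= S by exact: normc_ge0.
have ls : 0 < l * s by rewrite mulr_gt0.
have h : l * s / 2 * S <= 2 by apply: le_trans hn; rewrite ler_wpM2r.
rewrite ler_pdivlMr ?mulr_gt0 //.
have -> : K%:R^-1 * S * (r * l) = 2 * (l * s / 2 * S) by rewrite /s; field; rewrite gt_eqF.
by rewrite -(ler_pM2l (ltr0Sn R 1)) in h; apply: le_trans h _; lra.
Qed.

Lemma dpoly_avg (R : realType) (c : nat -> R[i]) (N K : nat) (r : R) (z : R[i]) :
  dpoly (fun n => c n * avg_mult K r (ln n%:R)) N z =
  K%:R^-1%:C * \sum_(i < K) dpoly c N (z + (i%:R * (r / K%:R))%:C).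
Proof.
rewrite exchange_big /= mulr_sumr; apply: eq_bigr => n _.
rewrite /avg_mult !mulr_sumr mulr_suml; apply: eq_bigr => i _.
by rewrite expiD; ring.
Qed.

Lemma sqr_avg_le (R : realType) (K : nat) (x : 'I_K -> R) : (0 < K)%N ->
  (K%:R^-1 * \sum_(i < K) x i) ^+ 2 <= K%:R^-1 * \sum_(i < K) x i ^+ 2.
Proof.
move=> K0; have KR : 0 < K%:R :> R by rewrite ltr0n.
set m := K%:R^-1 * \sum_(i < K) x i.
have : 0 <= K%:R^-1 * \sum_(i < K) (x i - m) ^+ 2.
  by rewrite mulr_ge0 ?invr_ge0 ?(ltW KR) // sumr_ge0 // => i _; exact: sqr_ge0.
have -> : \sum_(i < K) (x i - m) ^+ 2 = \sum_(i < K) x i ^+ 2 + (- (2 * m) * \sum_(i < K) x i + K%:R * m ^+ 2).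
  have -> : K%:R * m ^+ 2 = \sum_(i < K) m ^+ 2 by rewrite sumr_const card_ord mulr_natl.
  by rewrite mulr_sumr -!big_split /=; apply: eq_bigr => i _; ring.
have -> : K%:R^-1 * (\sum_(i < K) x i ^+ 2 + (- (2 * m) * \sum_(i < K) x i + K%:R * m ^+ 2)) =
  K%:R^-1 * \sum_(i < K) x i ^+ 2 - m ^+ 2.
  by rewrite /m; field; rewrite gt_eqF.
by rewrite subr_ge0.
Qed.

(** A Riemann sum on an interval of length J h with free starting point [y]: the averaging shifts
    fit no fixed grid, so bounds are kept for a whole range of [y]. *)
Definition grid_square (R : realType) (h : R) (J : nat) (c : nat -> R[i]) (N : nat) (y : R) : R :=
  h * \sum_(k < J) normc (dpoly c N ((y + k%:R * h)%:C)) ^+ 2.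

(** Convexity of the square. An average of length [r] looks at starting points up to y + r, so their
    range shrinks by [r]. *)
Lemma grid_square_avg (R : realType) (h T r d : R) (J N K : nat) (c : nat -> R[i]) :
  (0 < K)%N -> 0 <= h -> 0 <= r ->
  (forall y, 0 <= y <= T -> grid_square h J c N y <= d) ->
  forall y, 0 <= y <= T - r ->
    grid_square h J (fun n => c n * avg_mult K r (ln n%:R)) N y <= d.
Proof.
move=> K0 h0 r0 hd y /andP[y0 yT]; have KR : 0 < K%:R :> R by rewrite ltr0n.
apply: (@le_trans _ _ (K%:R^-1 * \sum_(i < K) grid_square h J c N (y + i%:R * (r / K%:R)))).
  rewrite /grid_square -mulr_sumr mulrCA ler_wpM2l // exchange_big /= mulr_sumr.
  apply: ler_sum => k _; rewrite dpoly_avg normcZ ?invr_ge0 ?(ltW KR) //.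
  apply: le_trans (_ : (K%:R^-1 * \sum_(i < K) normc (dpoly c N ((y + k%:R * h)%:C + (i%:R * (r / K%:R))%:C))) ^+ 2 <= _).
    rewrite lerXn2r ?nnegrE ?mulr_ge0 ?invr_ge0 ?(ltW KR) ?normc_ge0 ?sumr_ge0 //.
      by move=> i _; exact: normc_ge0.
    by rewrite ler_wpM2l ?invr_ge0 ?(ltW KR) // normc_sum.
  apply: (le_trans (sqr_avg_le _ K0)); rewrite ler_wpM2l ?invr_ge0 ?(ltW KR) //.
  apply: ler_sum => i _; rewrite -rmorphD le_eqVlt; apply/orP; left; apply/eqP.
  by congr (normc (dpoly c N (_ %:C)) ^+ 2); rewrite addrAC.
rewrite mulrC ler_pdivrMr //.
have -> : d * K%:R = \sum_(i < K) d by rewrite sumr_const card_ord mulr_natr.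
apply: ler_sum => i _; apply: hd.
have ir : 0 <= i%:R * (r / K%:R) <= r.
  rewrite mulr_ge0 ?divr_ge0 ?(ltW KR) //= mulrA ler_pdivrMr // mulrC ler_wpM2l //.
  by rewrite ler_nat ltnW.
by case/andP: ir; lra.
Qed.

Lemma grid_square_avgs (R : realType) (h d : R) (J N K : nat) (rs : seq R) (T : R) (c : nat -> R[i]) :
  (0 < K)%N -> 0 <= h -> (forall r, r \in rs -> 0 <= r) ->
  (forall y, 0 <= y <= T -> grid_square h J c N y <= d) ->
  forall y, 0 <= y <= T - \sum_(r <- rs) r ->
    grid_square h J (fun n => c n * \prod_(r <- rs) avg_mult K r (ln n%:R)) N y <= d.
Proof.
move=> K0 h0; elim: rs T c => [|r rs IH] T c rs0 hd y.
  rewrite big_nil subr0; under eq_fun do rewrite big_nil mulr1; exact: hd.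
rewrite big_cons opprD addrA => hy.
under eq_fun do rewrite big_cons mulrA.
apply: (IH (T - r)) => //; first by move=> r' hr'; apply: rs0; rewrite inE hr' orbT.
by apply: grid_square_avg => //; apply: rs0; rewrite inE eqxx.
Qed.

(** * Lower bounds from nonnegative frequencies *)

Lemma Re_cayley2_real (R : rcfType) (x : R) :
  complex.Re (cayley (x%:C) ^+ 2) = (1 - x ^+ 2) / (x ^+ 2 + 1) ^+ 2.
Proof.
have u0 : x ^+ 2 + 1 != 0 by rewrite gt_eqF // ltr_wpDl ?sqr_ge0.
by rewrite cayley_real expr2 /=; field; rewrite u0.
Qed.

Lemma Re_cayley2_imag (R : rcfType) (y : R) : 0 <= y ->
  complex.Re (cayley (0 +i* y) ^+ 2) = (1 + y) ^- 2.
Proof.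
move=> y0; rewrite cayley_imag // expr2 /= !mul0r subr0.
by rewrite -invfM.
Qed.

(** All frequencies but the first are at least ln 2, so the rest of the sum is at most M exp(- ln 2
    Im z) <= M / (1 + ln 2 Im z). *)
Lemma dpoly_upper_ge (R : realType) (c : nat -> R[i]) (N : nat) (M : R) (z : R[i]) :
  (1 <= N)%N -> c 1%N = 1 -> \sum_(2 <= n < N.+1) normc (c n) <= M ->
  0 <= complex.Im z -> 2 * M <= 1 + ln 2 * complex.Im z ->
  1 / 2 <= normc (dpoly c N z).
Proof.
move=> N1 c1 hM z0 hz.
have M0 : 0 <= M by apply: le_trans hM; apply: sumr_ge0 => n _; exact: normc_ge0.
have l2 := ln2_bounds R.
rewrite /dpoly big_ltn // c1 ln1.
have -> : expi 0 z = 1 by rewrite /expi rmorph0 mul0r mulr0 cexp0.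
rewrite mulr1; set S := \sum_(2 <= n < N.+1) _.
suff hS : normc S <= 1 / 2.
  have := normcB (1 + S) S; rewrite addrK normc1 -lerBlDr => h1.
  by apply: le_trans h1; lra.
apply: (le_trans (normc_sum _ _ _)).
set e := expR (- (ln 2 * complex.Im z)).
have e0 : 0 <= e by exact: expR_ge0.
apply: (@le_trans _ _ (\sum_(2 <= n < N.+1) normc (c n) * e)).
  apply: ler_sum_nat => n /andP[n2 _]; rewrite normcM normc_expi ler_wpM2l ?normc_ge0 //.
  rewrite ler_expR lerN2 ler_wpM2r // ler_ln ?posrE ?ltr0n ?ler_nat //.
  exact: ltnW.
rewrite -mulr_suml; apply: (@le_trans _ _ (M * e)); first by rewrite ler_wpM2r.
have E : 1 + ln 2 * complex.Im z <= e^-1 by rewrite /e -expRN opprK; exact: expR_ge1Dx.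
have ep : 0 < e by exact: expR_gt0.
have : 2 * M * e <= e^-1 * e by rewrite ler_wpM2r // (le_trans hz).
by rewrite mulVf ?gt_eqF //; lra.
Qed.

(* The frequencies log n are nonnegative, so dpoly is bounded in the upper
   half-plane and close to c 1 = 1 high up; the harmonic function
   Re (i / (z + i))^2 is at most 0 on the reals outside [-1, 1] and positive on
   the imaginary axis, which prevents dpoly from being small on [-1, 1]. *)
Lemma one_sided_lower_bound (R : realType) (H M : R) : 0 < H -> 0 <= M ->
  exists2 d : R, 0 < d & forall (c : nat -> R[i]) (N J : nat) (h : R),
    (1 <= N)%N -> (0 < J)%N -> 0 <= h -> J%:R * h = H / 2 -> c 1%N = 1 ->
    \sum_(2 <= n < N.+1) normc (c n) <= M ->
    ~ (forall y, 0 <= y <= H / 4 -> grid_square h J c N y <= d).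
Proof.
move=> H0 M0.
have l2 := ln2_bounds R.
have l20 : 0 < ln (2 : R) by lra.
(* z -> l z + l maps [-1, 1] onto [0, H/4], the range of starting points; [Y] is the height at which
   [dpoly_upper_ge] applies after this scaling. *)
pose l := H / 8; have ll0 : 0 < l by rewrite /l divr_gt0.
pose Y := 2 * M / (ln 2 * l).
have Y0 : 0 <= Y by rewrite divr_ge0 ?mulr_ge0 // ltW.
pose B := 1 + M; have B1 : 1 <= B by rewrite /B; lra.
(* Makes Re W(iY) = ln (16 B^2) + 1, so that at iY the lower bound H / 8 is multiplied by at least
   32 B^2 and exceeds T = 2 H B^2. *)
pose A := (1 + Y) ^+ 2 * (ln (16 * B ^+ 2) + 1).
have lB : 0 <= ln (16 * B ^+ 2).
  by apply: ln_ge0; rewrite expr2; nra.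
have Y1 : 0 < (1 + Y) ^+ 2 by rewrite exprn_gt0 // ltr_wpDr.
have A0 : 0 <= A by rewrite mulr_ge0 ?(ltW Y1) //; lra.
pose T := 4 * (H / 2 * B ^+ 2).
have T0 : 0 < T by rewrite !mulr_gt0 ?exprn_gt0 ?invr_gt0 //; lra.
(* Re W <= A on [-1, 1], so grid squares of at most T exp(-A) stay below [T] after
   multiplication. *)
exists (T * expR (- A)); first by rewrite mulr_gt0 ?expR_gt0.
move=> c N J h N1 J0 h0 Jh c1 hM hd.
have hS : sum_coefs c N <= B by rewrite /sum_coefs big_ltn // c1 normc1 lerD2l.
pose W z : R[i] := A%:C * cayley z ^+ 2.
pose pt k z : R[i] := l%:C * z + (l + k%:R * h)%:C.
pose g k z : R[i] := h%:C * dpoly c N (pt k z) ^+ 2 * cexp (W z).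
have ptIm k z : complex.Im (pt k z) = l * complex.Im z.
  by rewrite /pt; case: z => x y /=; ring.
have kh0 (k : nat) : 0 <= k%:R * h by rewrite mulr_ge0.
have gE z : sum_norms J g z = (h * \sum_(k < J) normc (dpoly c N (pt k z)) ^+ 2) * expR (complex.Re (W z)).
  rewrite mulr_sumr mulr_suml; apply: eq_bigr => k _.
  by rewrite /g [normc (_ * cexp _)]normcM normc_cexp normcZ // normcX.
have gle z : 0 <= complex.Im z -> h * \sum_(k < J) normc (dpoly c N (pt k z)) ^+ 2 <= H / 2 * B ^+ 2.
  move=> z0; rewrite -Jh [J%:R * h]mulrC -mulrA ler_wpM2l //.
  have -> : J%:R * B ^+ 2 = \sum_(k < J) B ^+ 2 by rewrite sumr_const card_ord mulr_natl.
  apply: ler_sum => k _; rewrite lerXn2r ?nnegrE ?normc_ge0 //; first by lra.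
  by apply: le_trans hS; apply: dpoly_le; rewrite ptIm mulr_ge0 // ltW.
have ge0 z : 0 <= h * \sum_(k < J) normc (dpoly c N (pt k z)) ^+ 2.
  by rewrite mulr_ge0 // sumr_ge0 // => k _; exact: sqr_ge0.
have main z : 0 <= complex.Im z -> sum_norms J g z <= T.
  apply: max_principle_halfplane.
  - move=> k w w0; apply: taylor2M.
      apply: taylor2M; first exact: taylor2_cst.
      have hp : taylor2 (pt k) w.
        by apply: taylor2D; [apply: taylor2M; [exact: taylor2_cst|exact: taylor2_id]|exact: taylor2_cst].
      have hq : taylor2 (fun z => dpoly c N (pt k z)) w.
        by apply: taylor2_sum => n; apply: taylor2M; [exact: taylor2_cst|exact: taylor2_expi].
      exact: (taylor2M hq hq).
    apply: taylor2_cexp; apply: taylor2M; first exact: taylor2_cst.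
    exact: (taylor2M (taylor2_cayley w0) (taylor2_cayley w0)).
  - move=> x; rewrite gE ReZ Re_cayley2_real.
    have u0 : 0 < x ^+ 2 + 1 by rewrite ltr_wpDl ?sqr_ge0.
    have u2 : 1 <= (x ^+ 2 + 1) ^+ 2 by rewrite exprn_ege1 // lerDr sqr_ge0.
    have [x1|x1] := leP (x ^+ 2) 1.
      apply: (@le_trans _ _ (T * expR (- A) * expR A)); last by rewrite -mulrA -expRD addNr expR0 mulr1.
      apply: ler_pM; rewrite ?expR_ge0 //; last first.
        rewrite ler_expR ler_piMr // ler_pdivrMr ?exprn_gt0 // mul1r.
        by have := sqr_ge0 x; lra.
      have x1' : -1 <= x <= 1 by rewrite -ler_norml -(@expr_le1 _ 2) // real_normK ?num_real.
      apply: le_trans (hd (l * x + l) _); last first.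
        by case/andP: x1' => xl xr; apply/andP; split; rewrite /l; nra.
      rewrite /grid_square ler_wpM2l // ler_sum // => k _.
      rewrite (_ : pt k x%:C = (l * x + l + k%:R * h)%:C) // /pt -rmorphM -rmorphD.
      by congr (_ %:C); ring.
    apply: (@le_trans _ _ (H / 2 * B ^+ 2 * 1)); last first.
      by move: T0; rewrite /T mulr1; set t := H / 2 * B ^+ 2; lra.
    apply: ler_pM; rewrite ?expR_ge0 ?gle //.
    rewrite -[leRHS]expR0 ler_expR mulr_ge0_le0 //.
    by rewrite ler_pdivrMr ?exprn_gt0 // mul0r; lra.
  - move=> e e0; exists (A + 1) => w w0 wA.
    have wp : 0 < normc w by lra.
    apply: (@le_trans _ _ T); last by rewrite lerDl ltW.
    rewrite gE.
    apply: (@le_trans _ _ (H / 2 * B ^+ 2 * 4)); last by rewrite /T mulrC.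
    apply: ler_pM; rewrite ?expR_ge0 ?gle //.
    rewrite -normc_cexp; apply: normc_cexp_le4.
    rewrite /W normcZ // normcX expr2.
    apply: (@le_trans _ _ (A * ((normc w)^-1 * 1))).
      by rewrite ler_wpM2l // ler_pM ?normc_ge0 // ?cayley_decay ?cayley_le1.
    by rewrite mulr1 ler_pdivrMr // mul1r; lra.
have := main (0 +i* Y) Y0; rewrite gE ReZ Re_cayley2_imag //.
have -> : A * (1 + Y) ^- 2 = ln (16 * B ^+ 2) + 1.
  by rewrite /A mulrAC mulfV ?mul1r // gt_eqF.
rewrite expRD lnK ?posrE; last by rewrite mulr_gt0 ?exprn_gt0 //; lra.
have low : H / 8 <= h * \sum_(k < J) normc (dpoly c N (pt k (0 +i* Y))) ^+ 2.
  have -> : H / 8 = h * (J%:R * (1 / 2) ^+ 2).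
    by rewrite mulrA [h * _]mulrC Jh; field.
  rewrite ler_wpM2l //.
  have -> : J%:R * (1 / 2) ^+ 2 = \sum_(k < J) (1 / 2) ^+ 2 :> R by rewrite sumr_const card_ord mulr_natl.
  apply: ler_sum => k _; rewrite lerXn2r ?nnegrE ?normc_ge0 //.
  apply: (dpoly_upper_ge N1 c1 hM); rewrite ptIm /= ?(mulr_ge0 (ltW ll0) Y0) //.
  have -> : ln 2 * (l * Y) = 2 * M by rewrite /Y; field; rewrite !gt_eqF.
  lra.
have e2 : 2 <= expR (1 : R) by apply: le_trans (expR_ge1Dx 1); lra.
apply/negP; rewrite -ltNge.
have h8 : 0 < H / 8 by rewrite divr_gt0.
have b0 : 0 < 16 * B ^+ 2 by rewrite mulr_gt0 ?exprn_gt0 //; lra.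
apply: (@lt_le_trans _ _ (H / 8 * (16 * B ^+ 2 * 2))); last first.
  by apply: ler_pM; [exact: ltW|rewrite mulr_ge0 ?(ltW b0)|exact: low|rewrite ler_wpM2l ?(ltW b0)].
rewrite /T.
have -> : H / 8 * (16 * B ^+ 2 * 2) = 4 * (H / 2 * B ^+ 2) + 2 * (H * B ^+ 2) by field.
by rewrite ltrDl !mulr_gt0 ?exprn_gt0 //; lra.
Qed.

(** * Convergent sums and Ingham's multiplier *)

Lemma sum_inv_sqr_le2 (R : realType) (J : nat) : \sum_(k < J) (k.+1%:R ^+ 2)^-1 <= 2 :> R.
Proof.
case: J => [|J]; first by rewrite big_ord0.
suff : \sum_(k < J.+1) (k.+1%:R ^+ 2)^-1 <= 2 - J.+1%:R^-1 :> R.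
  by move/le_trans; apply; rewrite gerBl invr_ge0.
elim: J => [|J IH]; first by rewrite big_ord_recr big_ord0 /= expr1n invr1; lra.
rewrite big_ord_recr /=; apply: le_trans (lerD IH (lexx _)) _.
have J0 : 0 < J.+1%:R :> R by rewrite ltr0n.
rewrite -[J.+2%:R]natr1; move: (J.+1%:R : R) J0 => x x0.
have x1 : 0 < x + 1 by lra.
rewrite -subr_ge0.
have -> : 2 - (x + 1)^-1 - (2 - x^-1 + ((x + 1) ^+ 2)^-1) = (x * (x + 1) ^+ 2)^-1.
  by field; rewrite !gt_eqF.
by rewrite invr_ge0 mulr_ge0 ?sqr_ge0 // ltW.
Qed.

Lemma sum_inv_pow2_le2 (R : realType) (J : nat) : \sum_(0 <= k < J) ((2 ^ k)%:R)^-1 <= 2 :> R.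
Proof.
suff : \sum_(0 <= k < J) ((2 ^ k)%:R)^-1 = 2 - 2 / (2 ^ J)%:R :> R.
  by move=> ->; rewrite gerBl divr_ge0.
elim: J => [|J IH]; first by rewrite big_geq // expn0; lra.
rewrite big_nat_recr //= IH expnS natrM.
have : 0 < (2 ^ J)%:R :> R by rewrite ltr0n expn_gt0.
by move: ((2 ^ J)%:R : R) => x x0; field; rewrite gt_eqF.
Qed.

(** Condensation applied to the constant function e, whose logarithm is 1. *)
Lemma sum_inv_nlogn2_bounded (R : realType) :
  exists C : R, forall N, \sum_(2 <= n < N) (n%:R * ln n%:R ^+ 2)^-1 <= C.
Proof.
have [|||C hC] := @bounded_dyadic_convergent R (fun=> expR 1) 2.
- by move=> n _; exact: expR_gt0.
- by [].
- move=> J; apply: le_trans (sum_inv_sqr_le2 R J); apply: ler_sum => k _.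
  rewrite ler_piMl ?invr_ge0 ?sqr_ge0 // expRK ge_max ler01 /= ge_min lexx //.
exists C => N; apply: le_trans (hC N); apply: ler_sum => n _.
by rewrite /log_weight expRK mul1r.
Qed.

Lemma double_dyadic (n N k0 : nat) : (2 ^ (2 ^ k0) <= n <= N)%N ->
  exists2 k, (k0 <= k < N)%N & (2 ^ (2 ^ k) <= n < 2 ^ (2 ^ k.+1))%N.
Proof.
move=> /andP[kn nN].
have n1 : (1 < n)%N by apply: leq_trans kn; rewrite -{1}(expn1 2) leq_exp2l // expn_gt0.
have n0 : (0 < n)%N by exact: ltnW.
pose t := trunc_log 2 n.
have t1 : (2 ^ t <= n)%N by exact: trunc_logP.
have t2 : (n < 2 ^ t.+1)%N by exact: trunc_log_ltn.
have t0 : (0 < t)%N by rewrite lt0n; apply: contraTneq t2 => ->; rewrite -leqNgt expn1.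
pose k := trunc_log 2 t.
have k1 : (2 ^ k <= t)%N by exact: trunc_logP.
have k2 : (t < 2 ^ k.+1)%N by exact: trunc_log_ltn.
have h1 : (2 ^ (2 ^ k) <= n)%N by apply: leq_trans t1; rewrite leq_exp2l.
have h2 : (n < 2 ^ (2 ^ k.+1))%N by apply: (leq_trans t2); rewrite leq_exp2l.
exists k; last by rewrite h1.
apply/andP; split.
  by have := leq_ltn_trans kn h2; rewrite ltn_exp2l // ltn_exp2l.
by apply: leq_trans nN; apply: leq_trans h1; apply: (ltn_trans (ltn_expl k (leqnn 2))); exact: ltn_expl.
Qed.

(* Ingham's construction: in the dyadic range 2^(2^k) <= n < 2^(2^(k+1)), each
   average of length 32 / 2^k gains a factor 1/e, and about log Phi of them
   are used; their total length is small by the convergence hypothesis. Two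
   more averages of length H / 16 gain the factor 1 / log^2 n. *)
Lemma ingham_multiplier (R : realType) (Phi : nat -> R) (H C : R) :
  (forall n, (2 <= n)%N -> 0 < Phi n) ->
  (forall m n, (2 <= m)%N -> (m <= n)%N -> Phi m <= Phi n) ->
  0 < H ->
  (forall K, \sum_(0 <= k < K) Num.max 0 (ln (Phi (2 ^ (2 ^ k.+1))%N)) / (2 ^ k)%:R <= C) ->
  exists2 M : R, 0 <= M & forall N, (2 <= N)%N -> exists K, exists rs : seq R,
    [/\ (0 < K)%N, (forall r, r \in rs -> 0 <= r), \sum_(r <- rs) r <= H / 4 &
     forall a, admissible Phi N a ->
      \sum_(2 <= n < N.+1) normc (coefs a n * \prod_(r <- rs) avg_mult K r (ln n%:R)) <= M].
Proof.
move=> Phi0 Phim H0 hC.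
pose psi k := Num.max 0 (ln (Phi (2 ^ (2 ^ k.+1))%N)).
have psi0 k : 0 <= psi k by rewrite /psi le_max lexx.
(* Up to the factor 32, this bounds the length spent on range k: at most psi k + 1 averages,
   rounding included, of length 32 / 2^k. *)
pose a k := psi k / (2 ^ k)%:R + ((2 ^ k)%:R)^-1.
have P2 k : 0 < (2 ^ k)%:R :> R by rewrite ltr0n expn_gt0.
have a0 k : 0 <= a k by rewrite addr_ge0 ?divr_ge0 ?invr_ge0.
have haC K : \sum_(0 <= k < K) a k <= C + 2.
  by rewrite big_split /=; apply: lerD; [exact: hC|exact: sum_inv_pow2_le2].
(* The tail is at most H / 256; times 32 this is H / 8, and the two averages of length H / 16 bring
   the total to H / 4. *)
have [k0 hk0] := bounded_sum_tail a0 haC (divr_gt0 (divr_gt0 H0 (ltr0Sn R 7)) (ltr0Sn R 31)).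
pose n0 := (2 ^ (2 ^ k0))%N.
have [S hS] := sum_inv_nlogn2_bounded R.
have S0 : 0 <= S by have := hS 0%N; rewrite big_geq.
exists (\sum_(2 <= n < n0) Phi n / n%:R + (64 / H) ^+ 2 * S).
  apply: addr_ge0; last by apply: mulr_ge0 => //; exact: sqr_ge0.
  rewrite big_nat sumr_ge0 // => n /andP[n2 _].
  by rewrite divr_ge0 // ltW // Phi0.
move=> N N2.
pose m k := (Num.truncn (psi k)).+1.
pose rho k : R := 32 / (2 ^ k)%:R.
have rho0 k : 0 < rho k by rewrite divr_gt0.
have m1 k : (m k)%:R <= psi k + 1.
  by rewrite /m -natr1 lerD2r truncn_le.
have m2 k : psi k <= (m k)%:R by apply: ltW; exact: truncnS_gt.
have lnN : 0 < ln N%:R :> R by exact: ln_nat_gt0.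
(* Fine enough for [avg_mult_le] at all lengths r <= 32 + H and all n <= N. *)
pose K := (Num.truncn (8 * (32 + H) * ln N%:R)).+1.
have KR : 0 < K%:R :> R by rewrite ltr0n.
pose rs := [:: H / 16; H / 16] ++ flatten [seq nseq (m k) (rho k) | k <- index_iota k0 N].
exists K, rs; split => //.
- move=> r; rewrite /rs mem_cat !inE => /orP[/orP[/eqP->|/eqP->]|]; rewrite ?divr_ge0 ?(ltW H0) //.
  by move=> /flatten_mapP[k _]; rewrite mem_nseq => /andP[_ /eqP ->]; exact: ltW.
- rewrite /rs big_cat !big_cons big_nil big_flatten big_map.
  apply: (@le_trans _ _ (H / 16 + (H / 16 + 0) + \sum_(k0 <= k < N) 32 * a k)).
    rewrite lerD2l; apply: ler_sum => k _; rewrite big_nseq.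
    have -> : iter (m k) (+%R (rho k)) 0 = (m k)%:R * rho k by rewrite iter_addr_0 mulr_natl.
    have -> : 32 * a k = (psi k + 1) * rho k by rewrite /a /rho; field; rewrite gt_eqF.
    by rewrite ler_wpM2r // ltW.
  by rewrite -mulr_sumr; have := hk0 N; lra.
move=> c hc.
pose mm (n : nat) (r : R) : R := normc (avg_mult K r (ln n%:R)).
have mm0 n r : 0 <= mm n r by exact: normc_ge0.
have mm1 n r : mm n r <= 1 by exact: avg_mult_le1.
have prodE n : normc (\prod_(r <- rs) avg_mult K r (ln n%:R)) =
   mm n (H / 16) * mm n (H / 16) * \prod_(k0 <= k < N) mm n (rho k) ^+ m k.
  have -> : normc (\prod_(r <- rs) avg_mult K r (ln n%:R)) = \prod_(r <- rs) mm n r.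
    elim: (rs) => [|r s IH]; first by rewrite !big_nil normc1.
    by rewrite !big_cons normcM IH.
  rewrite /rs big_cat !big_cons big_nil big_flatten big_map; congr (_ * _); first by rewrite /= mulr1.
  by apply: eq_bigr => k _; rewrite big_nseq iter_mulr_1.
have prod1 n (P : pred nat) : 0 <= \prod_(k0 <= k < N | P k) mm n (rho k) ^+ m k <= 1.
  apply/andP; split; first by apply: prodr_ge0 => k _; rewrite exprn_ge0.
  by apply: Num.Theory.prodr_ile1 => k _; rewrite exprn_ge0 // exprn_ile1.
have mmle n r : (2 <= n <= N)%N -> 0 < r -> r <= 32 + H -> mm n r <= 4 / (r * ln n%:R).
  move=> /andP[n2 nN] r0 rH; apply: avg_mult_le => //; first exact: ln_nat_gt0.
  rewrite ler_pdivrMr //.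
  have h1 : r * ln n%:R <= (32 + H) * ln N%:R.
    apply: ler_pM => //; rewrite ?(ltW r0) ?(ltW (ln_nat_gt0 R n2)) //.
    by rewrite ler_ln ?posrE ?ltr0n ?ler_nat // ltnW.
  have := truncnS_gt (8 * (32 + H) * ln N%:R); rewrite -/K => h2.
  by move: h1 h2; rewrite -mulrA; set x := (32 + H) * _; lra.
have cn n : (2 <= n <= N)%N -> normc (coefs c n) <= Phi n / n%:R.
  move=> /[dup] hn /andP[n2 _]; rewrite /coefs; have -> : (n == 1%N) = false by case: n n2 {hn} => [|[|]].
  by rewrite normcM normcV normc_nat ler_wpM2r ?invr_ge0 // hc.
have Pn0 n : (2 <= n)%N -> 0 <= Phi n / n%:R by move=> n2; rewrite divr_ge0 // ltW // Phi0.
apply: (@le_trans _ _ (\sum_(2 <= n < N.+1) ((if (n < n0)%N then Phi n / n%:R else 0) +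
    (64 / H) ^+ 2 * (n%:R * ln n%:R ^+ 2)^-1))).
  apply: ler_sum_nat => n /andP[n2 nN]; have hn : (2 <= n <= N)%N by rewrite n2.
  have d0 : 0 <= (64 / H) ^+ 2 * (n%:R * ln n%:R ^+ 2)^-1.
    by apply: mulr_ge0; rewrite ?sqr_ge0 // invr_ge0 mulr_ge0 ?sqr_ge0.
  rewrite normcM prodE; case: ltnP => nn0.
    apply: (@le_trans _ _ (Phi n / n%:R)); last by rewrite lerDl.
    apply: le_trans (cn n hn); rewrite ler_piMr ?normc_ge0 //.
    have /andP[p0 p1] := prod1 n xpredT.
    by rewrite mulr_ile1 ?mulr_ge0 // mulr_ile1.
  rewrite add0r.
  have [k /andP[k0k kN] /andP[kn nk]] := @double_dyadic n N k0 (introT andP (conj nn0 nN)).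
  have ln0 := ln_nat_gt0 R n2.
  have n00 : 0 < n%:R :> R by rewrite ltr0n ltnW.
  have b1 : mm n (H / 16) <= 64 / (H * ln n%:R).
    apply: (le_trans (mmle n (H / 16) hn _ _)); rewrite ?divr_gt0 //; first by lra.
    by rewrite le_eqVlt; apply/orP; left; apply/eqP; field; rewrite !gt_eqF.
  (* log n >= 2^k ln 2 >= 2^k / 2, so rho k log n >= 16 and the multiplier is at most 1/4 <= 1/e. *)
  have b2 : mm n (rho k) <= expR (- 1).
    apply: (le_trans (mmle n (rho k) hn (rho0 k) _)).
      rewrite /rho ler_pdivrMr //; have : 1 <= (2 ^ k)%:R :> R by rewrite ler1n expn_gt0.
      by move: ((2 ^ k)%:R : R) => x x1; nra.
    apply: (@le_trans _ _ (1 / 4)); last first.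
      rewrite expRN -[1 / 4]invrK lef_pV2 ?posrE ?invr_gt0 ?expR_gt0 ?divr_gt0 //.
      by rewrite div1r invrK; apply: expR_le4; rewrite normr1.
    have l2 := ln2_bounds R.
    have hl : (2 ^ k)%:R * (1 / 2) <= ln n%:R :> R.
      apply: (@le_trans _ _ (ln (2 ^ (2 ^ k))%:R)).
        by rewrite ln_pow2 ler_wpM2l //; lra.
      by rewrite ler_ln ?posrE ?ltr0n ?expn_gt0 ?ler_nat ?(ltnW n2).
    rewrite ler_pdivrMr ?mulr_gt0 // /rho.
    have -> : 1 / 4 * (32 / (2 ^ k)%:R * ln n%:R) = 8 * (ln n%:R / (2 ^ k)%:R) :> R by field; rewrite gt_eqF.
    have : 1 / 2 <= ln n%:R / (2 ^ k)%:R :> R by rewrite ler_pdivlMr // mulrC.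
    lra.
  (* n < 2^(2^(k+1)) gives log Phi(n) <= psi k <= m k; the other ranges contribute factors of at
     most 1. *)
  have b3 : \prod_(k0 <= k < N) mm n (rho k) ^+ m k <= (Phi n)^-1.
    rewrite (@bigD1_seq _ _ _ _ _ k) ?iota_uniq ?mem_index_iota ?k0k //=.
    have /andP[p0 p1] := prod1 n (fun i => i != k).
    apply: (@le_trans _ _ (expR (- 1) ^+ m k * 1)).
      by apply: ler_pM => //; rewrite ?exprn_ge0 // lerXn2r ?nnegrE ?expR_ge0.
    rewrite mulr1 -expRM_natl mulrN mulr1 -[leRHS]lnK ?posrE ?invr_gt0 ?Phi0 //.
    rewrite ler_expR lnV ?posrE ?Phi0 // lerN2; apply: le_trans (m2 k).
    rewrite /psi le_max ler_ln ?posrE ?Phi0 ?Phim ?orbT //; first exact: ltnW.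
    by apply: leq_trans n2 (ltnW nk).
  apply: (@le_trans _ _ (Phi n / n%:R * (64 / (H * ln n%:R) * (64 / (H * ln n%:R)) * (Phi n)^-1))).
    apply: ler_pM; rewrite ?normc_ge0 ?cn //.
      by have /andP[p0 _] := prod1 n xpredT; rewrite !mulr_ge0.
    by apply: ler_pM => //; [rewrite mulr_ge0|have /andP[] := prod1 n xpredT|apply: ler_pM].
  rewrite le_eqVlt; apply/orP; left; apply/eqP.
  by field; rewrite !gt_eqF // Phi0.
rewrite big_split /= -mulr_sumr lerD //; last first.
  by rewrite ler_wpM2l ?sqr_ge0.
have n02 : (2 <= n0)%N by rewrite /n0 -{1}(expn1 2) leq_exp2l // expn_gt0.
rewrite -big_mkcond /=.
have pos i j (P : pred nat) : (2 <= i)%N -> 0 <= \sum_(i <= n < j | P n) Phi n / n%:R.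
  move=> i2; rewrite big_nat_cond sumr_ge0 // => n /andP[/andP[n2 _] _].
  by apply: Pn0; exact: leq_trans n2.
have [h|h] := leqP n0 N.+1.
  rewrite (big_cat_nat n02 h) /= [X in _ + X]big_nat_cond [X in _ + X]big_pred0 ?addr0; last first.
    by move=> n; case: (leqP n0 n) => ?; rewrite ?andbF.
  by rewrite big_nat_cond [leRHS]big_nat_cond le_eqVlt; apply/orP; left; apply/eqP; apply: eq_bigl => n; case: (n < n0)%N; rewrite ?andbF ?andbT.
rewrite [leRHS](@big_cat_nat _ _ _ N.+1) //= ; last exact: ltnW.
apply: (@le_trans _ _ (\sum_(2 <= n < N.+1) Phi n / n%:R)).
  by rewrite [leRHS](bigID (fun n => (n < n0)%N)) /= lerDl pos.
by rewrite lerDl pos // ltnW.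
exact: leqW.
Qed.

(** If the mean square were below d / 2, fine Riemann sums over all intervals of length H / 2 in
    [0, H] would be at most [d]. The averages use up H / 4 of the starting points [0, H/2] and leave
    what [one_sided_lower_bound] forbids. *)
Lemma convergent_lower_bound (R : realType) (Phi : nat -> R) (H B : R) :
  (forall n, (2 <= n)%N -> 0 < Phi n) ->
  (forall m n, (2 <= m)%N -> (m <= n)%N -> Phi m <= Phi n) ->
  0 < H -> (forall N, \sum_(2 <= n < N) log_weight Phi n <= B) ->
  exists2 d : R, 0 < d & forall N a, (2 <= N)%N -> admissible Phi N a ->
    d <= mean_square H N a.
Proof.
move=> Phi0 Phim H0 hB.
have [C hC] := convergent_dyadic_bound Phi0 Phim hB.
have [M M0 hM] := ingham_multiplier Phi0 Phim H0 hC.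
have [d d0 hd] := one_sided_lower_bound H0 M0.
exists (d / 2); first by rewrite divr_gt0.
move=> N a N2 ha; rewrite leNgt; apply/negP => hI.
have N1 : (1 <= N)%N by exact: ltnW.
have [K [rs [K0 rs0 hrs hsum]]] := hM N N2.
pose L := 2 * sum_coefs (coefs a) N * lip_const (coefs a) N.
have L0 : 0 <= L by rewrite /L !mulr_ge0 ?sum_coefs_ge0 ?lip_const_ge0.
pose D := L * (H / 2) ^+ 2.
have D0 : 0 <= D by rewrite mulr_ge0 // sqr_ge0.
pose J := (Num.truncn (D / (d / 2))).+1.
have JR : 0 < J%:R :> R by rewrite ltr0n.
have DJ : D / J%:R <= d / 2.
  rewrite ler_pdivrMr // mulrC -ler_pdivrMr ?divr_gt0 //.
  by apply: ltW; exact: truncnS_gt.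
pose h := H / 2 / J%:R.
have h0 : 0 <= h by rewrite !divr_ge0 // ltW.
have Jh : J%:R * h = H / 2 by rewrite /h mulrC divfK // gt_eqF.
pose c n := coefs a n * \prod_(r <- rs) avg_mult K r (ln n%:R).
have c1 : c 1%N = 1.
  rewrite /c /coefs mul1r; apply: big1 => r _.
  by rewrite -[1%:R]/(1 : R) ln1; exact: avg_mult0.
apply: (hd c N J h N1 (ltn0Sn _) h0 Jh c1 (hsum a ha)).
move=> y /andP[y0 yH].
apply: (@grid_square_avgs R h d J N K rs (H / 2)) => //; last by rewrite y0; lra.
move=> {y0 yH}y /andP[y0 yH].
have hg := lipschitz_sqr_dpoly (coefs a) N 0; rewrite -/L in hg.
have := @riemann_sum R _ L y h J hg L0 h0; rewrite Jh => /ler_normlP[+ _].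
rewrite opprB lerBlDr.
have -> : J%:R * (L * h ^+ 2) = D / J%:R by rewrite /h /D; field; rewrite gt_eqF.
move=> hr; apply: (@le_trans _ _ (D / J%:R + mean_square H N a)); last by lra.
have yH2 : y + H / 2 <= H by move: yH; lra.
have yy : y <= y + H / 2 by rewrite lerDl divr_ge0 // ltW.
have hI2 := Rintegral_le_itv hg (fun t => sqr_ge0 _) y0 yy yH2.
rewrite mean_squareE //; apply: (le_trans _ (lerD (lexx _) hI2)).
apply: le_trans hr; rewrite /grid_square ler_wpM2l // ler_sum // => k _.
by rewrite add0r.
Qed.

Local Close Scope complex_scope.

Theorem theorem1 (R : realType) (Phi : nat -> R) (H : R)
  (Phi_gt0 : forall n, (2 <= n)%N -> 0 < Phi n)
  (Phi_increasing : forall m n, (2 <= m)%N -> (m <= n)%N -> Phi m <= Phi n)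
  (H_gt0 : 0 < H) :
  exists mu : nat -> R,
    [/\ forall N, (2 <= N)%N ->
          is_minimum (mean_square H N @` admissible Phi N) (mu N),
        cvgn mu &
        (0 < limn mu <->
         (\sum_(2 <= n <oo) (ln (Phi n) / (n%:R * ln n%:R ^+ 2))%:E < +oo)%E)].
Proof.
(* [maxn N 2] makes [mu] defined and monotone at every natural number. *)
have hmin N : exists x, is_minimum (mean_square H (maxn N 2) @` admissible Phi (maxn N 2)) x.
  have N1 : (1 <= maxn N 2)%N by rewrite leq_max orbT.
  have C0 : 0 <= 2 * bound_coefs Phi (maxn N 2) * H.
    by rewrite !mulr_ge0 ?bound_coefs_ge0 // ltW.
  have [a ha hm] := admissible_minimizer Phi_gt0 C0
    (fun a b => @mean_square_lipschitz R Phi H a b (maxn N 2) N1 (ltW H_gt0)).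
  exists (mean_square H (maxn N 2) a); split; first by exists a.
  by move=> _ [b hb <-]; exact: hm.
have [mu hmu] := choice hmin.
have mu_le N a : (2 <= N)%N -> admissible Phi N a -> mu N <= mean_square H N a.
  by move=> N2 ha; have [_] := hmu N; rewrite (maxn_idPl N2); apply; exists a.
have mu_ge0 N : 0 <= mu N.
  by have [[a _ <-] _] := hmu N; apply: Rintegral_ge0 => t _; exact: sqr_ge0.
have mu_decr : {homo mu : n m / (n <= m)%N >-> m <= n}.
  move=> n m nm; have [[a ha <-] _] := hmu n; have [_] := hmu m; apply.
  set p := maxn n 2 in ha *; set q := maxn m 2.
  have pq : (p <= q)%N by rewrite /p /q geq_max !leq_max nm leqnn orbT.
  have p2 : (2 <= p)%N by rewrite leq_max orbT.
  (* Padding with zeros does not change the polynomial, so minima decrease with N. *)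
  pose b k := if (k <= p)%N then a k else 0.
  exists b.
    move=> k /andP[k2 kq]; rewrite /b; case: ifP => kp; first by apply: ha; rewrite k2.
    by rewrite normc0 ltW // Phi_gt0.
  apply: eq_Rintegral => t _; congr (normc (1 + _) ^+ 2).
  rewrite (big_cat_nat (leqW p2) (_ : p.+1 <= q.+1)%N) //= [X in _ + X]big_nat_cond [X in _ + X]big1 ?addr0.
    by apply: eq_big_nat => k /andP[_ kp]; rewrite /b -ltnS kp.
  by move=> k /andP[/andP[pk _] _]; rewrite /b leqNgt pk mul0r.
have mu_cvg : cvgn mu.
  by apply: nonincreasing_is_cvgn => //; exists 0 => _ [n _ <-].
exists mu; split => //.
  by move=> N N2; have := hmu N; rewrite (maxn_idPl N2).
have lim_le N : limn mu <= mu N by exact: nonincreasing_cvgn_ge.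
rewrite (series_lty_bounded (log_weight_sign Phi_gt0 Phi_increasing)).
split=> [lim0|[B hB]].
  have [B hB] := divergent_bound Phi_gt0 Phi_increasing H_gt0 lim0
    (fun N a N2 ha => le_trans (lim_le N) (mu_le N a N2 ha)).
  exact: bounded_dyadic_convergent hB.
have [d d0 hd] := convergent_lower_bound Phi_gt0 Phi_increasing H_gt0 hB.
apply: (lt_le_trans d0); apply: limr_ge => //; near=> N.
have N2 : (2 <= N)%N by near: N; exists 2.
have [[a ha <-] _] := hmu N; move: ha; rewrite (maxn_idPl N2) => ha.
exact: hd.
Unshelve. all: by end_near. Qed.
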